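(* Assume condition (A1) (stated in the context). Also assume that $j$ is radial, i.e. $j(y)=j(|y|)$, and radially decreasing. Then for any bounded, open set $D\subset\mathbb{R}^d$ with $|\partial D|=0$ we have $$\lambda_D\ge\lambda_B,$$ where $B$ is the ball around $0$ satisfying $|B|=|D|$, and $\lambda_D,\lambda_B$ are the generalized principal eigenvalues of $L$ (with zero potential) in $D$ and $B$, defined in the context.
   Context: Operator: $j:\mathbb{R}^d\setminus\{0\}\to[0,\infty)$ is a fixed measurable function with $\int_{\mathbb{R}^d}(1\wedge|y|^2)j(y)\,dy<\infty$, and $$Lu(x)=\Delta u(x)+\int_{\mathbb{R}^d}\big(u(x+y)-u(x)-\mathbf 1_{\{|y|\le1\}}\,y\cdot\nabla u(x)\big)j(y)\,dy.$$ Exponent and condition (A1): $\psi(z)=\int_{\mathbb{R}^d}(1-e^{iz\cdot\xi}+\mathbf 1_{\{|\xi|\le1\}}\,iz\cdot\xi)\,j(\xi)\,d\xi$. Condition (A1): for some constant $C>0$, $|\mathrm{Im}\,\psi(p)|\le C(|p|^2+|\mathrm{Re}\,\psi(p)|)$ for all $p\in\mathbb{R}^d$, and for all $r>0$, $\sup_{|p|\le r}(|p|^2+\mathrm{Re}\,\psi(p))>0$. Viscosity supersolutions: functions are Borel measurable. A bounded $u:\mathbb{R}^d\to\mathbb{R}$, lower semicontinuous in $\bar D$, satisfies $Lu\le f$ in $D$ in the viscosity sense if for every $x\in D$, every neighbourhood $N_x$ of $x$ in $D$ and every $\varphi\in C^2(\overline{N_x})$ such that $\varphi-u$ attains maximum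 $0$ in $N_x$ at $x$, the function $v$ equal to $\varphi$ in $N_x$ and to $u$ elsewhere satisfies $Lv(x)\le f(x)$. Principal eigenvalue: $C_+(D)$ is the set of positive continuous functions in $D$, $C_{b,+}(\mathbb{R}^d)$ the set of bounded non-negative continuous functions on $\mathbb{R}^d$, and $$\lambda_D=\sup\{\lambda:\ \exists\, v\in C_+(D)\cap C_{b,+}(\mathbb{R}^d)\ \text{with}\ Lv\le-\lambda v\ \text{in } D\ \text{(viscosity sense)}\}.$$ $|\cdot|$ of a set denotes Lebesgue measure. *)

(* Defs.v *)
From HB Require Import structures.
From mathcomp Require Import all_boot all_order all_algebra.
From mathcomp Require Import complex.
From mathcomp Require Import all_classical all_reals all_analysis.
From mathcomp Require Import measurable_realfun.

Set Implicit Arguments.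
Unset Strict Implicit.
Unset Printing Implicit Defensive.

Import Order.TTheory GRing.Theory Num.Theory.
Import numFieldNormedType.Exports.

Local Open Scope classical_set_scope.
Local Open Scope ring_scope.

(* 'rV[R]_n carries its Borel sigma-algebra. *)
HB.instance Definition _ (R : realType) (n : nat) :=
  Measurable.copy 'rV[R]_n (g_sigma_algebraType (@open 'rV[R]_n)).

Section measurable_rV.
Context {R : realType}.

Lemma open_measurable_rV n (U : set 'rV[R]_n) : open U -> measurable U.
Proof. by move=> oU; exact: sub_sigma_algebra. Qed.

Lemma measurable_coord n (i : 'I_n) :
  measurable_fun [set: 'rV[R]_n] (fun v => v ord0 i : R).
Proof.
apply: (measurability _ (RGenOInfty.measurableE R)) => // _ [_ [a ->] <-].
rewrite setTI; apply: open_measurable_rV.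
by apply: open_comp; [move=> v _; exact: coord_continuous|exact: rray_open].
Qed.

Lemma measurable_fun_rV d (T : measurableType d) n (f : T -> 'rV[R]_n) :
  (forall i, measurable_fun setT (fun t => f t ord0 i : R)) ->
  measurable_fun setT f.
Proof.
move=> mf; apply: (@measurability _ _ _ _ _ _ (@open 'rV[R]_n)) => //.
move=> _ [U oU <-]; rewrite setTI.
pose K := ('rV[rat]_n * nat)%type.
pose c (q : 'rV[rat]_n) : 'rV[R]_n := map_mx ratr q.
pose V (k : K) : set T :=
  if `[< ball (c k.1) k.2.+1%:R^-1 `<=` U >]
  then f @^-1` ball (c k.1) k.2.+1%:R^-1 else set0.
have -> : f @^-1` U = \bigcup_(k in [set: K]) V k.
  apply/seteqP; split => t /=; last first.
    by move=> [k _]; rewrite /V; case: asboolP => // + /=; exact.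
  move=> Uft; have := open_nbhs_nbhs (conj oU Uft).
  move=> /nbhs_ballP[e /= e0 feU].
  have [m me] : exists m : nat, m.+1%:R^-1 < e / 2 :> R.
    have e2 : 0 < e / 2 by rewrite divr_gt0.
    by have [m _ /(_ m (leqnn m))] := near_infty_natSinv_lt (PosNum e2); exists m.
  have m0 : 0 < m.+1%:R^-1 :> R by [].
  have hq (i : 'I_n) : exists q : rat, ball (f t ord0 i : R) m.+1%:R^-1 (ratr q).
    have [y [yb [q _ qy]]] := @dense_rat R (ball (f t ord0 i : R) m.+1%:R^-1)
      (ex_intro _ _ (ballxx _ m0)) (ball_open _ _).
    by exists q; rewrite qy.
  have {hq}[q hq] := choice hq.
  pose q' : 'rV[rat]_n := \row_i q i.
  have cq : ball (f t) m.+1%:R^-1 (c q').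
    by split=> // i j; rewrite !mxE ord1; exact: hq.
  exists (q', m) => //; rewrite /V /=; case: asboolP => [_|].
    by apply: ball_sym.
  case; apply: subset_trans feU => y yc.
  have := ball_triangle cq yc; apply: le_ball.
  by rewrite (splitr e) lerD// ltW.
apply: countable_bigcupT_measurable => [|[q m]]; first exact: countableP.
rewrite /V /=; case: ifP => // _.
have -> : f @^-1` ball (c q) m.+1%:R^-1 =
    \bigcap_(i in [set: 'I_n])
      (fun t => f t ord0 i : R) @^-1` ball (c q ord0 i : R) m.+1%:R^-1.
  apply/seteqP; split => t /=.
    by move=> [_ h] i _; exact: h.
  by move=> h; split => // i j; rewrite ord1; exact: h.
apply: fin_bigcap_measurable => [|i _]; first exact: finite_finset.
rewrite -[X in measurable X]setTI; apply: mf => //.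
exact: measurable_ball.
Qed.

End measurable_rV.

Section lebesgue_rV.
Context {R : realType}.

Definition cons_rV n (p : measurableTypeR R * 'rV[R]_n) : 'rV[R]_n.+1 :=
  row_mx (p.1)%:M p.2.

Lemma cons_rV0 n p : @cons_rV n p ord0 ord0 = p.1.
Proof.
have := row_mxEl (p.1)%:M p.2 ord0 (ord0 : 'I_1); rewrite [RHS]mxE mulr1n => <-.
by congr (row_mx _ _ _ _); exact/val_inj.
Qed.

Lemma cons_rVS n p i : @cons_rV n p ord0 (lift ord0 i) = p.2 ord0 i.
Proof.
rewrite -(row_mxEr (p.1)%:M p.2 ord0 i).
by congr (row_mx _ _ _ _); exact/val_inj.
Qed.

Lemma measurable_cons_rV n : measurable_fun setT (@cons_rV n).
Proof.
apply: measurable_fun_rV => i; case: (unliftP ord0 i) => [k ->|->].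
  rewrite (_ : (fun _ => _) = (fun v : 'rV[R]_n => v ord0 k : R) \o snd).
    exact: measurableT_comp (measurable_coord k) measurable_snd.
  by apply/funext => p /=; rewrite cons_rVS.
rewrite (_ : (fun _ => _) = fst); first exact: measurable_fst.
by apply/funext => p /=; rewrite cons_rV0.
Qed.

Definition uncons_rV n (v : 'rV[R]_n.+1) : measurableTypeR R * 'rV[R]_n :=
  (v ord0 ord0, \row_i v ord0 (lift ord0 i)).

Lemma cons_rVK n : cancel (@cons_rV n) (@uncons_rV n).
Proof.
move=> [x v]; rewrite /uncons_rV cons_rV0; congr pair.
by apply/rowP => i; rewrite mxE cons_rVS.
Qed.

Lemma measurable_uncons_rV n : measurable_fun setT (@uncons_rV n).
Proof.
apply/measurable_fun_pairP; split; first exact: measurable_coord.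
apply: measurable_fun_rV => i.
rewrite (_ : (fun _ => _) = (fun v : 'rV[R]_n.+1 => v ord0 (lift ord0 i) : R)).
  exact: measurable_coord.
by apply/funext => v /=; rewrite mxE.
Qed.

Section step.
Variables (n : nat) (mu : {sigma_finite_measure set 'rV[R]_n -> \bar R}).

Definition lebesgue_cons : set 'rV[R]_n.+1 -> \bar R :=
  pushforward (lebesgue_measure \x mu)%E (@cons_rV n).

Let lebesgue_cons0 : lebesgue_cons set0 = 0%E.
Proof. by rewrite /lebesgue_cons /pushforward preimage_set0 measure0. Qed.

Let lebesgue_cons_ge0 A : (0 <= lebesgue_cons A)%E.
Proof. exact: integral_ge0. Qed.

Let lebesgue_cons_sigma_additive : semi_sigma_additive lebesgue_cons.
Proof.
have mc := @measurable_cons_rV n.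
exact: (@measure_semi_sigma_additive _ _ _ (pushforward _ (@cons_rV n))).
Qed.

HB.instance Definition _ := isMeasure.Build _ _ _ lebesgue_cons
  lebesgue_cons0 lebesgue_cons_ge0 lebesgue_cons_sigma_additive.

Let lebesgue_cons_sigma_finite : sigma_finite setT lebesgue_cons.
Proof.
have /sigma_finiteP[F [FT ndF Foo]] := sigma_finiteT (@lebesgue_measure R).
have /sigma_finiteP[G [GT ndG Goo]] := sigma_finiteT mu.
exists (fun k => @uncons_rV n @^-1` (F k `*` G k)).
  rewrite -preimage_bigcup (_ : \bigcup_k _ = setT) ?preimage_setT//.
  rewrite -setXTT FT GT; apply/seteqP; split => -[x v] /=.
    by move=> [k _ []]; split; exists k.
  move=> [[k _ Fk] [l _ Gl]]; exists (maxn k l) => //; split.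
    by move: x Fk; exact/subsetPset/ndF/leq_maxl.
  by move: v Gl; exact/subsetPset/ndG/leq_maxr.
move=> k; have [[mF Fk] [mG Gk]] := (Foo k, Goo k); split.
  rewrite -[X in measurable X]setTI; apply: measurable_uncons_rV => //.
  exact: measurableX.
rewrite /lebesgue_cons /pushforward -comp_preimage.
rewrite (_ : _ \o _ = id); last by apply/funext => p /=; rewrite cons_rVK.
by rewrite preimage_id product_measure1E// lte_mul_pinfty// ge0_fin_numE.
Qed.

HB.instance Definition _ := Measure_isSigmaFinite.Build _ _ _ lebesgue_cons
  lebesgue_cons_sigma_finite.

End step.

(* [lebesgue_rV n] is Lebesgue measure on R^n: the product of [n] copies of the
   one-dimensional one; see [lebesgue_rV_setX]. *)
Fixpoint lebesgue_rV n : {sigma_finite_measure set 'rV[R]_n -> \bar R} :=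
  if n is n'.+1 then lebesgue_cons (lebesgue_rV n') else \d_(0 : 'rV[R]_0).

Lemma lebesgue_rV_setX n (A : 'I_n -> set R) :
  (forall i, measurable (A i : set (measurableTypeR R))) ->
  lebesgue_rV n [set v | forall i, A i (v ord0 i)] =
  (\prod_(i < n) lebesgue_measure (A i))%E.
Proof.
elim: n A => [|n IHn] A mA.
  by rewrite big_ord0 /= diracE mem_set // => -[].
rewrite big_ord_recl -IHn //= /lebesgue_cons /pushforward.
rewrite -product_measure1E //; last first.
  rewrite [X in measurable X](_ : _ = \bigcap_(i in [set: 'I_n])
      ((fun v : 'rV[R]_n => v ord0 i : R) @^-1` A (lift ord0 i))).
    apply: fin_bigcap_measurable => [|i _]; first exact: finite_finset.
    by rewrite -[X in measurable X]setTI; apply: measurable_coord => //; exact: mA.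
  apply/seteqP; split => v /= h i; last exact: (h i I).
  by move=> _; exact: h.
congr (_ _); apply/seteqP; split => p /= h.
  split; first by have := h ord0; rewrite cons_rV0.
  by move=> i; have := h (lift ord0 i); rewrite cons_rVS.
move=> i; case: (unliftP ord0 i) => [k ->|->].
  by rewrite cons_rVS; exact: h.2.
by rewrite cons_rV0; exact: h.1.
Qed.

End lebesgue_rV.

(* The library norm `|x| on row vectors is the sup norm; [enorm] is the
   Euclidean one. Both induce the same topology and the same bounded sets. *)
Section euclidean.
Context {R : realType} {d : nat}.
Implicit Types (x y : 'rV[R]_d) (f : 'rV[R]_d -> R).

Definition edot x y : R := \sum_(i < d) x ord0 i * y ord0 i.

Definition enorm x : R := Num.sqrt (edot x x).

Definition eball (r : R) : set 'rV[R]_d := [set x | enorm x < r].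

Definition boundary (A : set 'rV[R]_d) : set 'rV[R]_d := closure A `\` A°.

Definition partial (i : 'I_d) f : 'rV[R]_d -> R :=
  fun x => 'D_(delta_mx ord0 i) f x.

Definition grad f x : 'rV[R]_d := \row_i partial i f x.

Definition laplacian f x : R := \sum_(i < d) partial i (partial i f) x.

Definition extends_continuously (N : set 'rV[R]_d) f :=
  exists g : 'rV[R]_d -> R,
    {within closure N, continuous g} /\ forall x, N x -> g x = f x.

(* C^2(closure N) for open N: f is C^2 in N and all its partial derivatives of
   order at most 2 extend continuously to the closure of N. Only the values of
   f on N matter. *)
Definition C2_closure (N : set 'rV[R]_d) f :=
  [/\ extends_continuously N f,
      forall i, (forall x, N x -> derivable f x (delta_mx ord0 i)) /\
        extends_continuously N (partial i f) &
      forall i k,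
        (forall x, N x -> derivable (partial i f) x (delta_mx ord0 k)) /\
        extends_continuously N (partial k (partial i f))].

End euclidean.

Section levy_operator.
Context {R : realType} {d : nat}.
Implicit Types (j u f : 'rV[R]_d -> R) (D : set 'rV[R]_d).

(* The value of j at the origin is irrelevant: every integrand below vanishes
   there. *)
Definition levy_density j :=
  [/\ measurable_fun [set y : 'rV[R]_d | y != 0] j,
      forall y, y != 0 -> 0 <= j y &
      (\int[lebesgue_rV d]_y (Num.min 1 (enorm y ^+ 2) * j y)%:E < +oo)%E].

(* Extended-real valued, so that a divergent integral is not turned into a
   real number; it is finite when u is bounded, measurable and C^2 near x. *)
Definition levy_op j u (x : 'rV[R]_d) : \bar R :=
  ((laplacian u x)%:E +
   \int[lebesgue_rV d]_y
     ((u (x + y) - u x - (enorm y <= 1)%R%:R * edot y (grad u x)) * j y)%:E)%E.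

Definition expi (t : R) : R[i] := Complex (cos t) (sin t).

Definition complex_integral (f : 'rV[R]_d -> R[i]) : R[i] :=
  Complex (\int[lebesgue_rV d]_y complex.Re (f y))
          (\int[lebesgue_rV d]_y complex.Im (f y)).

Definition levy_exponent j (z : 'rV[R]_d) : R[i] :=
  complex_integral (fun y =>
    (1 - expi (edot z y)
     + (enorm y <= 1)%R%:R * (Complex 0 1 * real_complex R (edot z y)))
    * real_complex R (j y)).

Definition condition_A1 j :=
  (exists2 C : R, 0 < C & forall p,
     `|complex.Im (levy_exponent j p)|
       <= C * (enorm p ^+ 2 + `|complex.Re (levy_exponent j p)|)) /\
  (forall r : R, 0 < r ->
     (0 < ereal_sup [set (enorm p ^+ 2 + complex.Re (levy_exponent j p))%:E
                    | p in [set p : 'rV[R]_d | (enorm p <= r)%R]])%E).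

Definition radially_decreasing j :=
  exists g : R -> R, (forall y, y != 0 -> j y = g (enorm y)) /\
    (forall s t, 0 < s -> s <= t -> g t <= g s).

(* [patch u N phi] is phi on N and u elsewhere. In [subspace (closure D)], the
   points of closure D have their relative neighbourhoods and all the other
   points are isolated, so semicontinuity is only required on closure D. *)
Definition viscosity_supersolution j D u f :=
  [/\ measurable_fun setT u, bounded_fun u,
      @lower_semicontinuous (subspace (closure D)) R (EFin \o u) &
      forall (x : 'rV[R]_d) (N : set 'rV[R]_d) (phi : 'rV[R]_d -> R),
        D x -> open N -> N x -> N `<=` D -> C2_closure N phi ->
        phi x - u x = 0 -> (forall y, N y -> phi y - u y <= 0) ->
        (levy_op j (patch u N phi) x <= (f x)%:E)%E].

Definition C_plus D : set ('rV[R]_d -> R) :=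
  [set v : 'rV[R]_d -> R | {within D, continuous v} /\ forall x, D x -> 0 < v x].

Definition C_b_plus : set ('rV[R]_d -> R) :=
  [set v : 'rV[R]_d -> R | [/\ continuous v, bounded_fun v & forall x, 0 <= v x]].

Definition principal_eigenvalue j D : \bar R :=
  ereal_sup [set l%:E | l in [set l : R | exists2 v, (C_plus D `&` C_b_plus) v &
    viscosity_supersolution j D v (fun x => - l * v x)]].

End levy_operator.

(* Main.v *)
(* Let [v] be a supersolution in the ball at level [lam], and [lam1 < lam]. The
   semigroup of [L] is replaced by the explicit iteration
     u_0 = 0,   u_(n+1) = k * u_n + h (m + lam1) f u_n + h,
   where [f] is a Lipschitz cut-off and [k] is a radially nonincreasing kernel
   of mass [1 - h m] such that [(k * w - (1 - h m) w) / h] is uniformly close to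
   [L w] on any class of functions with Lipschitz second derivatives.

   For [f] a cut-off of the ball of radius slightly larger than [r], the [u_n]
   are bounded uniformly in [n]. Otherwise normalize [u_n] by its value at 0 and
   mollify it: this gives a radially decreasing [W <= 1], bounded below near 0,
   with [L W + lam1 W >= - small] in the ball, and [W] is small near the sphere
   and outside, by barriers. Since [lam1 < lam], adding a small multiple of a
   subsolution [(4 r^2 - |x|^2)^N] and subtracting a constant gives a function
   that, suitably scaled, touches [v] from below at a forbidden point.

   Polarizing [f] with respect to a hyperplane increases [sup u_n], as the
   convolution with [k] and the product both preserve the polarization order.
   Finitely many polarizations bring a cut-off of [D] below a cut-off of a ball of
   slightly larger volume, so [u_n] is also bounded for [f] a cut-off of [D].

   Finally, damping the iteration by [1 + h (lam1 - lam')], with [lam' < lam1],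
   makes its increments tend to 0, so that a mollified iterate is a smooth
   supersolution in [D] at level [lam'], hence a viscosity one. *)

(* A fixed point of the iteration satisfies [(k * u - (1 - h m) u) / h = m u - (m + lam1) f u - 1].
   This is a discrete form of [L u = - lam1 u - 1] where [f = 1] and of [L u = m u - 1] where
   [f = 0]. Killing at a large rate [m] thus penalizes the exterior and replaces a Dirichlet
   condition; the domain enters only through the function [f], which can be polarized. The rate also
   makes [m + lam1] nonnegative, so that every coefficient of the iteration has the sign that
   monotonicity and polarization require. The supersolution [v] can only be tested against functions
   of class C^2, while the iterates are merely bounded and Lipschitz; hence the mollifications,
   which commute with [k]. The order of the quantifiers shapes the proof: [m], the smoothness bound
   [C], the tolerance [e] and the bound [M] on the iterates are extracted from the ball before any
   kernel is chosen. One kernel, accurate enough for the ball and for the domain, can then serve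
   both. *)
From HB Require Import structures.
Require Import Defs.
From mathcomp Require Import all_boot all_order all_algebra.
From mathcomp Require Import all_classical all_reals all_analysis.
From mathcomp Require Import measurable_realfun ring lra.
Set Implicit Arguments.
Unset Strict Implicit.
Unset Printing Implicit Defensive.
Import Order.TTheory GRing.Theory Num.Theory.
Import numFieldNormedType.Exports.
Local Open Scope classical_set_scope.
Local Open Scope ring_scope.


(** * Euclidean norm and invariance of Lebesgue measure *)

Section euclidean_norm.
Context {R : realType} {d : nat}.
Implicit Types (x y z : 'rV[R]_d) (a b c : R).

Lemma edotC x y : edot x y = edot y x.
Proof. by apply: eq_bigr => i _; rewrite mulrC. Qed.

Lemma edotDl x y z : edot (x + y) z = edot x z + edot y z.
Proof.
by rewrite -big_split; apply: eq_bigr => i _; rewrite mxE mulrDl.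
Qed.

Lemma edotZl a x y : edot (a *: x) y = a * edot x y.
Proof. by rewrite mulr_sumr; apply: eq_bigr => i _; rewrite mxE mulrA. Qed.

Lemma edotNl x y : edot (- x) y = - edot x y.
Proof. by rewrite -scaleN1r edotZl mulN1r. Qed.

Lemma edotDr x y z : edot z (x + y) = edot z x + edot z y.
Proof. by rewrite edotC edotDl !(edotC z). Qed.

Lemma edotZr a x y : edot y (a *: x) = a * edot y x.
Proof. by rewrite edotC edotZl (edotC y). Qed.

Lemma edotNr x y : edot y (- x) = - edot y x.
Proof. by rewrite edotC edotNl edotC. Qed.

Lemma edotBl x y z : edot (x - y) z = edot x z - edot y z.
Proof. by rewrite edotDl edotNl. Qed.

Lemma edot0l x : edot 0 x = 0.
Proof. by rewrite -(scale0r 0) edotZl mul0r. Qed.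

Lemma edot0r x : edot x 0 = 0.
Proof. by rewrite edotC edot0l. Qed.

Definition edotE := (edotDl, edotDr, edotNl, edotNr, edotZl, edotZr).

Lemma edot_ge0 x : 0 <= edot x x.
Proof. by apply: sumr_ge0 => i _; rewrite -expr2 sqr_ge0. Qed.

Lemma sqr_enorm x : enorm x ^+ 2 = edot x x.
Proof. by rewrite sqr_sqrtr // edot_ge0. Qed.

Lemma enorm_ge0 x : 0 <= enorm x.
Proof. exact: sqrtr_ge0. Qed.

Lemma edot_eq0 x : (edot x x == 0) = (x == 0).
Proof.
apply/eqP/eqP => [h|->]; last by rewrite edot0l.
apply/rowP => i; rewrite mxE; apply/eqP; rewrite -sqrf_eq0 expr2.
move/eqP : h; rewrite psumr_eq0 => [/allP/(_ i)|j _]; last by rewrite -expr2 sqr_ge0.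
by rewrite mem_index_enum => /(_ isT).
Qed.

Lemma enorm_eq0 x : (enorm x == 0) = (x == 0).
Proof. by rewrite -edot_eq0 -sqr_enorm sqrf_eq0. Qed.

Lemma enorm_gt0 x : (0 < enorm x) = (x != 0).
Proof. by rewrite lt_def enorm_ge0 andbT enorm_eq0. Qed.

Lemma enorm0 : enorm (0 : 'rV[R]_d) = 0.
Proof. by apply/eqP; rewrite enorm_eq0. Qed.

Lemma enormN x : enorm (- x) = enorm x.
Proof. by rewrite /enorm !edotE opprK. Qed.

Lemma enormB x y : enorm (x - y) = enorm (y - x).
Proof. by rewrite -enormN opprB. Qed.

Lemma enormZ a x : enorm (a *: x) = `|a| * enorm x.
Proof.
by rewrite /enorm !edotE mulrA -expr2 sqrtrM ?sqr_ge0 // sqrtr_sqr.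
Qed.

(** Cauchy-Schwarz, from the nonnegativity of the square norm of [edot y y *: x - edot x y *: y]. *)
Lemma edot_le x y : `|edot x y| <= enorm x * enorm y.
Proof.
have [->|y0] := eqVneq y 0; first by rewrite edot0r normr0 enorm0 mulr0.
have yy : 0 < edot y y by rewrite lt_def edot_ge0 edot_eq0 y0.
rewrite -(@ler_pXn2r _ 2) ?nnegrE ?mulr_ge0 ?enorm_ge0 //.
rewrite exprMn !sqr_enorm real_normK ?num_real //.
have := edot_ge0 (edot y y *: x - edot x y *: y).
rewrite !edotE (edotC y x).
set p := edot x y; set q := edot x x; set s := edot y y.
rewrite (_ : _ + _ = s * (q * s - p ^+ 2)); last by rewrite -/p -/q -/s; ring.
by rewrite pmulr_rge0 // subr_ge0.
Qed.

Lemma ler_edot x y : edot x y <= enorm x * enorm y.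
Proof. exact: le_trans (ler_norm _) (edot_le x y). Qed.

Lemma enormD x y : enorm (x + y) <= enorm x + enorm y.
Proof.
rewrite -(@ler_pXn2r _ 2) ?nnegrE ?addr_ge0 ?enorm_ge0 //.
rewrite sqr_enorm sqrrD !sqr_enorm !edotE (edotC y x).
have := ler_edot x y; lra.
Qed.

Lemma enormBD x y : enorm (x - y) <= enorm x + enorm y.
Proof. by rewrite -(enormN y) enormD. Qed.

Lemma ler_enormB x y : `|enorm x - enorm y| <= enorm (x - y).
Proof.
have h1 := enormD (x - y) y; rewrite subrK in h1.
have h2 := enormD (y - x) x; rewrite subrK (enormB y) in h2.
by rewrite ler_norml; apply/andP; split; lra.
Qed.

Lemma coord_le_enorm x i : `|x ord0 i| <= enorm x.
Proof.
rewrite -(@ler_pXn2r _ 2) ?nnegrE ?enorm_ge0 // sqr_enorm real_normK ?num_real //.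
rewrite /edot (bigD1 i) //= expr2 lerDl sumr_ge0 // => j _.
by rewrite -expr2 sqr_ge0.
Qed.

Lemma enorm_delta i : enorm (delta_mx ord0 i : 'rV[R]_d) = 1.
Proof.
rewrite /enorm /edot (bigD1 i) //= big1 => [|j ji]; last first.
  by rewrite !mxE (negbTE ji) mulr0.
by rewrite !mxE !eqxx mulr1 addr0 sqrtr1.
Qed.

Lemma edot_delta x i : edot x (delta_mx ord0 i) = x ord0 i.
Proof.
rewrite /edot (bigD1 i) //= big1 => [|j ji]; last first.
  by rewrite !mxE (negbTE ji) mulr0.
by rewrite !mxE !eqxx mulr1 addr0.
Qed.

Lemma norm_le_enorm x : `|x| <= enorm x.
Proof.
rewrite [leLHS](mx_normrE x).
apply/bigmax_leP; split => [|[i j] _]; first exact: enorm_ge0.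
by rewrite /= ord1 coord_le_enorm.
Qed.

Lemma coord_le_norm x i : `|x ord0 i| <= `|x|.
Proof.
rewrite [leRHS](mx_normrE x).
by apply: (@le_bigmax _ _ _ _ (fun k : 'I_1 * 'I_d => `|x k.1 k.2|) (ord0, i)).
Qed.

(** Together with [norm_le_enorm] this identifies the topologies and the bounded sets of the two
    norms; the size of the constant is immaterial. *)
Lemma enorm_le_norm x : enorm x <= d%:R * `|x|.
Proof.
rewrite -(@ler_pXn2r _ 2) ?nnegrE ?enorm_ge0 ?mulr_ge0 // sqr_enorm.
apply: (@le_trans _ _ (\sum_(i < d) `|x| ^+ 2)).
  apply: ler_sum => i _; rewrite -expr2 -real_normK ?num_real //.
  by rewrite ler_pXn2r ?nnegrE // coord_le_norm.
rewrite sumr_const card_ord exprMn -[leLHS]mulr_natl ler_wpM2r ?sqr_ge0 //.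
by rewrite -natrX ler_nat; case: (d) => // k; rewrite leq_pmulr.
Qed.

Lemma ball_enorm x (r : R) : 0 < r ->
  exists2 e : R, 0 < e & ball x e `<=` [set y | enorm (y - x) < r].
Proof.
move=> r0; have d0 : 0 < d%:R + 1 :> R by rewrite ltr_pwDr.
exists (r / (d%:R + 1)); first by rewrite divr_gt0.
move=> y /=; rewrite -ball_normE /= => xy.
rewrite enormB (le_lt_trans (enorm_le_norm _)) //.
have : (d%:R + 1) * `|x - y| < r by rewrite mulrC -ltr_pdivlMr.
have := normr_ge0 (x - y); lra.
Qed.

Lemma enorm_continuous : continuous (@enorm R d).
Proof.
move=> x; apply/(@cvgrPdist_lt _ _ _ (nbhs x) (nbhs_filter x)) => e e0.
have [r r0 xr] := ball_enorm x e0.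
apply/nbhs_ballP; exists r => //= y /xr /= yx.
by rewrite distrC (le_lt_trans (ler_enormB _ _)).
Qed.

Lemma eball_open (r : R) : open (@eball R d r).
Proof.
rewrite (_ : eball r = @enorm R d @^-1` [set t | t < r]) //.
apply: open_comp => [x _|]; first exact: enorm_continuous.
exact: open_lt.
Qed.

Lemma cball_compact (r : R) : compact [set x : 'rV[R]_d | enorm x <= r].
Proof.
apply: bounded_closed_compact.
  exists r; split; first exact: num_real.
  by move=> M rM x /= xr; rewrite (le_trans (norm_le_enorm x)) // (le_trans xr) ?ltW.
rewrite (_ : [set x | _] = @enorm R d @^-1` [set t | t <= r]) //.
by apply: closed_comp => [x _|]; [exact: enorm_continuous|exact: closed_le].
Qed.

Lemma bounded_enorm (A : set 'rV[R]_d) :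
  bounded_set A -> exists2 M : R, 0 < M & forall x, A x -> enorm x < M.
Proof.
move=> [M [_ AM]]; exists (d%:R * (`|M| + 1) + 1).
  by rewrite ltr_pwDr // mulr_ge0 // addr_ge0.
move=> x Ax; have := AM (`|M| + 1); rewrite (le_lt_trans (ler_norm M)) ?ltrDl //.
move=> /(_ isT x Ax) /= xM.
by rewrite (le_lt_trans (enorm_le_norm x)) // ltr_pwDr // ler_wpM2l.
Qed.

Lemma nbhs_enorm x (A : set 'rV[R]_d) :
  nbhs x A <-> exists2 r : R, 0 < r & forall y, enorm (y - x) < r -> A y.
Proof.
split=> [/nbhs_ballP[e /= e0 xA]|[r r0 xA]].
  exists e => // y yx; apply: xA; rewrite -ball_normE /= distrC.
  exact: le_lt_trans (norm_le_enorm _) yx.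
have [e e0 xe] := ball_enorm x r0.
by apply/nbhs_ballP; exists e => // y /xe; exact: xA.
Qed.

End euclidean_norm.

Section measurable_vectors.
Context {R : realType} {d : nat}.

Lemma measurable_addrV :
  measurable_fun setT (fun p : 'rV[R]_d * 'rV[R]_d => p.1 + p.2).
Proof.
apply: measurable_fun_rV => i.
rewrite (_ : (fun _ => _) =
    (fun p : 'rV[R]_d * 'rV[R]_d => p.1 ord0 i + p.2 ord0 i)); last first.
  by apply/funext => p; rewrite mxE.
by apply: measurable_funD; apply: (measurableT_comp (measurable_coord i)).
Qed.

Lemma measurable_scale (a : R) :
  measurable_fun setT (fun x : 'rV[R]_d => a *: x).
Proof.
apply: measurable_fun_rV => i.
rewrite (_ : (fun _ => _) = (fun p : 'rV[R]_d => a * p ord0 i)); last first.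
  by apply/funext => p; rewrite mxE.
by apply: measurable_funM => //; exact: measurable_coord.
Qed.

Lemma measurable_shift (a : 'rV[R]_d) : measurable_fun setT (fun x : 'rV[R]_d => x + a).
Proof.
apply: (@measurableT_comp _ _ _ _ _ _ _ _ (fun x => (x, a)) measurable_addrV).
by apply/measurable_fun_pairP; split; [exact: measurable_id|exact: measurable_cst].
Qed.

Lemma continuous_measurable_rV (f : 'rV[R]_d -> R) :
  continuous f -> measurable_fun setT f.
Proof.
move=> cf; apply: (measurability _ (RGenOInfty.measurableE R)) => // _ [_ [a ->] <-].
rewrite setTI; apply: open_measurable_rV.
apply: open_comp => [v _|]; first exact: cf.
exact: rray_open.
Qed.

Lemma measurable_eball (r : R) : measurable (@eball R d r).
Proof. by apply: open_measurable_rV; exact: eball_open. Qed.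

End measurable_vectors.

Section invariance.
Context {R : realType}.
Local Notation mu := (@lebesgue_measure R).

Lemma lebesgue_measure_shift (a : R) (A : set (measurableTypeR R)) :
  measurable A -> mu ((fun x => x + a) @^-1` A) = mu A.
Proof.
move=> mA; have ms : measurable_fun setT (fun x : measurableTypeR R => x + a).
  by apply: measurable_funD.
apply/esym.
apply: (@lebesgue_measure_unique R (pushforward mu (fun x : measurableTypeR R => x + a : measurableTypeR R))) => //.
move=> _ [[u v]] _ <-.
rewrite /= /pushforward [X in _ = mu X](_ : _ = `]u - a, v - a]%classic); last first.
  apply/seteqP; split=> x /=; rewrite !in_itv /= => /andP[h1 h2];
  by apply/andP; split; lra.
by rewrite !lebesgue_measure_itv /= !lte_fin ltrD2r -!EFinB opprB addrA subrK.
Qed.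

Variable n : nat.

(** The image of the product measure agrees with it on rectangles, hence everywhere by uniqueness of
    the product measure. *)
Lemma product_measure_invariant d1 d2 (T1 : measurableType d1) (T2 : measurableType d2)
  (m1 : {sigma_finite_measure set T1 -> \bar R})
  (m2 : {sigma_finite_measure set T2 -> \bar R}) (f : T1 -> T1) (g : T2 -> T2) :
  measurable_fun setT f -> measurable_fun setT g ->
  (forall A, measurable A -> m1 (f @^-1` A) = m1 A) ->
  (forall A, measurable A -> m2 (g @^-1` A) = m2 A) ->
  forall A, measurable A ->
    (m1 \x m2)%E ((fun p => (f p.1, g p.2)) @^-1` A) = (m1 \x m2)%E A.
Proof.
move=> mf mg If Ig A mA.
have mfg : measurable_fun setT (fun p : T1 * T2 => (f p.1, g p.2)).
  by apply/measurable_fun_pairP; split; [exact: (measurableT_comp mf)|exact: (measurableT_comp mg)].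
apply/esym.
apply: (@product_measure_unique _ _ _ _ _ m1 m2
  (pushforward (m1 \x m2)%E (fun p : T1 * T2 => (f p.1, g p.2)))) => // B C mB mC.
rewrite /pushforward -[m1 B]If // -[m2 C]Ig // -product_measure1E //.
- by rewrite -[X in measurable X]setTI; exact: mf.
- by rewrite -[X in measurable X]setTI; exact: mg.
Qed.

End invariance.

Section invariance_rV.
Context {R : realType}.

(** Induction on the dimension: the map acts separately on the first coordinate and on the others.
    The sign covers both the translations and the maps sending [x] to [a - x], which
    [lebesgue_rV_reflect0] needs. *)
Lemma lebesgue_rV_affine n (b : bool) (a : 'rV[R]_n) (A : set 'rV[R]_n) :
  measurable A ->
  lebesgue_rV n ((fun x => (-1) ^+ b *: x + a) @^-1` A) = lebesgue_rV n A.
Proof.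
elim: n a A => [|n IH] a A mA.
  by congr (lebesgue_rV 0 _); apply/seteqP; split=> x /=; rewrite [_ + _]thinmx0 (thinmx0 x).
rewrite /= /lebesgue_cons /pushforward.
pose f (x : measurableTypeR R) : measurableTypeR R := (-1) ^+ b * x + a ord0 ord0.
pose g (x : 'rV[R]_n) := (-1) ^+ b *: x + \row_i a ord0 (lift ord0 i).
have mcA : measurable (@cons_rV R n @^-1` A).
  by rewrite -[X in measurable X]setTI; apply: measurable_cons_rV.
have fI B : measurable B -> lebesgue_measure (f @^-1` B) = lebesgue_measure B.
  move=> mB; rewrite /f; case: (b); last first.
    rewrite (_ : (fun _ => _) @^-1` B = (fun x => x + a ord0 ord0) @^-1` B).
      exact: lebesgue_measure_shift.
    by apply/seteqP; split => x /=; rewrite expr0 mul1r.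
  rewrite -[RHS](lebesgue_measure_shift (a ord0 ord0)) //.
  have mB' : measurable ((fun x : measurableTypeR R => x + a ord0 ord0) @^-1` B).
    by rewrite -[X in measurable X]setTI; apply: measurable_funD.
  rewrite -[RHS]lebesgue_measureN //.
  by congr (lebesgue_measure _); apply/seteqP; split => x /=; rewrite expr1 mulN1r.
have mf : measurable_fun setT f by apply: measurable_funD => //; apply: measurable_funM.
have mg : measurable_fun setT g.
  exact: (measurableT_comp (measurable_shift (\row_i a ord0 (lift ord0 i))) (measurable_scale _)).
rewrite -[RHS](product_measure_invariant mf mg fI (IH _)) //.
congr ((_ \x _)%E _).
have E (p : measurableTypeR R * 'rV[R]_n) :
    (-1) ^+ b *: cons_rV p + a = cons_rV (f p.1, g p.2).
  apply/rowP => i; rewrite mxE mxE; case: (unliftP ord0 i) => [k ->|->].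
    by rewrite !cons_rVS !mxE.
  by rewrite !cons_rV0.
by apply/seteqP; split => p /=; rewrite E.
Qed.

End invariance_rV.

Section reflections.
Context {R : realType} {d : nat}.
Implicit Types (e x y : 'rV[R]_d) (c : R).

Definition reflect e c x : 'rV[R]_d := x - (2 * (edot x e - c)) *: e.

Lemma reflectK e c : edot e e = 1 -> involutive (reflect e c).
Proof.
by move=> e1 x; apply/rowP => i; rewrite /reflect !edotE e1 !mxE; ring.
Qed.

Lemma reflectB e c x y : reflect e c x - reflect e c y = reflect e 0 (x - y).
Proof.
by apply/rowP => i; rewrite /reflect !edotE !mxE; ring.
Qed.

Lemma enorm_reflect0 e x : edot e e = 1 -> enorm (reflect e 0 x) = enorm x.
Proof.
move=> e1; rewrite /enorm /reflect !edotE e1 (edotC e x).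
by congr Num.sqrt; ring.
Qed.

Lemma enorm_reflectB e c x y : edot e e = 1 ->
  enorm (reflect e c x - reflect e c y) = enorm (x - y).
Proof. by move=> e1; rewrite reflectB enorm_reflect0. Qed.

Lemma reflectE e c x : reflect e c x = reflect e 0 x + (2 * c) *: e.
Proof. by apply/rowP => i; rewrite /reflect !mxE; ring. Qed.

Lemma measurable_reflect e c : measurable_fun setT (reflect e c).
Proof.
apply: measurable_fun_rV => i; apply: continuous_measurable_rV => x.
apply/(@cvgrPdist_lt _ _ _ (nbhs x) (nbhs_filter x)) => eps eps0.
have [n0|n0] := leP (1 + 2 * enorm e ^+ 2) 0.
  by have := sqr_ge0 (enorm e); lra.
apply/nbhs_enorm; exists (eps / (1 + 2 * enorm e ^+ 2)) => [|y yx].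
  by rewrite divr_gt0.
rewrite -[X in `|X - _|]/((reflect e c x) ord0 i).
have -> : reflect e c x ord0 i - reflect e c y ord0 i = (reflect e 0 (x - y)) ord0 i.
  by rewrite -(reflectB e c) !mxE.
apply: le_lt_trans (coord_le_enorm _ _) _.
apply: (@le_lt_trans _ _ ((1 + 2 * enorm e ^+ 2) * enorm (x - y))); last first.
  by rewrite mulrC -ltr_pdivlMr // enormB.
rewrite /reflect subr0; apply: le_trans (enormBD _ _) _.
rewrite enormZ normrM (ger0_norm (ler0n _ 2)).
have := ler_wpM2r (enorm_ge0 e) (edot_le (x - y) e); lra.
Qed.

End reflections.

Section lebesgue_rV_balls.
Context {R : realType} {d : nat}.
Local Notation mu := (lebesgue_rV d).

Lemma lebesgue_rV_cube (x : 'rV[R]_d) (r : R) : 0 <= r ->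
  mu [set y | forall i, `]x ord0 i - r, x ord0 i + r[%classic (y ord0 i)] =
  ((2 * r) ^+ d)%:E.
Proof.
move=> r0; rewrite (lebesgue_rV_setX (A := fun i => `]x ord0 i - r, x ord0 i + r[%classic)) //.
have E i : lebesgue_measure `]x ord0 i - r, x ord0 i + r[%classic = (2 * r)%:E.
  rewrite lebesgue_measure_itv /= lte_fin; case: ifPn => [_|].
    by rewrite -EFinB; congr EFin; ring.
  by rewrite -leNgt => h; congr EFin; lra.
rewrite (eq_bigr _ (fun i _ => E i)) big_const_ord.
by elim: (d) => [|n IH] //; rewrite iterS IH -EFinM exprS.
Qed.

(** A ball of the sup norm is a cube, whose volume is explicit. *)
Lemma lebesgue_rV_open_gt0 (U : set 'rV[R]_d) :
  open U -> U !=set0 -> (0 < mu U)%E.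
Proof.
move=> oU [x Ux]; have : nbhs x U by exact: open_nbhs_nbhs.
move=> /nbhs_ballP[e /= e0 eU].
have cb : [set y : 'rV[R]_d | forall i, `]x ord0 i - e, x ord0 i + e[%classic (y ord0 i)] = ball x e.
  apply/seteqP; split => y /=.
    move=> h; split => // i k; rewrite ord1; have := h k.
    by rewrite /= in_itv /= -ball_normE /= ltr_distlC.
  by move=> [_ h] i; have := h ord0 i; rewrite -ball_normE /= in_itv /= ltr_distlC.
apply: (@lt_le_trans _ _ (mu (ball x e))).
  by rewrite -cb lebesgue_rV_cube ?ltW // lte_fin exprn_gt0 // mulr_gt0.
rewrite le_measure ?inE //; last exact: open_measurable_rV.
by apply: open_measurable_rV; exact: ball_open.
Qed.

Lemma lebesgue_rV_eball_lty (r : R) : (mu (eball r) < +oo)%E.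
Proof.
have [r0|r0] := leP r 0.
  rewrite (_ : eball r = set0) ?measure0 ?ltry //.
  by apply/seteqP; split => // x; rewrite /eball /= => xr; have := enorm_ge0 x; lra.
apply: (@le_lt_trans _ _ (mu [set y | forall i, `](0 : 'rV[R]_d) ord0 i - r, (0 : 'rV[R]_d) ord0 i + r[%classic (y ord0 i)])).
  apply: le_measure; rewrite ?inE.
  - exact: measurable_eball.
  - rewrite [X in measurable X](_ : _ = \bigcap_(i in [set: 'I_d])
      ((fun v : 'rV[R]_d => v ord0 i : R) @^-1` `](0 : 'rV[R]_d) ord0 i - r, (0 : 'rV[R]_d) ord0 i + r[%classic)).
      apply: fin_bigcap_measurable => [|i _]; first exact: finite_finset.
      by rewrite -[X in measurable X]setTI; exact: measurable_coord.
    by apply/seteqP; split => v h i; [move=> _|]; exact: h.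
  - move=> x; rewrite /eball /= => xr i; rewrite in_itv /= mxE sub0r add0r -ltr_norml.
    exact: le_lt_trans (coord_le_enorm _ _) xr.
by rewrite lebesgue_rV_cube ?ltW // ltry.
Qed.

Lemma lebesgue_rV_translate (a : 'rV[R]_d) A : measurable A ->
  mu ((fun x => x + a) @^-1` A) = mu A.
Proof.
move=> mA; rewrite -(lebesgue_rV_affine false a mA); congr (mu _).
by apply/seteqP; split => x /=; rewrite expr0 scale1r.
Qed.

(* Fubini for [1_A(x) 1_B(T y - x)], integrated in both orders, gives
   mu(A) mu(T^-1 B) = mu(B) mu(T^-1 A); B is a ball, which T preserves. *)
Lemma lebesgue_rV_reflect0 (e : 'rV[R]_d) A : edot e e = 1 -> measurable A ->
  mu (reflect e 0 @^-1` A) = mu A.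
Proof.
move=> e1 mA.
pose T := reflect e 0; pose B := @eball R d 1.
have mB : measurable B by exact: measurable_eball.
have mT : measurable_fun setT T by exact: measurable_reflect.
have mTy : measurable_fun setT (fun p : 'rV[R]_d * 'rV[R]_d => T p.2 - p.1).
  have -> : (fun p : 'rV[R]_d * 'rV[R]_d => T p.2 - p.1) =
    (fun p => p.1 + p.2) \o (fun p => (T p.2, (-1) *: p.1)).
    by apply/funext => p /=; rewrite scaleN1r.
  apply: (measurableT_comp measurable_addrV).
  apply/measurable_fun_pairP; split.
    exact: (measurableT_comp mT measurable_snd).
  exact: (measurableT_comp (measurable_scale (-1)) measurable_fst).
have TB : T @^-1` B = B by apply/seteqP; split => x; rewrite /B /eball /= enorm_reflect0.
pose J (C E : set 'rV[R]_d) : \bar R :=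
  (\int[mu]_x \int[mu]_y (\1_C x * \1_E (T y - x))%:E)%E.
have mI (C E : set 'rV[R]_d) : measurable C -> measurable E ->
   measurable_fun setT (fun p : 'rV[R]_d * 'rV[R]_d => (\1_C p.1 * \1_E (T p.2 - p.1) : R)%:E).
  move=> mC mE; apply/measurable_EFinP; apply: measurable_funM.
    exact: (measurableT_comp (measurable_indic mC) measurable_fst).
  exact: (measurableT_comp (measurable_indic mE) mTy).
have JE C E : measurable C -> measurable E -> J C E = (mu C * mu (T @^-1` E))%E.
  move=> mC mE; rewrite /J.
  have mTE : measurable (T @^-1` E) by rewrite -[X in measurable X]setTI; exact: mT.
  transitivity (\int[mu]_x ((\1_C x)%:E * mu (T @^-1` E)))%E.
    apply: eq_integral => x _; under eq_integral do rewrite EFinM.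
    rewrite ge0_integralZl //; last first.
      apply/measurable_EFinP; apply: (measurableT_comp (measurable_indic mE)).
      exact: (measurableT_comp (measurable_shift (- x)) mT).
    congr (_ * _)%E.
    rewrite (_ : (fun y => _) = (fun y => (\1_((fun y => T y - x) @^-1` E) y)%:E)) //.
    rewrite integral_indic // ?setIT; last first.
      rewrite -[X in measurable X]setTI.
      exact: (measurableT_comp (measurable_shift (- x)) mT).
    rewrite -[RHS](lebesgue_rV_translate (- T x)) //; congr (mu _).
    have Ty y : T (y + - T x) = T y - x by rewrite /T -(reflectB e 0) reflectK.
    by apply/seteqP; split => y; rewrite /preimage /= Ty.
  rewrite ge0_integralZr //; last by apply/measurable_EFinP; exact: measurable_indic.
  by rewrite integral_indic // setIT.
have Jsym C E : measurable C -> measurable E -> J C E = J E C.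
  move=> mC mE; rewrite /J.
  have F0 C' E' (p : 'rV[R]_d * 'rV[R]_d) : (0 <= (\1_C' p.1 * \1_E' (T p.2 - p.1) : R)%:E)%E.
    by rewrite lee_fin mulr_ge0.
  rewrite [LHS](fubini_tonelli _ (mI C E mC mE) (F0 C E)).
  rewrite [RHS](fubini_tonelli _ (mI E C mE mC) (F0 E C)) /=.
  apply: eq_integral => y _.
  pose s x := (-1) ^+ true *: x + T y : 'rV[R]_d.
  have ms : measurable_fun setT s.
    exact: (measurableT_comp (measurable_shift (T y)) (measurable_scale _)).
  have -> : (\int[mu]_x (\1_E x * \1_C (T y - x))%:E =
      \int[pushforward mu s]_x (\1_E x * \1_C (T y - x))%:E)%E.
    apply: eq_measure_integral => /= X mX _.
    by rewrite /pushforward -[LHS](lebesgue_rV_affine true (T y)).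
  rewrite ge0_integral_pushforward //.
  - rewrite preimage_setT; apply: eq_integral => x _ /=.
    have -> : s x = T y - x by rewrite /s expr1 scaleN1r addrC.
    by rewrite subKr mulrC.
  - apply/measurable_EFinP; apply: measurable_funM; first exact: measurable_indic.
    apply: (measurableT_comp (measurable_indic mC)).
    have -> : (fun x : 'rV[R]_d => T y - x) = s by apply/funext => x; rewrite /s expr1 scaleN1r addrC.
    exact: ms.
have := Jsym B A mB mA; rewrite !JE // TB [RHS]muleC.
have Bgt0 : (0 < mu B)%E.
  apply: lebesgue_rV_open_gt0; first exact: eball_open.
  by exists 0; rewrite /B /eball /= enorm0.
have Bfin : mu B \is a fin_num by rewrite ge0_fin_numE // lebesgue_rV_eball_lty.
move=> h; have : ((mu B)^-1 * (mu B * mu (T @^-1` A)) = (mu B)^-1 * (mu B * mu A))%E by rewrite h.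
by rewrite !muleA mulVe ?gt_eqF // !mul1e.
Qed.

End lebesgue_rV_balls.

Section change_of_variables.
Context {R : realType} {d : nat}.
Local Notation mu := (lebesgue_rV d).

Lemma integral_invariant (T : 'rV[R]_d -> 'rV[R]_d) (f : 'rV[R]_d -> \bar R) :
  measurable_fun setT T ->
  (forall A, measurable A -> mu (T @^-1` A) = mu A) ->
  measurable_fun setT f ->
  (\int[mu]_x f (T x) = \int[mu]_x f x)%E.
Proof.
move=> mT IT mf.
have ge0 (g : 'rV[R]_d -> \bar R) : measurable_fun setT g -> (forall x, 0 <= g x)%E ->
    (\int[mu]_x g (T x) = \int[mu]_x g x)%E.
  move=> mg g0; transitivity (\int[pushforward mu T]_x g x)%E.
    by rewrite ge0_integral_pushforward // preimage_setT.
  by apply: eq_measure_integral => /= A mA _; exact: IT.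
rewrite -[fun x => f (T x)]/(f \o T) integralE [RHS]integralE.
by rewrite funepos_comp funeneg_comp /= (ge0 _ (measurable_funepos mf) (funepos_ge0 f))
  (ge0 _ (measurable_funeneg mf) (funeneg_ge0 f)).
Qed.

Lemma lebesgue_rV_reflect (e : 'rV[R]_d) c A : edot e e = 1 -> measurable A ->
  mu (reflect e c @^-1` A) = mu A.
Proof.
move=> e1 mA; pose A' := (fun x => x + (2 * c) *: e) @^-1` A.
have mA' : measurable A'.
  by rewrite -[X in measurable X]setTI; apply: measurable_shift.
have -> : reflect e c @^-1` A = reflect e 0 @^-1` A'.
  by apply/seteqP; split => x; rewrite /A' /preimage /= (reflectE e c).
by rewrite lebesgue_rV_reflect0 // lebesgue_rV_translate.
Qed.

End change_of_variables.

(** * Real-valued integrals over R^d *)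

Section real_integral.
Context {R : realType} {d : nat}.
Local Notation mu := (lebesgue_rV d).
Local Notation V := 'rV[R]_d.
Implicit Types (f g k : V -> R).

(** Real-valued, hence a default value when the extended integral is infinite; [Lig] records the
    integrability that linearity and comparison rely on. *)
Definition Lint f : R := \int[mu]_x f x.

Definition Lig f := mu.-integrable setT (EFin \o f).

Lemma Lig_measurable f : Lig f -> measurable_fun setT f.
Proof. by move=> /measurable_int/measurable_EFinP. Qed.

Lemma Lig_dom f g : measurable_fun setT f -> (forall x, `|f x| <= g x) ->
  Lig g -> Lig f.
Proof.
move=> mf fg; apply: le_integrable => //; first exact/measurable_EFinP.
by move=> x _; rewrite /= lee_fin (le_trans (fg x)) ?ler_norm.
Qed.

Lemma LigD f g : Lig f -> Lig g -> Lig (fun x => f x + g x).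
Proof. by move=> If Ig; have := integrableD measurableT If Ig. Qed.

Lemma LigB f g : Lig f -> Lig g -> Lig (fun x => f x - g x).
Proof. by move=> If Ig; have := integrableB measurableT If Ig. Qed.

Lemma LigZ a f : Lig f -> Lig (fun x => a * f x).
Proof. by move=> If; have := integrableZl measurableT a If. Qed.

Lemma LigN f : Lig f -> Lig (fun x => - f x).
Proof.
by move=> If; under [X in Lig X]funext do rewrite -mulN1r; exact: LigZ.
Qed.

Lemma LigM f k M : measurable_fun setT f -> (forall x, `|f x| <= M) ->
  Lig k -> Lig (fun x => f x * k x).
Proof.
move=> mf fM Ik; apply: (@Lig_dom _ (fun x => M * `|k x|)).
- exact: measurable_funM mf (Lig_measurable Ik).
- by move=> x; rewrite normrM ler_wpM2r.
- by apply: LigZ; have := integrable_abse Ik.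
Qed.

Lemma Lig_norm f : Lig f -> Lig (fun x => `|f x|).
Proof. by move=> If; have := integrable_abse If. Qed.

Lemma LintD f g : Lig f -> Lig g -> Lint (fun x => f x + g x) = Lint f + Lint g.
Proof. by move=> If Ig; rewrite /Lint RintegralD. Qed.

Lemma LintB f g : Lig f -> Lig g -> Lint (fun x => f x - g x) = Lint f - Lint g.
Proof. by move=> If Ig; rewrite /Lint RintegralB. Qed.

Lemma LintZ a f : Lig f -> Lint (fun x => a * f x) = a * Lint f.
Proof. by move=> If; rewrite /Lint RintegralZl. Qed.

Lemma LintN f : Lig f -> Lint (fun x => - f x) = - Lint f.
Proof.
move=> If; rewrite -mulN1r -LintZ //; congr Lint.
by apply/funext => x; rewrite mulN1r.
Qed.

Lemma Lint0 : Lint (fun=> 0) = 0.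
Proof. by rewrite /Lint /Rintegral integral0. Qed.

Lemma Lint_ge0 f : (forall x, 0 <= f x) -> 0 <= Lint f.
Proof. by move=> f0; apply: Rintegral_ge0. Qed.

Lemma Lint_le f g : Lig f -> Lig g -> (forall x, f x <= g x) -> Lint f <= Lint g.
Proof. by move=> If Ig fg; apply: le_Rintegral. Qed.

Lemma Lint_abs f g : Lig f -> Lig g -> (forall x, `|f x| <= g x) -> `|Lint f| <= Lint g.
Proof.
move=> If Ig fg; rewrite ler_norml; apply/andP; split.
  rewrite -LintN //; apply: Lint_le => //; first exact: LigN.
  by move=> x; have := fg x; rewrite ler_norml => /andP[].
by apply: Lint_le => // x; have := fg x; rewrite ler_norml => /andP[].
Qed.

Lemma EFin_Lint f : Lig f -> (\int[mu]_x (f x)%:E)%E = (Lint f)%:E.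
Proof. by move=> If; rewrite /Lint /Rintegral fineK //; exact: integrable_fin_num. Qed.

Lemma Lint_reflect (e : V) c f : edot e e = 1 -> measurable_fun setT f ->
  Lint (fun x => f (reflect e c x)) = Lint f.
Proof.
move=> e1 mf; congr fine.
apply: (integral_invariant (f := EFin \o f) (measurable_reflect e c)) => [A mA|].
  exact: lebesgue_rV_reflect.
exact/measurable_EFinP.
Qed.

Lemma Lint_shift (a : V) f : measurable_fun setT f ->
  Lint (fun x => f (x + a)) = Lint f.
Proof.
move=> mf; congr fine.
apply: (integral_invariant (f := EFin \o f) (measurable_shift a)) => [A mA|].
  exact: lebesgue_rV_translate.
exact/measurable_EFinP.
Qed.

Lemma Lig_invariant (T : V -> V) f : measurable_fun setT T ->
  (forall A, measurable A -> mu (T @^-1` A) = mu A) -> Lig f -> Lig (fun x => f (T x)).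
Proof.
move=> mT IT If; have mf := Lig_measurable If.
have mf' : measurable_fun setT (fun x => f (T x)) by exact: (measurableT_comp mf mT).
apply/integrableP; split; first exact/measurable_EFinP.
have := integral_invariant (f := fun x => `|(f x)%:E|%E) mT IT => -> //.
  by case/integrableP : If.
by apply: measurableT_comp => //; exact/measurable_EFinP.
Qed.

Lemma Lig_reflect (e : V) c f : edot e e = 1 -> Lig f -> Lig (fun x => f (reflect e c x)).
Proof.
move=> e1; apply: Lig_invariant; first exact: measurable_reflect.
by move=> A mA; exact: lebesgue_rV_reflect.
Qed.

Lemma Lig_shift (a : V) f : Lig f -> Lig (fun x => f (x + a)).
Proof.
apply: Lig_invariant; first exact: measurable_shift.
by move=> A mA; exact: lebesgue_rV_translate.
Qed.

(** The separated bound [k x * l y] has a finite double integral, which gives the integrability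
    asked by Fubini's theorem. It is the shape met in a double convolution of a bounded function. *)
Lemma Lint_swap (F : V -> V -> R) k l :
  measurable_fun setT (fun p : V * V => F p.1 p.2) ->
  (forall x, 0 <= k x) -> (forall y, 0 <= l y) ->
  (forall x y, `|F x y| <= k x * l y) -> Lig k -> Lig l ->
  Lint (fun x => Lint (F x)) = Lint (fun y => Lint (fun x => F x y)).
Proof.
move=> mF k0 l0 Fkl Ik Il.
have Ix x : Lig (F x).
  apply: (Lig_dom _ (Fkl x)); last exact: LigZ.
  exact: (measurableT_comp mF (measurable_pair1 x)).
have Iy y : Lig (F ^~ y).
  apply: (Lig_dom (g := fun x => l y * k x)); last exact: LigZ.
    exact: (measurableT_comp mF (measurable_pair2 y)).
  by move=> x; rewrite mulrC.
have If : (mu \x mu)%E.-integrable setT (fun p : V * V => (F p.1 p.2)%:E).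
  apply/integrable12ltyP; first exact/measurable_EFinP.
  apply: (@le_lt_trans _ _ (\int[mu]_x (k x * Lint l)%:E)%E); last first.
    have /EFin_Lint -> : Lig (fun x => k x * Lint l).
      by under [X in Lig X]funext do rewrite mulrC; exact: LigZ.
    exact: ltry.
  have mn : measurable_fun setT (fun p : V * V => (`|F p.1 p.2|)%:E).
    by apply/measurable_EFinP; exact: measurableT_comp.
  apply: ge0_le_integral => //.
  - by move=> x _; exact: integral_ge0.
  - exact: (measurable_fun_fubini_tonelli_F (m2 := mu) _ mn).
  - apply/measurable_EFinP; apply: measurable_funM => //; exact: Lig_measurable.
  - move=> x _; rewrite (EFin_Lint (Lig_norm (Ix x))) lee_fin -LintZ //.
    by apply: Lint_le => //; [exact: Lig_norm|exact: LigZ].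
rewrite /Lint /Rintegral; congr fine.
transitivity (\int[mu]_x \int[mu]_y (F x y)%:E)%E.
  by apply: eq_integral => x _; rewrite /= EFin_Lint.
transitivity (\int[mu]_y \int[mu]_x (F x y)%:E)%E.
  exact: (Fubini If).
by apply: eq_integral => y _; rewrite /= EFin_Lint.
Qed.

End real_integral.

(** * Convolution *)

Section convolution.
Context {R : realType} {d : nat}.
Local Notation V := 'rV[R]_d.
Implicit Types (u v w k l : V -> R).

(** Bounded and Lipschitz with one common constant. The class is stable under sums, products,
    convolutions, reflections and polarizations, so all the functions of the iteration belong to it
    and are measurable. *)
Definition BL u := exists M : R, forall x y,
  `|u x| <= M /\ `|u x - u y| <= M * enorm (x - y).

Lemma BL_ge0 u : BL u -> exists2 M : R, 0 <= M & forall x y,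
  `|u x| <= M /\ `|u x - u y| <= M * enorm (x - y).
Proof. by move=> [M uM]; exists M => //; exact: le_trans (uM 0 0).1. Qed.

Lemma BL_continuous u : BL u -> continuous u.
Proof.
move=> /BL_ge0[M M0 uM] x; apply/(@cvgrPdist_lt _ _ _ (nbhs x) (nbhs_filter x)) => e e0.
apply/nbhs_enorm; exists (e / (M + 1)) => [|y yx].
  by rewrite divr_gt0 // ltr_pwDr.
apply: le_lt_trans (uM x y).2 _; rewrite enormB.
move: yx; rewrite ltr_pdivlMr ?ltr_pwDr //.
have := enorm_ge0 (y - x); lra.
Qed.

Lemma BL_measurable u : BL u -> measurable_fun setT u.
Proof. by move=> /BL_continuous; exact: continuous_measurable_rV. Qed.

Lemma BL_cst a : BL (fun=> a).
Proof. by exists `|a| => x y; rewrite subrr normr0 mulr_ge0 ?enorm_ge0. Qed.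

Lemma BL_D u v : BL u -> BL v -> BL (fun x => u x + v x).
Proof.
move=> [M uM] [N vN]; exists (M + N) => x y.
have [[u1 u2] [v1 v2]] := (uM x y, vN x y); split.
  exact: le_trans (ler_normD _ _) (lerD u1 v1).
by rewrite opprD addrACA mulrDl (le_trans (ler_normD _ _)) // lerD.
Qed.

Lemma BL_M u v : BL u -> BL v -> BL (fun x => u x * v x).
Proof.
move=> /BL_ge0[M M0 uM] /BL_ge0[N N0 vN]; exists (2 * M * N) => x y.
have [[u1 u2] [v1 v2]] := (uM x y, vN x y); split.
  rewrite normrM (le_trans (ler_pM _ _ u1 v1)) // -mulrA mulr_natl mulr2n lerDl.
  by rewrite mulr_ge0.
have -> : u x * v x - u y * v y = u x * (v x - v y) + (u x - u y) * v y by ring.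
rewrite (le_trans (ler_normD _ _)) // !normrM.
have h1 : `|u x| * `|v x - v y| <= M * (N * enorm (x - y)) by apply: ler_pM.
have h2 : `|u x - u y| * `|v y| <= (M * enorm (x - y)) * N.
  by apply: ler_pM => //; exact: (vN y y).1.
lra.
Qed.

Lemma BL_Z a u : BL u -> BL (fun x => a * u x).
Proof. by move=> bu; apply: BL_M => //; exact: BL_cst. Qed.

Lemma BL_B u v : BL u -> BL v -> BL (fun x => u x - v x).
Proof.
move=> bu bv; under [X in BL X]funext do rewrite -mulN1r.
by apply: BL_D => //; exact: BL_Z.
Qed.

Lemma BL_comp u (T : V -> V) : (forall x y, enorm (T x - T y) <= enorm (x - y)) ->
  BL u -> BL (fun x => u (T x)).
Proof.
move=> iT /BL_ge0[M M0 uM]; exists M => x y; have [h1 h2] := uM (T x) (T y).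
by split => //; rewrite (le_trans h2) // ler_wpM2l.
Qed.

Lemma BL_shift u a : BL u -> BL (fun x => u (a + x)).
Proof. by apply: BL_comp => x y; rewrite opprD addrACA subrr add0r. Qed.

(** With [x + y] this is a correlation. It is the usual convolution for the even kernels; for the
    odd ones it explains the minus sign in [C3_conv]. *)
Definition conv k u (x : V) : R := Lint (fun y => u (x + y) * k y).

Lemma Lig_conv k u x : Lig k -> BL u -> Lig (fun y => u (x + y) * k y).
Proof.
move=> Ik bu; have [M uM] := BL_shift x bu.
apply: (LigM (M := M)) => //; first by apply: BL_measurable; exact: BL_shift.
by move=> y; have [] := uM y y.
Qed.

Lemma conv_cst k a x : Lig k -> conv k (fun=> a) x = a * Lint k.
Proof. by move=> Ik; rewrite /conv LintZ. Qed.

Lemma convD k u v x : Lig k -> BL u -> BL v ->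
  conv k (fun x => u x + v x) x = conv k u x + conv k v x.
Proof.
move=> Ik bu bv; rewrite /conv -LintD; [|exact: Lig_conv|exact: Lig_conv].
by congr Lint; apply/funext => y; rewrite mulrDl.
Qed.

Lemma convB k u v x : Lig k -> BL u -> BL v ->
  conv k (fun x => u x - v x) x = conv k u x - conv k v x.
Proof.
move=> Ik bu bv; rewrite /conv -LintB; [|exact: Lig_conv|exact: Lig_conv].
by congr Lint; apply/funext => y; rewrite mulrBl.
Qed.

Lemma convZ k a u x : Lig k -> BL u -> conv k (fun x => a * u x) x = a * conv k u x.
Proof.
move=> Ik bu; rewrite /conv -LintZ; last exact: Lig_conv.
by congr Lint; apply/funext => y; rewrite mulrA.
Qed.

Lemma conv_le k u v x : Lig k -> (forall y, 0 <= k y) -> BL u -> BL v ->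
  (forall y, u y <= v y) -> conv k u x <= conv k v x.
Proof.
move=> Ik k0 bu bv uv; apply: Lint_le; [exact: Lig_conv|exact: Lig_conv|].
by move=> y; rewrite ler_wpM2r.
Qed.

Lemma conv_ge0 k u x : (forall y, 0 <= k y) -> (forall y, 0 <= u y) -> 0 <= conv k u x.
Proof. by move=> k0 u0; apply: Lint_ge0 => y; rewrite mulr_ge0. Qed.

Lemma BL_conv k u : Lig k -> BL u -> BL (conv k u).
Proof.
move=> Ik bu; have [M M0 uM] := BL_ge0 bu.
exists (M * Lint (fun y => `|k y|)) => x y; split.
  rewrite -LintZ; last exact: Lig_norm.
  apply: Lint_abs; [exact: Lig_conv|(apply: LigZ; exact: Lig_norm)|move=> z].
  by rewrite normrM ler_wpM2r // (uM _ 0).1.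
rewrite /conv -LintB; [|exact: Lig_conv|exact: Lig_conv].
rewrite mulrAC -LintZ; last exact: Lig_norm.
apply: Lint_abs; [|(apply: LigZ; exact: Lig_norm)|].
  by apply: LigB; exact: Lig_conv.
move=> z; rewrite -mulrBl normrM ler_wpM2r //.
by have := (uM (x + z) (y + z)).2; rewrite opprD addrACA subrr addr0.
Qed.

(** Used with a mollifier as one of the kernels: mollification commutes with the time step. *)
Lemma convC k l u x : Lig k -> Lig l -> BL u ->
  conv k (conv l u) x = conv l (conv k u) x.
Proof.
move=> Ik Il bu; have [M M0 uM] := BL_ge0 bu.
rewrite /conv.
transitivity (Lint (fun y => Lint (fun z => u (x + y + z) * l z * k y))).
  congr Lint; apply/funext => y; rewrite mulrC -LintZ; last exact: Lig_conv.
  by congr Lint; apply/funext => z; rewrite mulrC.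
rewrite (@Lint_swap _ _ _ (fun y => M * `|k y|) (fun z => `|l z|)).
- congr Lint; apply/funext => z; rewrite [RHS]mulrC -LintZ; last exact: Lig_conv.
  by congr Lint; apply/funext => y; rewrite (addrAC x y z); ring.
- have mk := Lig_measurable Ik; have ml := Lig_measurable Il.
  apply: measurable_funM; last exact: (measurableT_comp mk measurable_fst).
  apply: measurable_funM; last exact: (measurableT_comp ml measurable_snd).
  have mu : measurable_fun setT (fun y => u (x + y)) by apply: BL_measurable; exact: BL_shift.
  have := measurableT_comp mu measurable_addrV.
  by apply: eq_measurable_fun => p _ /=; rewrite addrA.
- by move=> y; rewrite mulr_ge0.
- by [].
- move=> y z; rewrite !normrM mulrAC ler_wpM2r // ler_wpM2r //.
  exact: (uM _ 0).1.
- by apply: LigZ; exact: Lig_norm.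
- exact: Lig_norm.
Qed.

(** This form has the point [x] in the kernel only, so that a reflection can act on the integration
    variable. *)
Lemma convE k u x : Lig k -> BL u -> conv k u x = Lint (fun z => u z * k (z - x)).
Proof.
move=> Ik bu; rewrite -(Lint_shift x).
  by congr Lint; apply/funext => y; rewrite addrK addrC.
apply: measurable_funM; first exact: BL_measurable.
apply: (measurableT_comp (f := k)); first exact: Lig_measurable.
exact: measurable_shift.
Qed.

End convolution.

(** * Polarization *)

Section polarization.
Context {R : realType} {d : nat}.
Local Notation V := 'rV[R]_d.
Implicit Types (u v w k f g : V -> R) (e x y z : V) (c : R).

Definition rkernel k := [/\ Lig k, forall y, 0 <= k y &
  forall y z, enorm y <= enorm z -> k z <= k y].

Definition rdecr u := forall x y, enorm x <= enorm y -> u y <= u x.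

Lemma rkernel_sym k x y : rkernel k -> enorm x = enorm y -> k x = k y.
Proof. by move=> [_ _ kd] xy; apply/eqP; rewrite eq_le !kd ?xy. Qed.

Lemma rdecr_sym u x y : rdecr u -> enorm x = enorm y -> u x = u y.
Proof. by move=> kd xy; apply/eqP; rewrite eq_le !kd ?xy. Qed.

Lemma edot_reflect e c x : edot e e = 1 -> edot (reflect e c x) e = 2 * c - edot x e.
Proof. by move=> e1; rewrite /reflect !edotE e1; ring. Qed.

Lemma sqr_enorm_reflect e c x : edot e e = 1 ->
  enorm (reflect e c x) ^+ 2 = enorm x ^+ 2 - 4 * c * (edot x e - c).
Proof. by move=> e1; rewrite !sqr_enorm /reflect !edotE e1 (edotC e x); ring. Qed.

Lemma le_enorm_sqr x y : (enorm x <= enorm y) = (enorm x ^+ 2 <= enorm y ^+ 2).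
Proof. by rewrite ler_pXn2r // nnegrE enorm_ge0. Qed.

Lemma enorm_reflect_same e c x z : edot e e = 1 ->
  0 <= (edot x e - c) * (edot z e - c) ->
  enorm (z - x) <= enorm (reflect e c z - x).
Proof.
move=> e1 xz; rewrite le_enorm_sqr !sqr_enorm /reflect !edotE e1 !(edotC e) (edotC z x).
lra.
Qed.

Lemma enorm_reflect_opp e c x z : edot e e = 1 ->
  (edot x e - c) * (edot z e - c) <= 0 ->
  enorm (reflect e c z - x) <= enorm (z - x).
Proof.
move=> e1 xz; rewrite le_enorm_sqr !sqr_enorm /reflect !edotE e1 !(edotC e) (edotC z x).
lra.
Qed.

Section fixed_hyperplane.
Variables (e : V) (c : R).
Hypothesis e1 : edot e e = 1.
Local Notation s := (reflect e c).

(* [w'] is dominated in its even part, and dominates on the half-space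
   [c <= edot x e] in its odd part. *)
Definition pol w w' := forall x, c <= edot x e ->
  w x + w (s x) <= w' x + w' (s x) /\ `|w x - w (s x)| <= w' x - w' (s x).

Lemma pol_even w w' x : pol w w' -> w x + w (s x) <= w' x + w' (s x).
Proof.
move=> ww'; have [h|h] := leP c (edot x e); first by have [] := ww' x h.
have sx : c <= edot (s x) e by rewrite edot_reflect //; lra.
by have [] := ww' _ sx; rewrite reflectK // addrC (addrC (w' _)).
Qed.

(** The two inequalities of [pol] add up to [max (w x) (w (s x)) <= w' x] on the half-space. This is
    how a bound on the iterates for a polarized function returns to the original one. *)
Lemma pol_ub w w' M : pol w w' -> (forall x, w' x <= M) -> forall x, w x <= M.
Proof.
move=> ww' w'M x; have [h|h] := leP c (edot x e).
  have [h1] := ww' x h; rewrite ler_norml => /andP[h2 h3].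
  by have := w'M x; lra.
have sx : c <= edot (s x) e by rewrite edot_reflect //; lra.
have [h1] := ww' _ sx; rewrite reflectK // in h1 *; rewrite ler_norml => /andP[h2 h3].
by have := w'M (s x); lra.
Qed.

Lemma pol_D w w' v v' : pol w w' -> pol v v' ->
  pol (fun x => w x + v x) (fun x => w' x + v' x).
Proof.
move=> ww' vv' x h; have [w1 w2] := ww' x h; have [v1 v2] := vv' x h.
split; first by lra.
rewrite (_ : _ + _ - _ = (w x - w (s x)) + (v x - v (s x))); last by ring.
by apply: le_trans (ler_normD _ _) _; lra.
Qed.

Lemma pol_Z a w w' : 0 <= a -> pol w w' -> pol (fun x => a * w x) (fun x => a * w' x).
Proof.
move=> a0 ww' x h; have [w1 w2] := ww' x h; split.
  by rewrite -!mulrDr ler_wpM2l.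
by rewrite -!mulrBr normrM ger0_norm // ler_wpM2l.
Qed.

Lemma pol_cst a : pol (fun=> a) (fun=> a).
Proof. by move=> x _; rewrite !subrr normr0. Qed.

(** Twice the even part of a product is even times even plus odd times odd, and twice the odd part
    is the sum of the two mixed products. Nonnegativity lets the inequalities be multiplied. *)
Lemma pol_M w w' v v' : (forall x, 0 <= w x) -> (forall x, 0 <= v x) ->
  pol w w' -> pol v v' -> pol (fun x => w x * v x) (fun x => w' x * v' x).
Proof.
move=> w0 v0 ww' vv' x h; have [w1 w2] := ww' x h; have [v1 v2] := vv' x h.
move: (w0 x) (w0 (s x)) (v0 x) (v0 (s x)) w1 w2 v1 v2.
move: (w x) (w (s x)) (v x) (v (s x)) (w' x) (w' (s x)) (v' x) (v' (s x)).
move=> a b p q a' b' p' q' a0 b0 p0 q0 h1 h2 h3 h4.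
have hE : (a + b) * (p + q) <= (a' + b') * (p' + q') by apply: ler_pM => //; lra.
have hO : `|a - b| * `|p - q| <= (a' - b') * (p' - q') by apply: ler_pM.
have hX : (a + b) * `|p - q| <= (a' + b') * (p' - q') by apply: ler_pM => //; lra.
have hY : `|a - b| * (p + q) <= (a' - b') * (p' + q') by apply: ler_pM => //; lra.
have := ler_norm ((a - b) * (p - q)); rewrite normrM => hO'; split; first by lra.
rewrite (_ : a * p - b * q = ((a + b) * (p - q) + (a - b) * (p + q)) / 2); last by field.
rewrite normrM (ger0_norm (x := 2^-1)) //.
have := ler_normD ((a + b) * (p - q)) ((a - b) * (p + q)).
rewrite !normrM (ger0_norm (x := a + b)) ?(ger0_norm (x := p + q)); lra.
Qed.

Lemma conv_reflect k u x : rkernel k -> BL u ->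
  conv k u (s x) = conv k (fun y => u (s y)) x.
Proof.
move=> rk bu; have [Ik _ _] := rk.
have bus : BL (fun y => u (s y)).
  by apply: (BL_comp (T := s)) => // a b; rewrite enorm_reflectB.
rewrite !convE // -(Lint_reflect c e1).
  congr Lint; apply/funext => z; congr (_ * _).
  by apply: rkernel_sym => //; rewrite enorm_reflectB.
apply: measurable_funM; first exact: BL_measurable.
apply: (measurableT_comp (f := k)); first exact: Lig_measurable.
exact: measurable_shift.
Qed.

(** Folding the integral along the hyperplane replaces the kernel by [k (z - x) - k (s z - x)]. For
    [x] in the half-space this has the sign of [o z], because of two mirror points the one on the
    side of [x] is the nearer to [x]. *)
Lemma conv_antisym_ge0 k o : rkernel k -> BL o ->
  (forall x, o (s x) = - o x) -> (forall x, c <= edot x e -> 0 <= o x) ->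
  forall x, c <= edot x e -> 0 <= conv k o x.
Proof.
move=> rk bo oA o0 x xH; have [Ik k0 kd] := rk.
rewrite convE //.
have mk : measurable_fun setT (fun z => k (z - x)).
  apply: (measurableT_comp (f := k)); first exact: Lig_measurable.
  exact: measurable_shift.
have I1 : Lig (fun z => o z * k (z - x)).
  have [M oM] := bo.
  apply: (LigM (M := M)) => [|y|]; first exact: BL_measurable.
    exact: (oM y y).1.
  exact: (Lig_shift (- x) Ik).
have E : Lint (fun z => o z * k (z - x)) = - Lint (fun z => o z * k (s z - x)).
  rewrite -(Lint_reflect c e1 (Lig_measurable I1)) -LintN.
    by congr Lint; apply/funext => z; rewrite oA mulNr.
  have := LigN (Lig_reflect c e1 I1).
  by under [X in Lig X]funext do rewrite oA mulNr opprK.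
have I2 : Lig (fun z => o z * k (s z - x)).
  have := LigN (Lig_reflect c e1 I1).
  by under [X in Lig X]funext do rewrite oA mulNr opprK.
suff : 0 <= Lint (fun z => o z * k (z - x)) - Lint (fun z => o z * k (s z - x)) by lra.
rewrite -LintB //; apply: Lint_ge0 => z; rewrite -mulrBr.
have [zH|zH] := leP c (edot z e).
  rewrite mulr_ge0 ?o0 // subr_ge0 kd // enorm_reflect_same //.
  by rewrite mulr_ge0 // subr_ge0.
have szH : c <= edot (s z) e by rewrite edot_reflect //; lra.
have := o0 _ szH; rewrite oA oppr_ge0 => oz.
rewrite mulr_le0 // subr_le0 kd // enorm_reflect_opp //.
by rewrite mulr_ge0_le0 // ?subr_ge0 // subr_le0 ltW.
Qed.

(** Convolution with a radial kernel commutes with [s]. The even parts then compare by monotonicity;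
    each sign of the absolute value leads to an antisymmetric function, to which [conv_antisym_ge0]
    applies. *)
Lemma pol_conv k w w' : rkernel k -> BL w -> BL w' -> pol w w' ->
  pol (conv k w) (conv k w').
Proof.
move=> rk bw bw' ww'; have [Ik k0 kd] := rk.
have bs u : BL u -> BL (fun y => u (s y)).
  by move=> bu; apply: (BL_comp (T := s)) => // a b; rewrite enorm_reflectB.
have [bws bws'] := (bs _ bw, bs _ bw').
move=> x xH; rewrite !conv_reflect // -!convD // -!convB //; split.
  apply: conv_le => //; [exact: BL_D|exact: BL_D|move=> y].
  exact: pol_even.
have bo := BL_B bw bws; have bo' := BL_B bw' bws'.
rewrite ler_norml; apply/andP; split.
  rewrite -[X in X <= _]add0r lerBlDr -convD //.
  apply: conv_antisym_ge0 => //; first exact: BL_D.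
    by move=> y; rewrite !reflectK //; ring.
  move=> y yH; have [_] := ww' y yH; rewrite ler_norml => /andP[]; lra.
rewrite -subr_ge0 -convB //.
apply: conv_antisym_ge0 => //; first exact: BL_B.
  by move=> y; rewrite !reflectK //; ring.
move=> y yH; have [_] := ww' y yH; rewrite ler_norml => /andP[]; lra.
Qed.

(** The two-point rearrangement across the hyperplane [edot x e = c]. For [c <= 0] the favoured side
    contains the origin. *)
Definition polarize u x : R :=
  if c <= edot x e then Num.max (u x) (u (s x)) else Num.min (u x) (u (s x)).

Lemma reflect_id x : edot x e = c -> s x = x.
Proof. by move=> h; rewrite /reflect h subrr mulr0 scale0r subr0. Qed.

Lemma polarizeE u x : c <= edot x e ->
  polarize u x = Num.max (u x) (u (s x)) /\ polarize u (s x) = Num.min (u x) (u (s x)).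
Proof.
move=> h; rewrite /polarize h; split => //.
rewrite edot_reflect //; case: ifPn => [h'|_]; last by rewrite reflectK // minC.
have sx : s x = x by apply: reflect_id; lra.
by rewrite sx sx maxxx minxx.
Qed.

Lemma pol_polarize u : pol u (polarize u).
Proof.
move=> x h; have [-> ->] := polarizeE u h.
by case: (leP (u x) (u (s x))) => h'; split; [lra|rewrite ler_norml; lra|
  lra|rewrite ler_norml; lra].
Qed.

Lemma polarize_rng u (P : R -> Prop) : (forall x, P (u x)) -> forall x, P (polarize u x).
Proof. by move=> uP x; rewrite /polarize; case: ifP => _; case: leP. Qed.

(** Polarization only permutes the values on each mirror pair. It is used with [g] the identity and
    with [g] the indicator of the positive numbers. *)
Lemma polarize_sum u (g : R -> R) x :
  g (polarize u x) + g (polarize u (s x)) = g (u x) + g (u (s x)).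
Proof.
wlog h : x / c <= edot x e => [hw|].
  have [h|h] := leP c (edot x e); first exact: hw.
  have sx : c <= edot (s x) e by rewrite edot_reflect //; lra.
  by have := hw _ sx; rewrite reflectK // addrC (addrC (g (u _))).
by have [-> ->] := polarizeE u h; case: leP => _ //; rewrite addrC.
Qed.

End fixed_hyperplane.

End polarization.

Section radial_decrease.
Context {R : realType} {d : nat}.
Local Notation V := 'rV[R]_d.
Implicit Types (u v w k f g : V -> R) (e x y z : V) (c : R).

Lemma rdecr_pol u e c : edot e e = 1 -> c <= 0 -> rdecr u -> pol e c u u.
Proof.
move=> e1 c0 ru x xH; split => //; rewrite ger0_norm // subr_ge0 ru //.
rewrite le_enorm_sqr sqr_enorm_reflect // lerBrDl gerDr.
by rewrite mulr_le0_ge0 ?subr_ge0 // mulr_ge0_le0.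
Qed.

(** The hyperplane is the perpendicular bisector of [x] and [y]; the origin lies on the side of [x],
    the nearer of the two. The last identity measures the distance from the hyperplane to the
    origin. *)
Lemma exists_reflect x y : x != y -> enorm x <= enorm y ->
  exists e c, [/\ edot e e = 1, c <= 0, c <= edot x e, reflect e c x = y &
    2 * c * enorm (x - y) = enorm x ^+ 2 - enorm y ^+ 2].
Proof.
move=> xy nxy; pose n := enorm (x - y).
have n0 : 0 < n by rewrite enorm_gt0 subr_eq0.
have nn : n ^+ 2 = edot x x - 2 * edot x y + edot y y.
  by rewrite sqr_enorm !edotE (edotC y x); ring.
have nu : n != 0 by rewrite gt_eqF.
have h2 : edot x x <= edot y y by rewrite -!sqr_enorm -le_enorm_sqr.
pose c := (edot x x - edot y y) / (2 * n).
have xe : edot x (n^-1 *: (x - y)) - c = n / 2.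
  rewrite /c !edotE; apply: (mulIf (x := 2 * n)); first by rewrite mulf_neq0.
  rewrite mulrBl divfK ?mulf_neq0 //.
  rewrite (_ : n / 2 * _ = n ^+ 2); last by field.
  by rewrite nn; field.
exists (n^-1 *: (x - y)), c; split.
- have -> : edot (n^-1 *: (x - y)) (n^-1 *: (x - y)) = n ^+ 2 / n ^+ 2.
    by rewrite {1}nn !edotE (edotC y x); field.
  by rewrite divff // sqrf_eq0.
- by rewrite /c pmulr_lle0 ?invr_gt0 ?mulr_gt0 // subr_le0.
- by rewrite -subr_ge0 xe divr_ge0 // ltW.
- rewrite /reflect xe mulrCA divff // mulr1 scalerA divff // scale1r.
  by rewrite opprB addrC subrK.
- by rewrite -/n !sqr_enorm /c; field.
Qed.

(** With [rdecr_pol] this characterizes radial monotonicity by polarizations towards the origin, so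
    every operation that preserves [pol] also preserves [rdecr]. *)
Lemma pol_rdecr u :
  (forall e c, edot e e = 1 -> c <= 0 -> pol e c u u) -> rdecr u.
Proof.
move=> pu x y xy; have [->//|nxy] := eqVneq x y.
have [e [c [e1 c0 xH <- _]]] := exists_reflect nxy xy.
have [_ h] := pu e c e1 c0 x xH.
by rewrite -subr_ge0; exact: le_trans h.
Qed.

Lemma rdecr_conv k u : rkernel k -> BL u -> rdecr u -> rdecr (conv k u).
Proof.
by move=> rk bu ru; apply: pol_rdecr => e c e1 c0; apply: pol_conv => //; exact: rdecr_pol.
Qed.

(** On one side, maximum and minimum are 1-Lipschitz. For points on opposite sides, [x] and [s y],
    as well as [s x] and [y], are no farther apart than [x] and [y], so all pairings of values are
    controlled. The constant does not deteriorate, as a chain of polarizations requires. *)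
Lemma polarize_lipschitz e c u M : edot e e = 1 ->
  (forall x y, `|u x - u y| <= M * enorm (x - y)) ->
  forall x y, `|polarize e c u x - polarize e c u y| <= M * enorm (x - y).
Proof.
move=> e1 uM x y.
have M0 : x != y -> 0 <= M.
  move=> xy; have := le_trans (normr_ge0 _) (uM x y).
  by rewrite pmulr_lge0 // enorm_gt0 subr_eq0.
have [->|nxy] := eqVneq x y; first by rewrite !subrr normr0 enorm0 mulr0.
have := M0 nxy => {}M0.
have h1 := uM x y.
have h2 : `|u (reflect e c x) - u (reflect e c y)| <= M * enorm (x - y).
  by rewrite (le_trans (uM _ _)) // enorm_reflectB.
have cross : (edot x e - c) * (edot y e - c) <= 0 ->
    `|u x - u (reflect e c y)| <= M * enorm (x - y) /\
    `|u (reflect e c x) - u y| <= M * enorm (x - y).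
  move=> h; split; rewrite (le_trans (uM _ _)) // ler_wpM2l //.
    by rewrite enormB (enormB x) enorm_reflect_opp.
  by rewrite enorm_reflect_opp // mulrC.
move: h1 h2 cross; rewrite /polarize.
move: (u x) (u (reflect e c x)) (u y) (u (reflect e c y)) => a b p q.
move: (M * _) => D h1 h2 cross.
have [xH|xH] := leP c (edot x e); have [yH|yH] := leP c (edot y e).
- by case: (leP a b) => ?; case: (leP p q) => ?; move: h1 h2; rewrite !ler_norml; lra.
- have [|h3 h4] := cross; first by rewrite mulr_ge0_le0 // ?subr_ge0 // subr_le0 ltW.
  by case: (leP a b) => ?; case: (leP p q).
- have [|h3 h4] := cross; first by rewrite mulr_le0_ge0 // ?subr_ge0 // subr_le0 ltW.
  by case: (leP a b) => ?; case: (leP p q).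
- by case: (leP a b) => ?; case: (leP p q) => ?; move: h1 h2; rewrite !ler_norml; lra.
Qed.

Lemma BL_polarize e c u : edot e e = 1 -> BL u -> BL (polarize e c u).
Proof.
move=> e1 [M uM]; exists M => x y; split.
  by apply: (@polarize_rng _ _ e c u (fun t => `|t| <= M)) => z; exact: (uM z z).1.
by apply: polarize_lipschitz => // a b; exact: (uM a b).2.
Qed.

End radial_decrease.

(** * The iteration and its monotonicity *)

Section scheme.
Context {R : realType} {d : nat}.
Local Notation V := 'rV[R]_d.
Variables (k : V -> R) (a h : R).
Hypotheses (rk : rkernel k) (a0 : 0 <= a) (h0 : 0 <= h).
Implicit Types (f g : V -> R) (n : nat).

(** The coefficient [a] stands for [h * (m + lam1)]. Starting from 0 makes the sequence
    nondecreasing for nonnegative [f]. *)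
Fixpoint scheme f n : V -> R :=
  if n is n'.+1 then fun x => conv k (scheme f n') x + a * (f x * scheme f n' x) + h
  else fun=> 0.

Lemma scheme_BL f n : BL f -> BL (scheme f n).
Proof.
have [Ik _ _] := rk; move=> bf; elim: n => [|n IH] /=; first exact: BL_cst.
apply: BL_D; last exact: BL_cst.
by apply: BL_D; [exact: BL_conv|apply: BL_Z; exact: BL_M].
Qed.

Lemma scheme_ge0 f n x : (forall x, 0 <= f x) -> 0 <= scheme f n x.
Proof.
have [_ k0 _] := rk; move=> f0; elim: n x => [|n IH] x //=.
by rewrite !addr_ge0 ?conv_ge0 // !mulr_ge0.
Qed.

Lemma scheme_le f g n x : BL f -> BL g -> (forall x, 0 <= f x) ->
  (forall x, f x <= g x) -> scheme f n x <= scheme g n x.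
Proof.
have [Ik k0 _] := rk; move=> bf bg f0 fg; elim: n x => [|n IH] x //=.
rewrite lerD2r lerD //.
  by apply: conv_le => //; exact: scheme_BL.
by rewrite ler_wpM2l // ler_pM // scheme_ge0.
Qed.

Lemma scheme_incr f n x : BL f -> (forall x, 0 <= f x) ->
  scheme f n x <= scheme f n.+1 x.
Proof.
have [Ik k0 _] := rk; move=> bf f0; elim: n x => [|n IH] x.
  exact: (scheme_ge0 1).
rewrite [leLHS]/= [leRHS]/= lerD2r lerD //.
  exact: (conv_le _ Ik k0 (scheme_BL n bf) (scheme_BL n.+1 bf)).
by rewrite ler_wpM2l // ler_wpM2l.
Qed.

Lemma scheme_pol e c f g n : edot e e = 1 -> BL f -> BL g ->
  (forall x, 0 <= f x) -> pol e c f g -> pol e c (scheme f n) (scheme g n).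
Proof.
have [Ik k0 _] := rk; move=> e1 bf bg f0 fg; elim: n => [|n IH] /=; first exact: pol_cst.
apply: pol_D; last exact: pol_cst.
apply: pol_D; first by apply: pol_conv => //; exact: scheme_BL.
by apply: pol_Z => //; apply: pol_M => // x; exact: scheme_ge0.
Qed.

Lemma scheme_rdecr f n : BL f -> (forall x, 0 <= f x) -> rdecr f -> rdecr (scheme f n).
Proof.
move=> bf f0 rf; apply: pol_rdecr => e c e1 c0.
by apply: scheme_pol => //; exact: rdecr_pol.
Qed.

End scheme.

(** * Rearrangement by finitely many polarizations *)

Section polarization_chain.
Context {R : realType} {d : nat}.
Local Notation V := 'rV[R]_d.
Implicit Types (u v w k f g : V -> R) (e x y z : V) (c : R).

Lemma Lig_indic (A : set V) : measurable A -> (lebesgue_rV d A < +oo)%E ->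
  Lig (\1_A : V -> R).
Proof.
move=> mA Aoo; apply/integrableP; split.
  by apply/measurable_EFinP; exact: measurable_indic.
under eq_integral do rewrite /= ger0_norm //.
by rewrite integral_indic // setIT.
Qed.

Lemma Lint_indic (A : set V) : measurable A ->
  Lint (\1_A : V -> R) = fine (lebesgue_rV d A).
Proof. by move=> mA; rewrite /Lint /Rintegral integral_indic // setIT. Qed.

Lemma Lig_eball r : Lig (\1_(eball r) : V -> R).
Proof. by apply: Lig_indic; [exact: measurable_eball|exact: lebesgue_rV_eball_lty]. Qed.

Lemma Lint_eball_gt0 (r : R) : 0 < r -> 0 < Lint (\1_(eball r) : V -> R).
Proof.
move=> r0; rewrite Lint_indic; last exact: measurable_eball.
apply: fine_gt0; rewrite lebesgue_rV_eball_lty andbT.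
by apply: lebesgue_rV_open_gt0; [exact: eball_open|exists 0; rewrite /eball /= enorm0].
Qed.

Lemma measurable_enorm : measurable_fun setT (@enorm R d).
Proof. by apply: continuous_measurable_rV; exact: enorm_continuous. Qed.

Lemma in_eball (r : R) x : (x \in eball r) = (enorm x < r).
Proof. by apply/idP/idP => [/set_mem|h]; [|apply/mem_set]. Qed.

Lemma Lig_supp f (M r : R) : measurable_fun setT f ->
  (forall x, `|f x| <= M) -> (forall x, r <= enorm x -> f x = 0) -> Lig f.
Proof.
move=> mf fM f0; apply: (Lig_dom mf (g := fun x => M * \1_(eball r) x)) => [x|].
  rewrite indicE in_eball; case: ltP => [_|/f0 ->]; first by rewrite mulr1.
  by rewrite normr0 mulr0.
by apply: LigZ; exact: Lig_eball.
Qed.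

Lemma enorm_le_reflect e c x : edot e e = 1 -> c <= 0 -> c <= edot x e ->
  enorm x <= enorm (reflect e c x).
Proof.
move=> e1 c0 h; rewrite le_enorm_sqr sqr_enorm_reflect // lerBrDl gerDr.
by rewrite mulr_le0_ge0 ?subr_ge0 // mulr_ge0_le0.
Qed.

Lemma polarize_eq0 u e c (r : R) : edot e e = 1 -> c <= 0 -> (forall x, 0 <= u x) ->
  (forall x, r <= enorm x -> u x = 0) -> forall x, r <= enorm x -> polarize e c u x = 0.
Proof.
move=> e1 c0 uge0 u0 x xr; have [xH|xH] := leP c (edot x e).
  by rewrite /polarize xH u0 // u0 ?maxxx // (le_trans xr) // enorm_le_reflect.
rewrite /polarize (leNgt c) xH /= u0 //.
by apply/eqP; rewrite eq_le ge_min lexx /= le_min lexx uge0.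
Qed.

(** The second moment is the quantity that polarization decreases. The change [v - u] is odd under
    the reflection, so its second moment can be averaged with that of its mirror image; the two
    factors of the resulting integrand have the same sign on either side of the hyperplane. *)
Lemma polarization_gain u e c (r : R) : edot e e = 1 -> BL u ->
  (forall x, r <= enorm x -> u x = 0) -> c <= 0 ->
  (forall x, 0 <= u x) ->
  2 * (Lint (fun z => u z * enorm z ^+ 2) - Lint (fun z => polarize e c u z * enorm z ^+ 2))
  = Lint (fun z => (polarize e c u z - u z) * (enorm (reflect e c z) ^+ 2 - enorm z ^+ 2))
  /\ Lig (fun z => (polarize e c u z - u z) * (enorm (reflect e c z) ^+ 2 - enorm z ^+ 2))
  /\ (forall z, 0 <= (polarize e c u z - u z) * (enorm (reflect e c z) ^+ 2 - enorm z ^+ 2)).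
Proof.
move=> e1 bu u0 c0 uge0; set v := polarize e c u.
have bv : BL v by exact: BL_polarize.
have v0 x : r <= enorm x -> v x = 0 by exact: polarize_eq0.
have ms : measurable_fun setT (fun z : V => enorm z ^+ 2).
  by apply: measurable_funX; exact: measurable_enorm.
have I2 w : BL w -> (forall x, r <= enorm x -> w x = 0) -> Lig (fun z => w z * enorm z ^+ 2).
  move=> bw w0; have [M M0 wM] := BL_ge0 bw.
  apply: (@Lig_supp _ (M * r ^+ 2) r) => [|x|x xr]; last by rewrite w0 ?mul0r.
    by apply: measurable_funM => //; exact: BL_measurable.
  have [xr|xr] := leP r (enorm x).
    by rewrite w0 // mul0r normr0 mulr_ge0 ?sqr_ge0.
  rewrite normrM ler_pM // ?(wM x x).1 // ger0_norm ?sqr_ge0 //.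
  have r0 : 0 <= r by have := enorm_ge0 x; lra.
  by rewrite ler_pXn2r ?nnegrE ?enorm_ge0 // ltW.
pose g z := v z - u z.
have bg : BL g by exact: BL_B.
have g0 x : r <= enorm x -> g x = 0 by move=> xr; rewrite /g u0 // v0 // subr0.
have Ig := I2 g bg g0.
have gs z : g (reflect e c z) = - g z.
  have /(_ u id z) := polarize_sum c e1; rewrite /g /v /=; lra.
have Igs : Lig (fun z => - (g z * enorm (reflect e c z) ^+ 2)).
  have := Lig_reflect c e1 Ig.
  by under [X in Lig X]funext do rewrite gs mulNr.
have E : Lint (fun z => g z * enorm z ^+ 2) = Lint (fun z => - (g z * enorm (reflect e c z) ^+ 2)).
  rewrite -(Lint_reflect c e1 (Lig_measurable Ig)); congr Lint.
  by apply/funext => z; rewrite gs mulNr.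
have Iall : Lig (fun z => g z * (enorm (reflect e c z) ^+ 2 - enorm z ^+ 2)).
  have := LigD (LigN Ig) (LigN Igs).
  by under [X in Lig X]funext do rewrite opprK addrC -mulrBr.
split; last split => //.
- have -> : Lint (fun z => u z * enorm z ^+ 2) - Lint (fun z => v z * enorm z ^+ 2) =
     - Lint (fun z => g z * enorm z ^+ 2).
    rewrite -LintB; [|exact: I2|exact: I2]; rewrite -LintN //; congr Lint.
    by apply/funext => z; rewrite /g; ring.
  rewrite mulr_natl mulr2n {2}E -!LintN // -LintD; [|exact: LigN|exact: LigN].
  by congr Lint; apply/funext => z; rewrite -/(g z); ring.
- move=> z; have [zH|zH] := leP c (edot z e).
    rewrite mulr_ge0 // ?subr_ge0 -?le_enorm_sqr ?enorm_le_reflect //.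
    by rewrite /v /polarize zH le_max lexx.
  rewrite mulr_le0 // ?subr_le0.
    by rewrite /v /polarize (leNgt c) zH /= ge_min lexx.
  rewrite -le_enorm_sqr -{2}(reflectK c e1 z) enorm_le_reflect // edot_reflect //; lra.
Qed.

(** Take [x] far out with a value at least 1/2 and a nearer zero [y], and polarize across their
    bisector. By the Lipschitz bound all the points near [y] gain at least 1/4, and each of them has
    a mirror image farther from the origin by a fixed amount. The decrease [gamma] therefore does
    not depend on [u], [x] or [y]. *)
Lemma polarization_step u (L r rho rho' : R) : 0 < L -> 0 <= rho' -> rho' < rho ->
  exists2 gamma : R, 0 < gamma & forall u,
  (forall x y, `|u x - u y| <= L * enorm (x - y)) ->
  (forall x, 0 <= u x <= 1) -> (forall x, r <= enorm x -> u x = 0) ->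
  forall x y, rho <= enorm x -> 2^-1 <= u x -> enorm y < rho' -> u y = 0 ->
  exists e c, [/\ edot e e = 1, c <= 0 &
    Lint (fun z => polarize e c u z * enorm z ^+ 2) <=
    Lint (fun z => u z * enorm z ^+ 2) - gamma].
Proof.
(* The first bound keeps the ball around [y] at distance at least [enorm (y - x) / 4] from the
   hyperplane; the second keeps the variation of [u] on it below 1/8. *)
move=> L0 rho'0 rr; pose t := Num.min ((rho - rho') / 4) (8 * L)^-1.
have t0 : 0 < t by rewrite lt_min divr_gt0 ?invr_gt0 ?mulr_gt0 ?subr_gt0.
pose D := rho ^+ 2 - rho' ^+ 2.
have D0 : 0 < D by rewrite subr_gt0 ltr_pXn2r ?nnegrE // (le_trans rho'0) // ltW.
exists (D / 16 * Lint (\1_(eball t) : V -> R)).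
  by rewrite mulr_gt0 ?divr_gt0 // Lint_eball_gt0.
move=> {}u uL u01 u0 x y xr ux yr uy.
have bu : BL u.
  exists (1 + L) => a b; have /andP[h1 h2] := u01 a; split.
    by rewrite ger0_norm //; lra.
  by rewrite (le_trans (uL _ _)) // ler_wpM2r ?enorm_ge0 //; lra.
have yx : y != x by apply/eqP => yx; move: yr xr; rewrite yx; lra.
have nyx : enorm y <= enorm x by lra.
have [e [c [e1 c0 yH syx E]]] := exists_reflect yx nyx.
exists e, c; split => //.
have [G [IG G0]] := polarization_gain e1 bu u0 c0 (fun z => (andP (u01 z)).1).
suff : D / 8 * Lint (\1_(eball t) : V -> R) <=
  2 * (Lint (fun z => u z * enorm z ^+ 2) -
       Lint (fun z => polarize e c u z * enorm z ^+ 2)) by lra.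
rewrite {}G -LintZ; last exact: Lig_eball.
rewrite -(Lint_shift (- y)); last by apply: measurable_funM => //; apply: measurable_indic; exact: measurable_eball.
apply: Lint_le => //.
  by apply: (Lig_shift (- y) (f := fun x => _ * \1_(eball t) x)); apply: LigZ; exact: Lig_eball.
move=> z; rewrite indicE in_eball; case: ltP => [zt|_]; last by rewrite mulr0.
have tr : t <= (rho - rho') / 4 by rewrite ge_min lexx.
have tL : L * t <= 1 / 8.
  have : t <= (8 * L)^-1 by rewrite ge_min lexx orbT.
  by rewrite -ler_pdivlMl // invfM mulrC mul1r.
have n0 : rho - rho' <= enorm (y - x).
  by have := ler_enormB x y; rewrite ler_norml enormB => /andP[]; lra.
have ye : edot y e - c = enorm (y - x) / 2.
  have : enorm (y - reflect e c y) = 2 * (edot y e - c).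
    rewrite /reflect opprB addrC subrK enormZ.
    rewrite ger0_norm ?mulr_ge0 ?subr_ge0 //.
    by rewrite /enorm e1 sqrtr1 mulr1.
  rewrite syx; lra.
have ze : edot z e - c >= enorm (y - x) / 4.
  have := edot_le (z - y) e; rewrite {2}/enorm e1 sqrtr1 mulr1 edotBl ler_norml => /andP[h _].
  lra.
have zH : c <= edot z e by have := enorm_ge0 (y - x); lra.
have h1 : D / 2 <= enorm (reflect e c z) ^+ 2 - enorm z ^+ 2.
  rewrite sqr_enorm_reflect //.
  have : (- c) * (enorm (y - x) / 4) <= - c * (edot z e - c) by rewrite ler_wpM2l // oppr_ge0.
  have : enorm y ^+ 2 <= rho' ^+ 2 by rewrite ler_pXn2r ?nnegrE ?enorm_ge0 // ltW.
  have : rho ^+ 2 <= enorm x ^+ 2 by rewrite ler_pXn2r ?nnegrE ?enorm_ge0 //; lra.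
  by rewrite /D; lra.
have h2 : 4^-1 <= polarize e c u z - u z.
  have hm : u (reflect e c z) <= polarize e c u z by rewrite /polarize zH le_max lexx orbT.
  have a1 := uL z y; have a2 := uL (reflect e c z) x.
  rewrite -{2}syx enorm_reflectB // in a2.
  have a3 : L * enorm (z - y) <= 1 / 8.
    by rewrite (le_trans _ tL) // ler_wpM2l // ltW.
  move: a1 a2; rewrite !ler_norml uy => /andP[_ b1] /andP[b2 _]; lra.
have : 4^-1 * (D / 2) <= (polarize e c u z - u z) * (enorm (reflect e c z) ^+ 2 - enorm z ^+ 2).
  by apply: ler_pM => //; rewrite divr_ge0 // ltW.
rewrite mulr1; lra.
Qed.

Lemma polarization_support u e c : edot e e = 1 ->
  Lig (fun z => (0 < u z)%R%:R : R) -> Lig (fun z => (0 < polarize e c u z)%R%:R : R) ->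
  Lint (fun z => (0 < polarize e c u z)%R%:R) = Lint (fun z => (0 < u z)%R%:R).
Proof.
move=> e1 Iu Iv.
have Ius := Lig_reflect c e1 Iu; have Ivs := Lig_reflect c e1 Iv.
have h (f : V -> R) : Lig f -> 2 * Lint f = Lint (fun z => f z + f (reflect e c z)).
  move=> If; rewrite LintD //; last exact: Lig_reflect.
  by rewrite (Lint_reflect c e1 (Lig_measurable If)); ring.
apply: (mulfI (x := 2)) => //; rewrite !h //; congr Lint; apply/funext => z.
exact: (polarize_sum c e1 u (fun t => (0 < t)%R%:R)).
Qed.

(** The second moment is nonnegative and drops by at least [gamma] at each step, so the chain is
    finite. [P] stays abstract: it is later an implication that carries a bound backwards along the
    chain. *)
Lemma polarization_chain (P : (V -> R) -> Prop) u0 (L r rho rho' : R) :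
  0 < L -> 0 <= rho' -> rho' < rho ->
  (forall x y, `|u0 x - u0 y| <= L * enorm (x - y)) ->
  (forall x, 0 <= u0 x <= 1) -> (forall x, r <= enorm x -> u0 x = 0) ->
  Lint (fun z => (0 < u0 z)%R%:R) < Lint (\1_(eball rho') : V -> R) ->
  P u0 -> (forall u e c, (forall x y, `|u x - u y| <= L * enorm (x - y)) ->
     (forall x, 0 <= u x <= 1) ->
     edot e e = 1 -> c <= 0 -> P u -> P (polarize e c u)) ->
  exists u, [/\ P u, forall x y, `|u x - u y| <= L * enorm (x - y),
     forall x, 0 <= u x <= 1 & forall x, rho <= enorm x -> u x < 2^-1].
Proof.
move=> L0 r'0 rr uL u01 us m0 Pu0 PS.
have [gamma g0 step] := polarization_step u0 r L0 r'0 rr.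
pose Inv u := [/\ P u, forall x y, `|u x - u y| <= L * enorm (x - y),
  forall x, 0 <= u x <= 1, forall x, r <= enorm x -> u x = 0 &
  Lint (fun z => (0 < u z)%R%:R) < Lint (\1_(eball rho') : V -> R)].
have Lpos u : (forall x y, `|u x - u y| <= L * enorm (x - y)) ->
    (forall x, 0 <= u x <= 1) -> (forall x, r <= enorm x -> u x = 0) ->
    Lig (fun z => (0 < u z)%R%:R : R).
  move=> lu u1 u0'; apply: (@Lig_supp _ 1 r) => [|x|x /u0' ->]; last by rewrite ltxx.
    have bu : BL u.
      exists (1 + L) => a b; have /andP[h1 h2] := u1 a; split.
        by rewrite ger0_norm //; lra.
      by rewrite (le_trans (lu _ _)) // ler_wpM2r ?enorm_ge0 //; lra.
    have -> : (fun z => (0 < u z)%R%:R : R) = \1_(u @^-1` `]0, +oo[).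
      apply/funext => z; rewrite indicE; have [h|h] := ltP 0 (u z).
        by rewrite mem_set //= in_itv /= h.
      by rewrite memNset //= in_itv /= andbT ltNge h.
    apply: measurable_indic; rewrite -[X in measurable X]setTI.
    exact: (BL_measurable bu).
  by case: (_ < _); rewrite ?normr0 ?normr1.
have stepInv u x : Inv u -> rho <= enorm x -> 2^-1 <= u x ->
    exists2 v, Inv v & Lint (fun z => v z * enorm z ^+ 2) <=
      Lint (fun z => u z * enorm z ^+ 2) - gamma.
  move=> [Pu lu u1 su mu] xr ux.
  (* Otherwise [u] would be positive on the whole of [eball rho'], against the bound on the measure
     of its support. *)
  have [y [yr uy]] : exists y, enorm y < rho' /\ u y = 0.
    apply: contrapT => hn; move: mu; rewrite ltNge => /negP; apply.
    apply: Lint_le; [exact: Lig_eball|exact: Lpos|move=> z].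
    rewrite indicE in_eball; case: ltP => // zr; have /andP[uz _] := u1 z.
    by rewrite lt_def uz andbT; case: eqP => // uz0; case: hn; exists z.
  have [e [c [e1 c0 dec]]] := step u lu u1 su x y xr ux yr uy.
  exists (polarize e c u) => //.
  have lv := polarize_lipschitz c e1 lu.
  have v1 : forall z, 0 <= polarize e c u z <= 1.
    exact: (@polarize_rng _ _ e c u (fun t => 0 <= t <= 1)).
  have sv := polarize_eq0 e1 c0 (fun z => (andP (u1 z)).1) su.
  split => //; first exact: PS.
  by rewrite polarization_support //; exact: Lpos.
have main n u : Inv u -> Lint (fun z => u z * enorm z ^+ 2) <= gamma *+ n ->
  exists u, [/\ P u, forall x y, `|u x - u y| <= L * enorm (x - y),
     forall x, 0 <= u x <= 1 & forall x, rho <= enorm x -> u x < 2^-1].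
  elim: n u => [|n IH] u Iu Jn;
    (have [good|/existsNP[x /not_implyP[xr /negP]]] :=
       pselect (forall x, rho <= enorm x -> u x < 2^-1);
       [by exists u; case: Iu|]); rewrite -leNgt => ux;
    have [v Iv dec] := stepInv u x Iu xr ux.
    have : 0 <= Lint (fun z => v z * enorm z ^+ 2).
      apply: Lint_ge0 => z; rewrite mulr_ge0 ?sqr_ge0 //.
      by case: Iv => _ _ /(_ z)/andP[].
    move: Jn dec; rewrite mulr0n; lra.
  apply: (IH v Iv); move: Jn dec; rewrite mulrS; lra.
have [n nP] : exists n : nat, Lint (fun z => u0 z * enorm z ^+ 2) <= gamma *+ n.
  exists (Num.truncn (Lint (fun z => u0 z * enorm z ^+ 2) / gamma)).+1.
  by rewrite -mulr_natl -ler_pdivrMr // ltW // truncnS_gt.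
exact: (main n u0).
Qed.

End polarization_chain.

(** * Functions with Lipschitz second derivatives *)

Section taylor_class_1d.
Context {R : realType}.
Implicit Types (f : R -> R) (a b C T : R).

(* [f1] and [f2] play the roles of the first two derivatives of [f], the latter
   being Lipschitz, on the interval [-T, T]. *)
Definition T3 T C f f1 f2 := forall a b, `|a| <= T -> `|b| <= T ->
  [/\ `|f a| <= C /\ `|f b - f a - f1 a * (b - a) - 2^-1 * (f2 a * (b - a) ^+ 2)| <= C * `|b - a| ^+ 3,
      `|f1 a| <= C /\ `|f1 b - f1 a - f2 a * (b - a)| <= C * `|b - a| ^+ 2 &
      `|f2 a| <= C /\ `|f2 b - f2 a| <= C * `|b - a|].

(** Multiplication by [t] raises the exponent of [ppow] by one, see [ppowS], so only the cube has to
    be treated by hand. *)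
Lemma T3_mulX T C f f1 f2 : 0 <= T -> T3 T C f f1 f2 ->
  T3 T ((5 * T + 5) * C) (fun t => t * f t) (fun t => f t + t * f1 t)
    (fun t => 2 * f1 t + t * f2 t).
Proof.
move=> T0 h a b aT bT; have [[u0 u] [v0 v] [w0 w]] := h a b aT bT.
have C0 : 0 <= C by apply: le_trans u0.
have mT t x K : `|t| <= T -> `|x| <= K -> `|t * x| <= T * K.
  by move=> tT xK; rewrite normrM ler_pM.
have D1 : 0 <= `|b - a| by [].
have DT : `|b - a| <= 2 * T by have := ler_normB b a; lra.
have CT : 0 <= T * C by rewrite mulr_ge0.
have P1 : 0 <= C * `|b - a| by rewrite mulr_ge0.
have P1T : 0 <= T * (C * `|b - a|) by rewrite mulr_ge0.
have P2 : 0 <= C * `|b - a| ^+ 2 by rewrite mulr_ge0 ?exprn_ge0.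
have P2T : 0 <= T * (C * `|b - a| ^+ 2) by rewrite mulr_ge0.
have P3 : 0 <= C * `|b - a| ^+ 3 by rewrite mulr_ge0 ?exprn_ge0.
have P3T : 0 <= T * (C * `|b - a| ^+ 3) by rewrite mulr_ge0.
have Q3 : C * `|b - a| ^+ 3 <= C * `|b - a| ^+ 2 * (2 * T) by have := ler_wpM2l P2 DT; clear -T0; lra.
have Q2 : C * `|b - a| ^+ 2 <= C * `|b - a| * (2 * T) by have := ler_wpM2l P1 DT; clear -T0; lra.
have F k : `|f2 a * (b - a) ^+ k| <= C * `|b - a| ^+ k.
  by rewrite normrM normrX ler_wpM2r ?exprn_ge0.
have F1 := F 1; rewrite !expr1 in F1; have F2 := F 2; have F3 := F 3.
split; split.
- by have := mT a _ _ aT u0; clear -T0 C0 CT; lra.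
- have -> : b * f b - a * f a - (f a + a * f1 a) * (b - a) -
     2^-1 * ((2 * f1 a + a * f2 a) * (b - a) ^+ 2) =
     b * (f b - f a - f1 a * (b - a) - 2^-1 * (f2 a * (b - a) ^+ 2)) +
     2^-1 * (f2 a * (b - a) ^+ 3) by field.
  have h1 := mT b _ _ bT u.
  by move: h1 F3; rewrite !ler_norml; clear -P3 P3T; lra.
- by have := mT a _ _ aT v0; move: u0; rewrite !ler_norml; clear -C0 CT; lra.
- have -> : f b + b * f1 b - (f a + a * f1 a) - (2 * f1 a + a * f2 a) * (b - a) =
     (f b - f a - f1 a * (b - a) - 2^-1 * (f2 a * (b - a) ^+ 2)) +
     b * (f1 b - f1 a - f2 a * (b - a)) + 3 / 2 * (f2 a * (b - a) ^+ 2).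
    by field.
  have h1 := mT b _ _ bT v.
  by move: h1 u F2; rewrite !ler_norml; clear -Q3 P2 P2T P3 P3T; lra.
- by have := mT a _ _ aT w0; move: v0; rewrite !ler_norml; clear -C0 CT; lra.
- have -> : 2 * f1 b + b * f2 b - (2 * f1 a + a * f2 a) =
     2 * (f1 b - f1 a - f2 a * (b - a)) + b * (f2 b - f2 a) + 3 * (f2 a * (b - a)).
    by ring.
  have h1 := mT b _ _ bT w.
  by move: h1 v F1; rewrite !ler_norml; clear -Q2 P1 P1T P2 P2T; lra.
Qed.

Definition ppow n (t : R) := Num.max 0 t ^+ n.

(** The cube is the first power of the positive part with a Lipschitz second derivative. When [a]
    and [b] lie on opposite sides of 0, powers of [b] are bounded by those of [b - a]. *)
Lemma T3_ppow3 T : 0 <= T ->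
  T3 T (6 * (T + 1) ^+ 3) (ppow 3) (fun t => 3 * ppow 2 t) (fun t => 6 * ppow 1 t).
Proof.
move=> T0 a b aT bT; rewrite /ppow !expr1.
have D0 : 0 <= `|b - a| by [].
have K1 : 1 <= (T + 1) ^+ 3 by rewrite exprn_ege1 // lerDr.
have K2 : T <= (T + 1) ^+ 3 by rewrite (@le_trans _ _ (T + 1)) ?lerDl // ler_eXnr // lerDr.
have K3 : T ^+ 2 <= (T + 1) ^+ 3.
  rewrite (@le_trans _ _ ((T + 1) ^+ 2)) ?ler_weXn2l ?lerDr //.
  by rewrite ler_pXn2r ?nnegrE ?lerDl // addr_ge0.
have K4 : T ^+ 3 <= (T + 1) ^+ 3.
  by rewrite ler_pXn2r ?nnegrE ?lerDl // addr_ge0.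
have P k : 0 <= `|b - a| ^+ k by rewrite exprn_ge0.
have low k x : `|x| <= 6 * `|b - a| ^+ k -> `|x| <= 6 * (T + 1) ^+ 3 * `|b - a| ^+ k.
  move=> /le_trans; apply; rewrite -mulrA ler_wpM2l //.
  by rewrite ler_peMl.
have maxT t : `|t| <= T -> 0 <= Num.max 0 t <= T.
  by rewrite ler_norml => /andP[_ tT]; rewrite le_max lexx ge_max T0.
have n3 (x : R) : `|3 * x| = 3 * `|x| by rewrite normrM ger0_norm.
have /andP[m0 mT] := maxT a aT.
split; split.
- rewrite ger0_norm ?exprn_ge0 //; apply: le_trans (_ : T ^+ 3 <= _); last by lra.
  by rewrite ler_pXn2r ?nnegrE.
- apply: low; rewrite -normrX.
  have [a0|a0] := leP 0 a; have [b0|b0] := leP 0 b.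
  + have -> : b ^+ 3 - a ^+ 3 - 3 * a ^+ 2 * (b - a) - 2^-1 * (6 * a * (b - a) ^+ 2) = (b - a) ^+ 3 by field.
    by rewrite ler_peMl // ler1n.
  + rewrite expr0n /= sub0r.
    have -> : - a ^+ 3 - 3 * a ^+ 2 * (b - a) - 2^-1 * (6 * a * (b - a) ^+ 2) = (b - a) ^+ 3 - b ^+ 3 by field.
    have : `|b ^+ 3| <= `|(b - a) ^+ 3|.
      rewrite !normrX ler_pXn2r ?nnegrE //.
      by rewrite (ltr0_norm b0) (ltr0_norm (x := b - a)); lra.
    by have := ler_normB ((b - a) ^+ 3) (b ^+ 3); have := normr_ge0 ((b - a) ^+ 3); lra.
  + rewrite !expr0n /= !mulr0 !mul0r !mulr0 !subr0.
    have : `|b ^+ 3| <= `|(b - a) ^+ 3|.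
      by rewrite !normrX ler_pXn2r ?nnegrE // !ger0_norm; lra.
    have := normr_ge0 ((b - a) ^+ 3); lra.
  + by rewrite !expr0n /= !mulr0 !mul0r !mulr0 !subr0 normr0 mulr_ge0.
- rewrite ger0_norm ?mulr_ge0 ?exprn_ge0 //.
  have : Num.max 0 a ^+ 2 <= T ^+ 2 by rewrite ler_pXn2r ?nnegrE.
  lra.
- apply: low; rewrite -normrX.
  have [a0|a0] := leP 0 a; have [b0|b0] := leP 0 b.
  + have -> : 3 * b ^+ 2 - 3 * a ^+ 2 - 6 * a * (b - a) = 3 * (b - a) ^+ 2 by ring.
    by have := normr_ge0 ((b - a) ^+ 2); rewrite n3; lra.
  + rewrite expr0n /= mulr0 sub0r.
    have -> : - (3 * a ^+ 2) - 6 * a * (b - a) = 3 * (b - a) ^+ 2 - 3 * b ^+ 2 by ring.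
    have : `|b ^+ 2| <= `|(b - a) ^+ 2|.
      rewrite !normrX ler_pXn2r ?nnegrE //.
      by rewrite (ltr0_norm b0) (ltr0_norm (x := b - a)); lra.
    have := ler_normB (3 * (b - a) ^+ 2) (3 * b ^+ 2); rewrite !n3; lra.
  + rewrite !expr0n /= !mulr0 !mul0r !subr0.
    have : `|b ^+ 2| <= `|(b - a) ^+ 2|.
      by rewrite !normrX ler_pXn2r ?nnegrE // !ger0_norm; lra.
    by have := normr_ge0 ((b - a) ^+ 2); rewrite n3; lra.
  + by rewrite !expr0n /= !mulr0 !mul0r !subr0 normr0 mulr_ge0.
- by rewrite ger0_norm ?mulr_ge0 //; lra.
- rewrite -[`|b - a|]expr1; apply: low; rewrite expr1 -mulrBr normrM (ger0_norm (x := 6)) // ler_wpM2l //.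
  have [a0|a0] := leP 0 a; have [b0|b0] := leP 0 b; rewrite ?subr0 ?sub0r ?normr0 //.
    by rewrite normrN ger0_norm // ler0_norm; lra.
  by rewrite !ger0_norm; lra.
Qed.

Lemma ppowS n t : ppow n.+2 t = t * ppow n.+1 t.
Proof.
by rewrite /ppow exprS; have [t0|t0] := leP 0 t; rewrite // expr0n /= !mulr0.
Qed.

Lemma T3_ppow n T : 0 <= T -> exists2 C, 0 <= C &
  T3 T C (ppow n.+3) (fun t => n.+3%:R * ppow n.+2 t)
    (fun t => (n.+3 * n.+2)%:R * ppow n.+1 t).
Proof.
move=> T0; elim: n => [|n [C C0 IH]].
  by exists (6 * (T + 1) ^+ 3); [rewrite mulr_ge0 ?exprn_ge0 ?addr_ge0|exact: T3_ppow3].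
exists ((5 * T + 5) * C); first by rewrite mulr_ge0 // addr_ge0 // mulr_ge0.
have := T3_mulX T0 IH; congr T3; apply/funext => t; rewrite ?natrM !ppowS -?natr1; ring.
Qed.

End taylor_class_1d.

Section taylor_class.
Context {R : realType} {d : nat}.
Local Notation V := 'rV[R]_d.
Implicit Types (u v w : V -> R) (p q : 'I_d -> V -> R) (H G : 'I_d -> 'I_d -> V -> R).
Implicit Types (x y z : V) (C : R).

Definition lin (p : 'I_d -> V -> R) x y : R := \sum_i p i x * y ord0 i.

Definition quad (H : 'I_d -> 'I_d -> V -> R) x y : R :=
  \sum_i \sum_k H i k x * (y ord0 i * y ord0 k).

(* [w] has gradient [p] and Hessian [H], the latter being Lipschitz, with
   bounds and remainder estimates that only involve [C]. *)
Definition C3 C w p H :=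
  [/\ forall x, `|w x| <= C,
      forall x y, enorm y <= 1 ->
        `|w (x + y) - w x - lin p x y - 2^-1 * quad H x y| <= C * enorm y ^+ 3,
      forall i x, `|p i x| <= C /\ forall y, enorm y <= 1 ->
        `|p i (x + y) - p i x - lin (H i) x y| <= C * enorm y ^+ 2 &
      forall i k x, `|H i k x| <= C /\ forall y, enorm y <= 1 ->
        `|H i k (x + y) - H i k x| <= C * enorm y].

Lemma C3_le C C' w p H : C <= C' -> C3 C w p H -> C3 C' w p H.
Proof.
move=> CC [h0 h1 h2 h3]; split.
- by move=> x; exact: le_trans CC.
- move=> x y y1; apply: le_trans (h1 x y y1) _.
  by rewrite ler_wpM2r ?exprn_ge0 ?enorm_ge0.
- move=> i x; have [u0 u1] := h2 i x; split; first exact: le_trans CC.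
  move=> y y1; apply: le_trans (u1 y y1) _.
  by rewrite ler_wpM2r ?exprn_ge0 ?enorm_ge0.
- move=> i k x; have [u0 u1] := h3 i k x; split; first exact: le_trans CC.
  move=> y y1; apply: le_trans (u1 y y1) _.
  by rewrite ler_wpM2r ?enorm_ge0.
Qed.

Lemma linD p q x y : lin (fun i x => p i x + q i x) x y = lin p x y + lin q x y.
Proof. by rewrite -big_split; apply: eq_bigr => i _; rewrite mulrDl. Qed.

Lemma linZ a p x y : lin (fun i x => a * p i x) x y = a * lin p x y.
Proof. by rewrite mulr_sumr; apply: eq_bigr => i _; rewrite mulrA. Qed.

Lemma quadD H G x y : quad (fun i k x => H i k x + G i k x) x y = quad H x y + quad G x y.
Proof.
rewrite -big_split; apply: eq_bigr => i _; rewrite -big_split.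
by apply: eq_bigr => k _; rewrite mulrDl.
Qed.

Lemma quadZ a H x y : quad (fun i k x => a * H i k x) x y = a * quad H x y.
Proof.
rewrite mulr_sumr; apply: eq_bigr => i _; rewrite mulr_sumr.
by apply: eq_bigr => k _; rewrite -mulrA.
Qed.

Lemma C3_cst a : C3 `|a| (fun=> a) (fun _ _ => 0) (fun _ _ _ => 0).
Proof.
have l0 (x y : V) : lin (fun _ _ => 0) x y = 0 by rewrite /lin big1 // => i _; rewrite mul0r.
have q0 (x y : V) : quad (fun _ _ _ => 0) x y = 0.
  by rewrite /quad big1 // => i _; rewrite big1 // => k _; rewrite mul0r.
split=> //.
- by move=> x y _; rewrite l0 q0 mulr0 !subrr ?subr0 normr0 mulr_ge0 ?exprn_ge0 ?enorm_ge0.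
- move=> i x; rewrite normr0; split => // y _.
  by rewrite l0 !subrr normr0 mulr_ge0 ?exprn_ge0 ?enorm_ge0.
- by move=> i k x; rewrite normr0; split => // y _; rewrite !subrr normr0 mulr_ge0 ?enorm_ge0.
Qed.

Lemma C3_D C C' w p H v q G : C3 C w p H -> C3 C' v q G ->
  C3 (C + C') (fun x => w x + v x) (fun i x => p i x + q i x)
     (fun i k x => H i k x + G i k x).
Proof.
move=> [a0 a1 a2 a3] [b0 b1 b2 b3]; split.
- by move=> x; rewrite (le_trans (ler_normD _ _)) // lerD.
- move=> x y y1; rewrite linD quadD.
  have -> : w (x + y) + v (x + y) - (w x + v x) - (lin p x y + lin q x y) -
      2^-1 * (quad H x y + quad G x y) =
    (w (x + y) - w x - lin p x y - 2^-1 * quad H x y) +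
    (v (x + y) - v x - lin q x y - 2^-1 * quad G x y) by ring.
  by rewrite mulrDl (le_trans (ler_normD _ _)) // lerD ?a1 ?b1.
- move=> i x; have [c0 c1] := a2 i x; have [e0 e1] := b2 i x; split.
    by rewrite (le_trans (ler_normD _ _)) // lerD.
  move=> y y1; rewrite linD.
  have -> : p i (x + y) + q i (x + y) - (p i x + q i x) - (lin (H i) x y + lin (G i) x y) =
    (p i (x + y) - p i x - lin (H i) x y) + (q i (x + y) - q i x - lin (G i) x y) by ring.
  by rewrite mulrDl (le_trans (ler_normD _ _)) // lerD ?c1 ?e1.
- move=> i k x; have [c0 c1] := a3 i k x; have [e0 e1] := b3 i k x; split.
    by rewrite (le_trans (ler_normD _ _)) // lerD.
  move=> y y1; rewrite opprD addrACA.
  by rewrite mulrDl (le_trans (ler_normD _ _)) // lerD ?c1 ?e1.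
Qed.

Lemma C3_Z a C w p H : C3 C w p H ->
  C3 (`|a| * C) (fun x => a * w x) (fun i x => a * p i x) (fun i k x => a * H i k x).
Proof.
move=> [a0 a1 a2 a3]; split.
- by move=> x; rewrite normrM ler_wpM2l.
- move=> x y y1; rewrite linZ quadZ mulrCA -!mulrBr normrM -mulrA ler_wpM2l //; exact: a1.
- move=> i x; have [c0 c1] := a2 i x; split; first by rewrite normrM ler_wpM2l.
  by move=> y y1; rewrite linZ -!mulrBr normrM -mulrA ler_wpM2l ?c1.
- move=> i k x; have [c0 c1] := a3 i k x; split; first by rewrite normrM ler_wpM2l.
  by move=> y y1; rewrite -!mulrBr normrM -mulrA ler_wpM2l ?c1.
Qed.

(** Here [r] is a squared radius. The exponents in use are at least 3, for the second derivatives to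
    be Lipschitz. *)
Definition bump n (r : R) x : R := ppow n (r - enorm x ^+ 2).

Definition bump_grad n r i x : R :=
  n%:R * ppow n.-1 (r - enorm x ^+ 2) * (- 2 * x ord0 i).

Definition bump_hess n r i k x : R :=
  (n * n.-1)%:R * ppow n.-2 (r - enorm x ^+ 2) * (4 * (x ord0 i * x ord0 k))
  - 2 * (i == k)%:R * (n%:R * ppow n.-1 (r - enorm x ^+ 2)).

Lemma ppow_le0 n (t : R) : t <= 0 -> ppow n.+1 t = 0.
Proof. by move=> t0; rewrite /ppow max_l // expr0n. Qed.

Lemma lin_bump n r x y : lin (bump_grad n r) x y =
  n%:R * ppow n.-1 (r - enorm x ^+ 2) * (- 2 * edot x y).
Proof.
by rewrite /lin /edot !mulr_sumr; apply: eq_bigr => i _; rewrite /bump_grad; ring.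
Qed.

Lemma lin_hess_bump n r i x y : lin (bump_hess n r i) x y =
  (n * n.-1)%:R * ppow n.-2 (r - enorm x ^+ 2) * (4 * x ord0 i * edot x y)
  - 2 * y ord0 i * (n%:R * ppow n.-1 (r - enorm x ^+ 2)).
Proof.
rewrite /lin /bump_hess.
under eq_bigr do rewrite mulrBl.
rewrite sumrB; congr (_ - _).
  by rewrite /edot !mulr_sumr; apply: eq_bigr => k _; ring.
rewrite (bigD1 i) //= big1 => [|k ki]; last by rewrite eq_sym (negbTE ki) mulr0 !mul0r.
by rewrite eqxx mulr1; ring.
Qed.

Lemma quad_lin H x y : quad H x y = \sum_i y ord0 i * lin (H i) x y.
Proof.
apply: eq_bigr => i _; rewrite mulr_sumr; apply: eq_bigr => k _; ring.
Qed.

Lemma quad_bump n r x y : quad (bump_hess n r) x y =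
  (n * n.-1)%:R * ppow n.-2 (r - enorm x ^+ 2) * (4 * edot x y ^+ 2)
  - 2 * enorm y ^+ 2 * (n%:R * ppow n.-1 (r - enorm x ^+ 2)).
Proof.
rewrite quad_lin.
under eq_bigr do rewrite lin_hess_bump mulrBr.
rewrite sumrB (sqr_enorm y); congr (_ - _).
  set A := _%:R * _; set b := edot x y.
  have -> : A * (4 * b ^+ 2) = (A * 4 * b) * \sum_i x ord0 i * y ord0 i.
    by rewrite -/(edot x y) -/b; ring.
  by rewrite mulr_sumr; apply: eq_bigr => i _; ring.
by rewrite /edot mulr_sumr mulr_suml; apply: eq_bigr => i _; ring.
Qed.

(** The expansion of [ppow] is composed with [r - enorm x ^+ 2], a polynomial of degree two whose
    increments are exact. *)
Lemma C3_bump n (r : R) : 0 <= r ->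
  exists C, C3 C (bump n.+3 r) (bump_grad n.+3 r) (bump_hess n.+3 r).
Proof.
(* Beyond radius [X] the bump vanishes, even after a step of length 1. For [x] within that radius
   and unit steps, [T] bounds the argument of [ppow] and [K] its Lipschitz constant. *)
move=> r0; pose X := r + 2; pose T := r + (X + 1) ^+ 2; pose K := 2 * X + 1.
have X0 : 0 <= X by rewrite addr_ge0.
have K0 : 0 <= K by rewrite addr_ge0 ?mulr_ge0.
have T0 : 0 <= T by rewrite addr_ge0 ?exprn_ge0 // addr_ge0.
have [C C0 h] := T3_ppow n T0.
pose C' := C * (1 + 2 * X + 4 * X ^+ 2 + 2 + (K ^+ 3 + 2 * X + 1) +
  (2 * X * K ^+ 2 + 2 * X + 2 * (K ^+ 2 + K)) +
  (4 * X ^+ 2 * K + 4 * (2 * X + 1) + 2 * (K ^+ 2 + K))).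
exists C'.
have C'0 : 0 <= C' by rewrite mulr_ge0 // !addr_ge0 ?mulr_ge0 ?exprn_ge0 // ?addr_ge0 ?mulr_ge0.
have far x y : X < enorm x -> enorm y <= 1 -> forall m, ppow m.+1 (r - enorm (x + y) ^+ 2) = 0.
  move=> Xx y1 m; apply: ppow_le0.
  have : enorm x <= enorm (x + y) + enorm y.
    by have := enormBD (x + y) y; rewrite addrK.
  move=> hx; have : r + 1 <= enorm (x + y) by rewrite /X in Xx; lra.
  move=> hr; have : (r + 1) ^+ 2 <= enorm (x + y) ^+ 2.
    by rewrite ler_pXn2r ?nnegrE ?enorm_ge0 // addr_ge0.
  have := sqr_ge0 r; lra.
have far0 x : X < enorm x -> forall m, ppow m.+1 (r - enorm x ^+ 2) = 0.
  by move=> Xx m; have := far x 0 Xx; rewrite enorm0 addr0 => ->.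
have xK i x : `|x ord0 i| <= enorm x by exact: coord_le_enorm.
(* Away from the ball of radius [X] every term vanishes. *)
have near x y : enorm x <= X -> enorm y <= 1 ->
  let a := r - enorm x ^+ 2 in let b := r - enorm (x + y) ^+ 2 in
  [/\ `|a| <= T, `|b| <= T, b - a = - (2 * edot x y + enorm y ^+ 2),
      `|b - a| <= K * enorm y & `|edot x y| <= X * enorm y].
  move=> xX y1 a b.
  have n0 := enorm_ge0 x; have m0 := enorm_ge0 y.
  have exy : `|edot x y| <= X * enorm y.
    by rewrite (le_trans (edot_le x y)) // ler_wpM2r.
  have xX2 : enorm x ^+ 2 <= (X + 1) ^+ 2.
    by rewrite ler_pXn2r ?nnegrE ?addr_ge0 //; lra.
  have xyX2 : enorm (x + y) ^+ 2 <= (X + 1) ^+ 2.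
    rewrite ler_pXn2r ?nnegrE ?addr_ge0 ?enorm_ge0 //.
    by have := enormD x y; lra.
  have h1 := sqr_ge0 (enorm x); have h2 := sqr_ge0 (enorm (x + y)).
  have yy : enorm y ^+ 2 <= enorm y by rewrite expr2 ler_piMl.
  split => //.
  - by rewrite /a /T ler_norml; apply/andP; split; lra.
  - by rewrite /b /T ler_norml; apply/andP; split; lra.
  - by rewrite /a /b !sqr_enorm !edotE (edotC y x); ring.
  - have -> : b - a = - (2 * edot x y + enorm y ^+ 2).
      by rewrite /a /b !sqr_enorm !edotE (edotC y x); ring.
    have := sqr_ge0 (enorm y).
    by move: exy; rewrite normrN /K !ler_norml; lra.
pose f a : R := ppow n.+3 a; pose f1 (a : R) := n.+3%:R * ppow n.+2 a.
pose f2 (a : R) := (n.+3 * n.+2)%:R * ppow n.+1 a.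
have leC' t E : t <= C * E -> E <= 1 + 2 * X + 4 * X ^+ 2 + 2 + (K ^+ 3 + 2 * X + 1) +
  (2 * X * K ^+ 2 + 2 * X + 2 * (K ^+ 2 + K)) +
  (4 * X ^+ 2 * K + 4 * (2 * X + 1) + 2 * (K ^+ 2 + K)) -> t <= C'.
  by move=> tE EC; rewrite (le_trans tE) // ler_wpM2l.
have KK : [/\ 0 <= X ^+ 2, 0 <= K ^+ 2, 0 <= K ^+ 3, 0 <= X * K ^+ 2 & 0 <= X ^+ 2 * K].
  by split; rewrite ?mulr_ge0 ?exprn_ge0.
case: KK => KK1 KK2 KK3 KK4 KK5.
have val x : enorm x <= X -> let a := r - enorm x ^+ 2 in
    [/\ `|f a| <= C, `|f1 a| <= C & `|f2 a| <= C].
  move=> xX a; have [aT _ _ _ _] := near x 0 xX (ltac:(by rewrite enorm0)).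
  by have [[? _] [? _] [? _]] := h a a aT aT.
have xX i x : enorm x <= X -> `|x ord0 i| <= X by apply: le_trans.
have nmul (A B t s : R) : `|t| <= A -> `|s| <= B -> `|t * s| <= A * B.
  by move=> tA sB; rewrite normrM ler_pM.
have dlt (i k : 'I_d) : `|(i == k)%:R| <= 1 :> R by case: (i == k); rewrite ?normr1 ?normr0.
split.
- move=> x; have [xx|xx] := leP (enorm x) X; last by rewrite /bump far0 // normr0.
  have [h1 _ _] := val x xx; apply: (leC' _ 1); rewrite ?mulr1 //; lra.
- move=> x y y1; rewrite lin_bump quad_bump /=.
  have [xx|xx] := leP (enorm x) X; last first.
    by rewrite /bump !(far _ _ xx y1) !(far0 _ xx) !(mulr0, mul0r, subr0) normr0 mulr_ge0 // exprn_ge0 ?enorm_ge0.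
  have [aT bT ba baK exy] := near x y xx y1; rewrite /bump.
  move: aT bT ba baK; set a := r - enorm x ^+ 2; set b := r - enorm (x + y) ^+ 2.
  move=> aT bT ba baK; have [[_ u] _ [w _]] := h a b aT bT.
  rewrite -/(f a) -/(f b) -/(f1 a) -/(f2 a) in u w *.
  set M := enorm y in y1 baK exy ba *; set e := edot x y in exy ba *.
  have M0 : 0 <= M by exact: enorm_ge0.
  have -> : f b - f a - f1 a * (- 2 * e) - 2^-1 * (f2 a * (4 * e ^+ 2) - 2 * M ^+ 2 * f1 a) =
    (f b - f a - f1 a * (b - a) - 2^-1 * (f2 a * (b - a) ^+ 2)) +
     2^-1 * (f2 a * (4 * (e * M ^+ 2) + M ^+ 4)) by rewrite ba; field.
  have M2 : 0 <= M ^+ 2 by rewrite exprn_ge0.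
  have M3 : 0 <= M ^+ 3 by rewrite exprn_ge0.
  have M43 : M ^+ 4 <= M ^+ 3 by rewrite (exprS M 3) ler_piMl.
  have M4 : 0 <= M ^+ 4 by rewrite exprn_ge0.
  have u' : C * `|b - a| ^+ 3 <= C * (K ^+ 3 * M ^+ 3).
    by rewrite ler_wpM2l // -exprMn ler_pXn2r ?nnegrE // mulr_ge0.
  have eM : `|e * M ^+ 2| <= X * M ^+ 3.
    by rewrite (exprS M 2) mulrA; apply: (nmul _ _ _ _) => //; rewrite ger0_norm.
  have w' : `|f2 a * (4 * (e * M ^+ 2) + M ^+ 4)| <= C * (4 * (X * M ^+ 3) + M ^+ 3).
    by apply: (nmul _ _ _ _) => //; move: eM; rewrite !ler_norml; clear -d M43 M4; lra.
  have lC : C * (K ^+ 3 + 2 * X + 1) <= C' by apply: (leC' _ _ (lexx _)); clear -d X0 K0 KK1 KK2 KK3 KK4 KK5; lra.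
  have := ler_wpM2r M3 lC.
  have : 0 <= C * M ^+ 3 by rewrite mulr_ge0.
  by move: u w'; rewrite !ler_norml; clear -d u'; lra.
- move=> i x; split.
    have [xx|xx] := leP (enorm x) X; last first.
      by rewrite /bump_grad !far0 // mulr0 mul0r normr0.
    have [_ h1 _] := val x xx; rewrite /bump_grad /=.
    have := nmul _ _ _ _ h1 (xX i x xx).
    have -> : n.+3%:R * ppow n.+2 (r - enorm x ^+ 2) * (-2 * x ord0 i) =
       -2 * (f1 (r - enorm x ^+ 2) * x ord0 i) by rewrite /f1; ring.
    move=> h2; apply: (leC' _ (2 * X)); last by lra.
    by move: h2; rewrite !ler_norml; lra.
  move=> y y1; rewrite lin_hess_bump /bump_grad /=.
  have [xx|xx] := leP (enorm x) X; last first.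
    by rewrite !(far _ _ xx y1) !(far0 _ xx) !(mulr0, mul0r, subr0) normr0 mulr_ge0 // exprn_ge0 ?enorm_ge0.
  have [aT bT ba baK exy] := near x y xx y1.
  move: aT bT ba baK; set a := r - enorm x ^+ 2; set b := r - enorm (x + y) ^+ 2.
  move=> aT bT ba baK; have [_ [v0 v] [w0 w]] := h a b aT bT.
  rewrite -/(f1 a) -/(f1 b) -/(f2 a) in v0 v w0 *.
  set M := enorm y in y1 baK exy ba *; set e := edot x y in exy ba *.
  have M0 : 0 <= M by exact: enorm_ge0.
  have yM : `|y ord0 i| <= M by exact: coord_le_enorm.
  rewrite [(x + y) _ _]mxE.
  have -> : f1 b * (-2 * (x ord0 i + y ord0 i)) - f1 a * (-2 * x ord0 i) -
     (f2 a * (4 * x ord0 i * e) - 2 * y ord0 i * f1 a) =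
     -2 * (x ord0 i * (f1 b - f1 a - f2 a * (b - a))) +
     2 * (x ord0 i * (f2 a * M ^+ 2)) - 2 * (y ord0 i * (f1 b - f1 a)) by rewrite ba; ring.
  have M2 : 0 <= M ^+ 2 by rewrite exprn_ge0.
  have MM : M ^+ 2 <= M by rewrite expr2 ler_piMl.
  have v' : C * `|b - a| ^+ 2 <= C * (K ^+ 2 * M ^+ 2).
    by rewrite ler_wpM2l // -exprMn ler_pXn2r ?nnegrE // mulr_ge0.
  have v1 : `|f1 b - f1 a - f2 a * (b - a)| <= C * (K ^+ 2 * M ^+ 2) by exact: le_trans v'.
  have h1 := nmul _ _ _ _ (xX i x xx) v1.
  have h2 : `|x ord0 i * (f2 a * M ^+ 2)| <= X * (C * M ^+ 2).
    by apply: (nmul _ _ _ _) => //; [exact: xX|apply: (nmul _ _ _ _) => //; rewrite ger0_norm].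
  have h3 : `|f1 b - f1 a| <= C * (K ^+ 2 + K) * M.
    have : `|f2 a * (b - a)| <= C * (K * M) by exact: (nmul _ _ _ _).
    have : C * (K ^+ 2 * M ^+ 2) <= C * (K ^+ 2 * M) by rewrite !ler_wpM2l.
    by move: v1; rewrite !ler_norml; clear -d; lra.
  have h4 := nmul _ _ _ _ yM h3.
  have lC : C * (2 * X * K ^+ 2 + 2 * X + 2 * (K ^+ 2 + K)) <= C'.
    by apply: (leC' _ _ (lexx _)); clear -d X0 K0 KK1 KK2 KK3 KK4 KK5; lra.
  have := ler_wpM2r M2 lC.
  by move: h1 h2 h4; rewrite !ler_norml; clear -d; lra.
- move=> i k x; split.
    have [xx|xx] := leP (enorm x) X; last first.
      by rewrite /bump_hess !far0 // !(mulr0, mul0r) subr0 normr0.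
    have [_ h1 h2] := val x xx; rewrite /bump_hess /=.
    have h3 := nmul _ _ _ _ h2 (nmul _ _ _ _ (xX i x xx) (xX k x xx)).
    have h4 := nmul _ _ _ _ (dlt i k) h1.
    rewrite -/(f1 _) -/(f2 _).
    apply: (leC' _ (4 * X ^+ 2 + 2)); last by lra.
    by move: h3 h4; rewrite !ler_norml; lra.
  move=> y y1; rewrite /bump_hess /=.
  have [xx|xx] := leP (enorm x) X; last first.
    by rewrite !(far _ _ xx y1) !(far0 _ xx) !(mulr0, mul0r, subr0) normr0 mulr_ge0 // enorm_ge0.
  have [aT bT ba baK exy] := near x y xx y1.
  move: aT bT ba baK; set a := r - enorm x ^+ 2; set b := r - enorm (x + y) ^+ 2.
  move=> aT bT ba baK; have [_ [v0 v] [w0 w]] := h a b aT bT.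
  have [_ _ [w1 _]] := h b a bT aT.
  rewrite -/(f1 a) -/(f1 b) -/(f2 a) -/(f2 b) in v0 v w0 w w1 *.
  set M := enorm y in y1 baK exy ba *; set e := edot x y in exy ba *.
  have M0 : 0 <= M by exact: enorm_ge0.
  have yM l : `|y ord0 l| <= M by exact: coord_le_enorm.
  rewrite ![(x + y) _ _]mxE.
  have -> : f2 b * (4 * ((x ord0 i + y ord0 i) * (x ord0 k + y ord0 k))) - 2 * (i == k)%:R * f1 b -
    (f2 a * (4 * (x ord0 i * x ord0 k)) - 2 * (i == k)%:R * f1 a) =
    4 * ((x ord0 i * x ord0 k) * (f2 b - f2 a)) +
    4 * (f2 b * (x ord0 i * y ord0 k + y ord0 i * x ord0 k + y ord0 i * y ord0 k)) -
    2 * ((i == k)%:R * (f1 b - f1 a)) by ring.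
  have M2 : 0 <= M ^+ 2 by rewrite exprn_ge0.
  have MM : M ^+ 2 <= M by rewrite expr2 ler_piMl.
  have w' : `|f2 b - f2 a| <= C * (K * M) by rewrite (le_trans w) // ler_wpM2l.
  have h1 := nmul _ _ _ _ (nmul _ _ _ _ (xX i x xx) (xX k x xx)) w'.
  have h2 : `|f2 b * (x ord0 i * y ord0 k + y ord0 i * x ord0 k + y ord0 i * y ord0 k)| <=
    C * ((2 * X + 1) * M).
    apply: (nmul _ _ _ _) => //.
    have := nmul _ _ _ _ (xX i x xx) (yM k); have := nmul _ _ _ _ (yM i) (xX k x xx).
    have := nmul _ _ _ _ (yM i) (yM k); rewrite !ler_norml; lra.
  have h3 : `|f1 b - f1 a| <= C * (K ^+ 2 + K) * M.
    have v' : C * `|b - a| ^+ 2 <= C * (K ^+ 2 * M ^+ 2).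
      by rewrite ler_wpM2l // -exprMn ler_pXn2r ?nnegrE // mulr_ge0.
    have : `|f2 a * (b - a)| <= C * (K * M) by exact: (nmul _ _ _ _).
    have : C * (K ^+ 2 * M ^+ 2) <= C * (K ^+ 2 * M) by rewrite !ler_wpM2l.
    by move: v; rewrite !ler_norml; clear -d v'; lra.
  have h4 := nmul _ _ _ _ (dlt i k) h3.
  have lC : C * (4 * X ^+ 2 * K + 4 * (2 * X + 1) + 2 * (K ^+ 2 + K)) <= C'.
    by apply: (leC' _ _ (lexx _)); clear -d X0 K0 KK1 KK2 KK3 KK4 KK5; lra.
  have := ler_wpM2r M0 lC.
  by move: h1 h2 h4; rewrite !ler_norml; clear -d; lra.
Qed.

End taylor_class.

Section one_variable.
Context {R : realType}.

(** The mean value theorem between 0 and [t] gains one power. Repeated, it gives the Taylor bounds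
    for sine and cosine, without the factorials. *)
Lemma le_expr_derive (f g : R -> R) n : (forall x : R, is_derive x 1 f (g x)) -> f 0 = 0 ->
  (forall t, `|g t| <= `|t| ^+ n) -> forall t, `|f t| <= `|t| ^+ n.+1.
Proof.
move=> df f0 gn.
have cf : continuous f.
  move=> x; apply: differentiable_continuous; apply/derivable1_diffP.
  exact: ex_derive.
have bound a b : a <= b -> (a = 0 \/ b = 0) -> `|f b - f a| <= `|b - a| ^+ n.+1.
  move=> ab ab0; have [|c] := @MVT_segment _ f g a b ab (fun x _ => df x).
    exact: continuous_subspaceT.
  rewrite in_itv /= => /andP[ac cb] ->; rewrite normrM exprSr ler_wpM2r //.
  rewrite (le_trans (gn c)) // lerXn2r ?nnegrE //.
  by rewrite (ger0_norm (x := b - a)) ?subr_ge0 // ler_norml; lra.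
move=> t; have [t0|t0] := leP 0 t.
  by have := bound 0 t t0 (or_introl erefl); rewrite f0 !subr0.
by have := bound t 0 (ltW t0) (or_intror erefl); rewrite f0 !sub0r !normrN.
Qed.

Lemma sin_le (t : R) : `|sin t| <= `|t|.
Proof.
rewrite -[leRHS]expr1; apply: (@le_expr_derive sin cos 0) => [|x].
  exact: sin0.
by rewrite expr0 ler_norml cos_geN1 cos_le1.
Qed.

Lemma cos_sub1_le (t : R) : `|cos t - 1| <= `|t| ^+ 2.
Proof.
apply: (@le_expr_derive (fun t => cos t - 1) (fun t => - sin t)) => [x||x].
- by rewrite -[- sin x]subr0; apply: is_deriveB.
- by rewrite cos0 subrr.
- by rewrite normrN expr1 sin_le.
Qed.

Lemma sin_sub_le (t : R) : `|sin t - t| <= `|t| ^+ 3.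
Proof.
apply: (@le_expr_derive (fun t => sin t - t) (fun t => cos t - 1)) => [|x].
- by rewrite sin0 subrr.
- exact: cos_sub1_le.
Qed.

Lemma cos_taylor2 (t : R) : `|cos t - 1 + 2^-1 * t ^+ 2| <= `|t| ^+ 4.
Proof.
apply: (@le_expr_derive (fun t => cos t - 1 + 2^-1 * t ^+ 2) (fun t => - sin t + t)) => [x||x].
- by apply: is_derive_eq; rewrite /GRing.scale /=; field.
- by rewrite cos0 subrr expr0n /= mulr0 addr0.
- by rewrite addrC -normrN opprB sin_sub_le.
Qed.

Lemma is_derive_quadratic (V : normedModType R) (w : V -> R) (x v : V) (a K : R) :
  (forall t, `|t| <= 1 -> `|w (x + t *: v) - w x - t * a| <= K * t ^+ 2) ->
  is_derive x v w a.
Proof.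
move=> h.
have K0 : 0 <= K by have := h 1; rewrite normr1 expr1n mulr1 => /(_ (lexx _)) /(le_trans _); apply.
have c : (fun t : R => t^-1 *: ((w \o shift x) (t *: v) - w x)) @ 0^' --> (a : R).
  apply/cvgrPdist_le => e e0; near=> t.
  have t0 : t != 0 by near: t; exact: nbhs_dnbhs_neq.
  have t1 : `|t| <= 1 by near: t; apply: dnbhs0_le.
  have te : `|t| <= e / (K + 1) by near: t; apply: dnbhs0_le; rewrite divr_gt0 // ltr_pwDr.
  rewrite /= (addrC (t *: v) x).
  have -> : a - t^-1 *: (w (x + t *: v) - w x) = - (t^-1 * (w (x + t *: v) - w x - t * a)).
    by rewrite -[t^-1 *: _]/(t^-1 * _); field.
  rewrite normrN normrM normrV ?unitfE // ler_pdivrMl ?normr_gt0 //.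
  apply: le_trans (h t t1) _; rewrite -real_normK ?num_real // expr2 mulrC -mulrA ler_wpM2l //.
  apply: le_trans (_ : (K + 1) * `|t| <= _); first by rewrite mulrC ler_wpM2r // lerDl.
  by rewrite mulrC -ler_pdivlMr // ltr_pwDr.
by apply: DeriveDef; [apply/cvg_ex; exists a|exact/cvg_lim].
Unshelve. all: by end_near. Qed.

End one_variable.

Section taylor_class_examples.
Context {R : realType} {d : nat}.
Local Notation V := 'rV[R]_d.
Implicit Types (u v w : V -> R) (p q : 'I_d -> V -> R) (H G : 'I_d -> 'I_d -> V -> R).
Implicit Types (x y z : V) (C : R).

Lemma lin_le C p x y : (forall i, `|p i x| <= C) -> `|lin p x y| <= d%:R * C * enorm y.
Proof.
move=> pC; apply: le_trans (ler_norm_sum _ _ _) _.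
apply: le_trans (_ : \sum_(i < d) C * enorm y <= _).
  by apply: ler_sum => i _; rewrite normrM ler_pM // coord_le_enorm.
by rewrite sumr_const card_ord -[leLHS]mulr_natl mulrA.
Qed.

Lemma quad_le C H x y : (forall i k, `|H i k x| <= C) ->
  `|quad H x y| <= d%:R ^+ 2 * C * enorm y ^+ 2.
Proof.
move=> HC; rewrite quad_lin; apply: le_trans (ler_norm_sum _ _ _) _.
apply: le_trans (_ : \sum_(i < d) enorm y * (d%:R * C * enorm y) <= _).
  by apply: ler_sum => i _; rewrite normrM ler_pM ?coord_le_enorm // lin_le.
by rewrite sumr_const card_ord -[leLHS]mulr_natl; lra.
Qed.

Lemma linN p x y : lin p x (- y) = - lin p x y.
Proof. by rewrite /lin -sumrN; apply: eq_bigr => i _; rewrite mxE mulrN. Qed.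

Lemma quadN H x y : quad H x (- y) = quad H x y.
Proof.
by apply: eq_bigr => i _; apply: eq_bigr => k _; rewrite !mxE mulrNN.
Qed.

Lemma C3_ge0 C w p H : C3 C w p H -> 0 <= C.
Proof. by move=> [h _ _ _]; exact: le_trans (h 0). Qed.

Lemma C3_quad C w p H x y : C3 C w p H -> enorm y <= 1 ->
  `|w (x + y) - w x - lin p x y| <= C * (1 + d%:R ^+ 2) * enorm y ^+ 2.
Proof.
move=> wC y1; have C0 := C3_ge0 wC; have [_ h1 _ h3] := wC.
have := h1 x y y1; have := @quad_le C H x y (fun i k => (h3 i k x).1).
have : C * enorm y ^+ 3 <= C * enorm y ^+ 2.
  by rewrite ler_wpM2l // (exprS _ 2) ler_piMl ?exprn_ge0 ?enorm_ge0.
have : 0 <= d%:R ^+ 2 * C * enorm y ^+ 2.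
  by rewrite mulr_ge0 ?exprn_ge0 ?enorm_ge0 // mulr_ge0 // exprn_ge0.
rewrite !ler_norml; lra.
Qed.

Lemma BL_local u (C L : R) : (forall x, `|u x| <= C) -> 0 <= L ->
  (forall x y, enorm y <= 1 -> `|u (x + y) - u x| <= L * enorm y) -> BL u.
Proof.
move=> uC L0 uL; have C0 : 0 <= C := le_trans (normr_ge0 _) (uC 0).
exists (2 * C + L) => x y; split; first by rewrite (le_trans (uC x)) //; lra.
have n0 := enorm_ge0 (x - y); rewrite mulrDl.
have CE : 0 <= C * enorm (x - y) by rewrite mulr_ge0.
have LE : 0 <= L * enorm (x - y) by rewrite mulr_ge0.
have [h|h] := leP (enorm (x - y)) 1.
  have e : y + (x - y) = x by rewrite addrC subrK.
  by have := uL y (x - y) h; rewrite e; lra.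
have : 2 * C <= 2 * C * enorm (x - y) by rewrite ler_peMr ?mulr_ge0 // ltW.
have := uC x; have := uC y; rewrite !ler_norml; lra.
Qed.

Lemma C3_BL C w p H : C3 C w p H ->
  [/\ BL w, forall i, BL (p i) & forall i k, BL (H i k)].
Proof.
move=> wC; have C0 := C3_ge0 wC; have [h0 h1 h2 h3] := wC.
have sq y : enorm y <= 1 -> enorm y ^+ 2 <= enorm y.
  by move=> y1; rewrite expr2 ler_piMl ?enorm_ge0.
have D0 : 0 <= C * (1 + d%:R ^+ 2) by rewrite mulr_ge0 // addr_ge0 ?exprn_ge0.
have dC : 0 <= d%:R * C by rewrite mulr_ge0.
split=> [|i|i k].
- apply: (@BL_local _ C (C * (1 + d%:R ^+ 2) + d%:R * C)); rewrite ?addr_ge0 //.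
  move=> x y y1; have := C3_quad x wC y1.
  have := @lin_le C p x y (fun i => (h2 i x).1).
  have := ler_wpM2l D0 (sq y y1); rewrite !ler_norml; lra.
- apply: (@BL_local _ C (C + d%:R * C)); rewrite ?addr_ge0 //.
    by move=> x; exact: (h2 i x).1.
  move=> x y y1; have := (h2 i x).2 y y1.
  have := @lin_le C (H i) x y (fun k => (h3 i k x).1).
  have := ler_wpM2l C0 (sq y y1); rewrite !ler_norml; lra.
- apply: (@BL_local _ C C) => //; first by move=> x; exact: (h3 i k x).1.
  by move=> x y y1; exact: (h3 i k x).2.
Qed.

Lemma C3_is_derive C w p H (i : 'I_d) x : C3 C w p H ->
  is_derive x (delta_mx ord0 i : V) w (p i x).
Proof.
move=> wC; apply: (is_derive_quadratic (K := C * (1 + d%:R ^+ 2))) => t t1.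
have nt : enorm (t *: (delta_mx ord0 i : V)) = `|t| by rewrite enormZ enorm_delta mulr1.
have := C3_quad x wC (y := t *: delta_mx ord0 i); rewrite nt real_normK ?num_real // => /(_ t1).
have -> // : lin p x (t *: delta_mx ord0 i) = t * p i x.
rewrite /lin (bigD1 i) //= big1 => [|k ki]; last by rewrite !mxE (negbTE ki) !mulr0.
by rewrite !mxE !eqxx mulr1 addr0 mulrC.
Qed.

Lemma C3_is_derive2 C w p H i k x : C3 C w p H ->
  is_derive x (delta_mx ord0 k : V) (p i) (H i k x).
Proof.
move=> [_ _ h2 _]; apply: (is_derive_quadratic (K := C)) => t t1.
have nt : enorm (t *: (delta_mx ord0 k : V)) = `|t| by rewrite enormZ enorm_delta mulr1.
have := (h2 i x).2 (t *: delta_mx ord0 k); rewrite nt real_normK ?num_real // => /(_ t1).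
have -> // : lin (H i) x (t *: delta_mx ord0 k) = t * H i k x.
rewrite /lin (bigD1 k) //= big1 => [|l lk]; last by rewrite !mxE (negbTE lk) !mulr0.
by rewrite !mxE !eqxx mulr1 addr0 mulrC.
Qed.

Lemma C3_partial C w p H i : C3 C w p H -> partial i w = p i.
Proof. by move=> wC; apply/funext => x; have [_ E] := C3_is_derive i x wC; exact: E. Qed.

Lemma C3_partial2 C w p H i k : C3 C w p H -> partial k (partial i w) = H i k.
Proof.
move=> wC; rewrite (C3_partial i wC); apply/funext => x.
by have [_ E] := C3_is_derive2 i k x wC; exact: E.
Qed.

Lemma C3_laplacian C w p H x : C3 C w p H -> laplacian w x = \sum_i H i i x.
Proof. by move=> wC; apply: eq_bigr => i _; rewrite (C3_partial2 _ _ wC). Qed.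

Lemma C3_grad C w p H x y : C3 C w p H -> edot y (grad w x) = lin p x y.
Proof.
by move=> wC; apply: eq_bigr => i _; rewrite mxE (C3_partial i wC) mulrC.
Qed.

Lemma C3_C2_closure C w p H (N : set V) : C3 C w p H -> C2_closure N w.
Proof.
move=> wC; have [bw bp bH] := C3_BL wC.
have ext u : BL u -> extends_continuously N u.
  by move=> bu; exists u; split => //; apply: continuous_subspaceT; exact: BL_continuous.
split=> [|i|i k]; first exact: ext.
  split; first by move=> x _; have [] := C3_is_derive i x wC.
  by rewrite (C3_partial i wC); exact: ext.
split; first by move=> x _; rewrite (C3_partial i wC); have [] := C3_is_derive2 i k x wC.
by rewrite (C3_partial2 i k wC); exact: ext.
Qed.

Lemma conv_kD (k l u : V -> R) x : Lig k -> Lig l -> BL u ->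
  conv (fun y => k y + l y) u x = conv k u x + conv l u x.
Proof.
move=> Ik Il bu; rewrite /conv -LintD; [|exact: Lig_conv|exact: Lig_conv].
by congr Lint; apply/funext => y; rewrite mulrDr.
Qed.

Lemma conv_kZ (k : V -> R) a u x : Lig k -> BL u -> conv (fun y => a * k y) u x = a * conv k u x.
Proof.
move=> Ik bu; rewrite /conv -LintZ; last exact: Lig_conv.
by congr Lint; apply/funext => y; rewrite mulrCA.
Qed.

Lemma Lig_cst0 : Lig (fun _ : V => 0 : R).
Proof. exact: integrable0. Qed.

Lemma conv_k_sum (I : Type) (r : seq I) (K : I -> V -> R) (a : I -> R) u x :
  (forall i, Lig (K i)) -> BL u ->
  Lig (fun y => \sum_(i <- r) a i * K i y) /\
  conv (fun y => \sum_(i <- r) a i * K i y) u x = \sum_(i <- r) a i * conv (K i) u x.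
Proof.
move=> IK bu; elim: r => [|i r [IH1 IH2]].
  have -> : (fun y => \sum_(i <- [::]) a i * K i y) = (fun=> 0).
    by apply/funext => y; rewrite big_nil.
  rewrite big_nil; split; first exact: Lig_cst0.
  by rewrite /conv (_ : (fun y => _) = (fun=> 0)) ?Lint0 //; apply/funext => y; rewrite mulr0.
have -> : (fun y => \sum_(l <- i :: r) a l * K l y) =
    (fun y => a i * K i y + \sum_(l <- r) a l * K l y).
  by apply/funext => y; rewrite big_cons.
have Ii := LigZ (a i) (IK i).
split; first exact: LigD.
by rewrite conv_kD // conv_kZ // IH2 big_cons.
Qed.

Lemma conv_k_shift (k : V -> R) u x y : Lig k -> BL u ->
  conv (fun t => k (t - y)) u x = conv k u (x + y).
Proof.
move=> Ik bu; rewrite !convE //; last exact: (Lig_shift (- y)).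
by congr Lint; apply/funext => z; rewrite opprD addrA.
Qed.

Lemma conv_le_supp (k : V -> R) u x (M a r : R) : Lig k -> BL u ->
  (forall x, `|u x| <= M) -> (forall t, `|k t| <= a * \1_(eball r) t) ->
  `|conv k u x| <= M * (a * Lint (\1_(eball r) : V -> R)).
Proof.
move=> Ik bu uM ka; rewrite -LintZ; last exact: Lig_eball.
rewrite -LintZ; last by apply: LigZ; exact: Lig_eball.
apply: Lint_abs; first exact: Lig_conv.
  by apply: LigZ; apply: LigZ; exact: Lig_eball.
by move=> y; rewrite normrM ler_pM.
Qed.

(** The derivatives fall on the kernel [w], so the constant involves only a bound of [u] and not its
    Lipschitz constant. Moving [x] by [y] moves the kernel by [- y], which changes the sign of the
    first derivatives; the radius [X + 1] accounts for such moves of length at most 1. *)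
Lemma C3_conv C w p H (X M : R) u : C3 C w p H ->
  (forall x, X <= enorm x -> [/\ w x = 0, forall i, p i x = 0 & forall i k, H i k x = 0]) ->
  BL u -> (forall x, `|u x| <= M) ->
  C3 (M * (C * Lint (\1_(eball (X + 1)) : V -> R)))
    (conv w u) (fun i x => - conv (p i) u x) (fun i k x => conv (H i k) u x).
Proof.
move=> wC far bu uM; have C0 := C3_ge0 wC; have [bw bp bH] := C3_BL wC.
have [h0 h1 h2 h3] := wC.
have Iw : Lig w.
  by apply: (@Lig_supp _ _ _ C X) => // [|x /far[]//]; exact: BL_measurable.
have Ip i : Lig (p i).
  apply: (@Lig_supp _ _ _ C X) => [|x|x /far[]//]; first exact: BL_measurable.
  exact: (h2 i x).1.
have IH i k : Lig (H i k).
  apply: (@Lig_supp _ _ _ C X) => [|x|x /far[_ _ ->]//]; first exact: BL_measurable.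
  exact: (h3 i k x).1.
have supp (k : V -> R) a y : enorm y <= 1 -> 0 <= a -> (forall t, `|k t| <= a) ->
    (forall t, X <= enorm t -> X <= enorm (t - y) -> k t = 0) ->
    forall t, `|k t| <= a * \1_(eball (X + 1)) t.
  move=> y1 a0 ka k0 t; rewrite indicE in_eball; case: ltP => [_|h]; first by rewrite mulr1.
  rewrite k0 ?normr0 ?mulr_ge0 //; first by lra.
  have := enormD (t - y) y; rewrite subrK; lra.
have supp0 (k : V -> R) a : 0 <= a -> (forall t, `|k t| <= a) ->
    (forall t, X <= enorm t -> k t = 0) ->
    forall t, `|k t| <= a * \1_(eball (X + 1)) t.
  by move=> a0 ka k0; apply: (supp _ _ 0) => //; rewrite ?enorm0 // => t /k0.
have lsum (q : 'I_d -> V -> R) x y : (forall i, Lig (q i)) ->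
    Lig (fun t => lin q t y) /\ conv (fun t => lin q t y) u x = \sum_i conv (q i) u x * y ord0 i.
  move=> Iq; have [I1 I2] := conv_k_sum (index_enum 'I_d) (fun i => y ord0 i) x Iq bu.
  have E : (fun t => lin q t y) = (fun t => \sum_i y ord0 i * q i t).
    by apply/funext => t; apply: eq_bigr => i _; rewrite mulrC.
  by rewrite E I2; split => //; apply: eq_bigr => i _; rewrite mulrC.
have qsum x y : Lig (fun t => quad H t y) /\
    conv (fun t => quad H t y) u x = quad (fun i k x => conv (H i k) u x) x y.
  have I1 i : Lig (fun t => lin (H i) t y) by have [] := lsum (H i) x y (IH i).
  have [J1 J2] := conv_k_sum (index_enum 'I_d) (fun i => y ord0 i) x I1 bu.
  have E : (fun t => quad H t y) = (fun t => \sum_i y ord0 i * lin (H i) t y).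
    by apply/funext => t; rewrite quad_lin.
  rewrite E J2 quad_lin; split => //; apply: eq_bigr => i _; congr (_ * _).
  by have [_ ->] := lsum (H i) x y (IH i).
split.
- by move=> x; apply: conv_le_supp => //; apply: supp0 => // t /far[].
- move=> x y y1.
  (* The Taylor remainder of the kernel for the increment [- y]; its convolution with [u] is the
     remainder of [conv w u]. *)
  pose k t := w (t - y) + (-1) * w t + lin p t y + - 2^-1 * quad H t y.
  have [L1 L2] := lsum p x y Ip; have [Q1 Q2] := qsum x y.
  have I1 : Lig (fun t => w (t - y)) by exact: (Lig_shift (- y)).
  have I2 := LigZ (-1) Iw; have I3 := LigZ (- 2^-1) Q1.
  have Ik : Lig k by do !apply: LigD => //.
  have -> : conv w u (x + y) - conv w u x - lin (fun i x => - conv (p i) u x) x y -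
      2^-1 * quad (fun i k x => conv (H i k) u x) x y = conv k u x.
    rewrite /k conv_kD //; last by do !apply: LigD => //.
    rewrite conv_kD //; last by apply: LigD.
    rewrite conv_kD // conv_k_shift // !conv_kZ // L2 Q2.
    have -> : lin (fun i x => - conv (p i) u x) x y = - \sum_i conv (p i) u x * y ord0 i.
      by rewrite /lin -sumrN; apply: eq_bigr => i _; rewrite mulNr.
    by ring.
  rewrite -mulrA mulrAC; apply: conv_le_supp => //.
  apply: (supp _ _ y) => // [|t|t t1 t2]; first by rewrite mulr_ge0 // exprn_ge0 ?enorm_ge0.
    have := h1 t (- y); rewrite enormN linN quadN => /(_ y1).
    by rewrite /k mulN1r opprK mulNr.
  have [w0 p0 H0] := far t t1; have [w1 _ _] := far _ t2.
  rewrite /k w0 w1 /lin /quad big1 => [|i _]; last by rewrite p0 mul0r.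
  rewrite big1 => [|i _]; last by rewrite big1 // => l _; rewrite H0 mul0r.
  by rewrite !mulr0 !addr0.
- move=> i x; split.
    by rewrite normrN; apply: conv_le_supp => //; apply: supp0 => // [t|t /far[]//]; exact: (h2 i t).1.
  move=> y y1; pose k t := (-1) * p i (t - y) + p i t + (-1) * lin (H i) t y.
  have [L1 L2] := lsum (H i) x y (IH i).
  have I1 : Lig (fun t => p i (t - y)) by exact: (Lig_shift (- y)).
  have I2 := LigZ (-1) I1; have I3 := LigZ (-1) L1.
  have Ik : Lig k by do !apply: LigD => //.
  have -> : - conv (p i) u (x + y) - - conv (p i) u x -
     lin ((fun i k x => conv (H i k) u x) i) x y = conv k u x.
    rewrite /k conv_kD //; last by apply: LigD.
    rewrite conv_kD // !conv_kZ // conv_k_shift // L2 /lin; ring.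
  rewrite -mulrA mulrAC; apply: conv_le_supp => //.
  apply: (supp _ _ y) => // [|t|t t1 t2]; first by rewrite mulr_ge0 // exprn_ge0 ?enorm_ge0.
    have := (h2 i t).2 (- y); rewrite enormN linN => /(_ y1).
    by rewrite -normrN /k; congr (`|_| <= _); ring.
  have [_ p0 H0] := far t t1; have [_ p1 _] := far _ t2.
  rewrite /k p0 p1 /lin big1 => [|l _]; last by rewrite H0 mul0r.
  by rewrite !mulr0 !addr0.
- move=> i l x; split.
    by apply: conv_le_supp => //; apply: supp0 => // [t|t /far[_ _ ->]//]; exact: (h3 i l t).1.
  move=> y y1; pose k t := H i l (t - y) + (-1) * H i l t.
  have I1 : Lig (fun t => H i l (t - y)) by exact: (Lig_shift (- y)).
  have I2 := LigZ (-1) (IH i l).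
  have Ik : Lig k by apply: LigD.
  have -> : conv (H i l) u (x + y) - conv (H i l) u x = conv k u x.
    by rewrite /k conv_kD // !conv_kZ // conv_k_shift // mulN1r.
  rewrite -mulrA mulrAC; apply: conv_le_supp => //.
  apply: (supp _ _ y) => // [|t|t t1 t2]; first by rewrite mulr_ge0 // enorm_ge0.
    have := (h3 i l t).2 (- y); rewrite enormN => /(_ y1).
    by rewrite /k mulN1r.
  have [_ _ H0] := far t t1; have [_ _ H1] := far _ t2.
  by rewrite /k H0 H1 mulr0 addr0.
Qed.

(** The addition formulas reduce every estimate to the Taylor bounds at 0. This cosine of one
    coordinate is the test function of [center_bound]. *)
Lemma C3_cos (i0 : 'I_d) (s : R) :
  exists C, C3 C (fun x => cos (s * x ord0 i0))
    (fun i x => (i == i0)%:R * (- s * sin (s * x ord0 i0)))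
    (fun i k x => ((i == i0) && (k == i0))%:R * (- s ^+ 2 * cos (s * x ord0 i0))).
Proof.
pose S := `|s|; pose C := 1 + S + S ^+ 2 + S ^+ 3 + S ^+ 4.
have S0 : 0 <= S := normr_ge0 s.
have [S2 S3 S4] : [/\ 0 <= S ^+ 2, 0 <= S ^+ 3 & 0 <= S ^+ 4] by split; rewrite exprn_ge0.
have linE (q : V -> R) x y : lin (fun i x => (i == i0)%:R * q x) x y = q x * y ord0 i0.
  rewrite /lin (bigD1 i0) //= big1 => [|k ki]; last by rewrite (negbTE ki) !mul0r.
  by rewrite eqxx mul1r addr0.
have lin2E (q : V -> R) i x y :
    lin (fun k x => ((i == i0) && (k == i0))%:R * q x) x y = (i == i0)%:R * (q x * y ord0 i0).
  case: (i == i0) => /=; first by rewrite linE mul1r.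
  by rewrite mul0r /lin big1 // => k _; rewrite !mul0r.
have quadE (q : V -> R) x y :
    quad (fun i k x => ((i == i0) && (k == i0))%:R * q x) x y = q x * y ord0 i0 ^+ 2.
  rewrite quad_lin (bigD1 i0) //= big1 => [|k ki]; last by rewrite lin2E (negbTE ki) mul0r mulr0.
  by rewrite lin2E eqxx mul1r; ring.
have T y : enorm y <= 1 -> let t := s * y ord0 i0 in let N := enorm y in
   [/\ `|cos t - 1 + 2^-1 * t ^+ 2| <= S ^+ 4 * N ^+ 3,
       `|sin t - t| <= S ^+ 3 * N ^+ 3, `|cos t - 1| <= S ^+ 2 * N ^+ 2 & `|sin t| <= S * N].
  move=> y1 t N.
  have tS : `|t| <= S * N by rewrite normrM ler_wpM2l // coord_le_enorm.
  have N0 : 0 <= N by exact: enorm_ge0.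
  have tS' n : `|t| ^+ n <= S ^+ n * N ^+ n.
    by rewrite -exprMn lerXn2r ?nnegrE ?mulr_ge0.
  split; last exact: le_trans (sin_le _) _.
  - apply: le_trans (cos_taylor2 _) _; apply: le_trans (tS' _) _.
    by rewrite ler_wpM2l // (exprS _ 3) ler_piMl ?exprn_ge0.
  - by apply: le_trans (sin_sub_le _) _.
  - by apply: le_trans (cos_sub1_le _) _.
have cs (a b c e f : R) : `|b| <= c -> `|e| <= f -> `|cos a * b| <= c /\ `|sin a * e| <= f.
  move=> bc ef; rewrite !normrM; split.
    by rewrite -[leRHS]mul1r ler_pM // ler_norml cos_geN1 cos_le1.
  by rewrite -[leRHS]mul1r ler_pM // ler_norml sin_geN1 sin_le1.
have delta (b : bool) (t c : R) : 0 <= c -> `|t| <= c -> `|b%:R * t| <= c.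
  by move=> c0 tc; case: b; rewrite ?mul1r // mul0r normr0.
have c1 a : `|cos a : R| <= 1 by rewrite ler_norml cos_geN1 cos_le1.
have s1 a : `|sin a : R| <= 1 by rewrite ler_norml sin_geN1 sin_le1.
have C0 : 0 <= C by rewrite /C !addr_ge0.
exists C; split.
- by move=> x; rewrite (le_trans (c1 _)) // /C; lra.
- move=> x y y1; rewrite linE quadE mxE mulrDr cosD.
  have [h1 h2 h3 h4] := T y y1; move: h1 h2 h3 h4.
  set t := s * y ord0 i0; set a := s * x ord0 i0; set N := enorm y => h1 h2 h3 h4.
  have N3 : 0 <= N ^+ 3 by rewrite exprn_ge0 // enorm_ge0.
  have -> : cos a * cos t - sin a * sin t - cos a - - s * sin a * y ord0 i0 -
    2^-1 * (- s ^+ 2 * cos a * y ord0 i0 ^+ 2) =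
    cos a * (cos t - 1 + 2^-1 * t ^+ 2) - sin a * (sin t - t) by rewrite /t; field.
  have [e1 e2] := cs a _ _ _ _ h1 h2.
  have : (S ^+ 3 + S ^+ 4) * N ^+ 3 <= C * N ^+ 3 by rewrite ler_wpM2r // /C; lra.
  by move: e1 e2; rewrite !ler_norml; lra.
- move=> i x; split.
    apply: (delta _ _ _ C0); rewrite normrM normrN.
    apply: le_trans (_ : S * 1 <= _); first by rewrite ler_wpM2l.
    by rewrite /C; lra.
  move=> y y1; have E (b t1 t2 t3 : R) : b * t1 - b * t2 - b * t3 = b * (t1 - t2 - t3) by ring.
  rewrite lin2E E mxE (mulrDr s) sinD.
  have [h1 h2 h3 h4] := T y y1; move: h1 h2 h3 h4.
  set t := s * y ord0 i0; set a := s * x ord0 i0; set N := enorm y => h1 h2 h3 h4.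
  have N2 : 0 <= N ^+ 2 by rewrite exprn_ge0 // enorm_ge0.
  apply: (delta _ _ _ (mulr_ge0 C0 N2)).
  have -> : - s * (sin a * cos t + cos a * sin t) - - s * sin a - - s ^+ 2 * cos a * y ord0 i0 =
    - s * (cos a * (sin t - t) + sin a * (cos t - 1)) by rewrite /t; ring.
  have [e1 e2] := cs a _ _ _ _ h2 h3.
  have N32 : S ^+ 3 * N ^+ 3 <= S ^+ 3 * N ^+ 2.
    by rewrite ler_wpM2l // (exprS _ 2) ler_piMl.
  rewrite normrM normrN -/S.
  apply: le_trans (_ : S * ((S ^+ 2 + S ^+ 3) * N ^+ 2) <= _).
    rewrite ler_wpM2l //; move: e1 e2; rewrite !ler_norml; lra.
  have : (S ^+ 3 + S ^+ 4) * N ^+ 2 <= C * N ^+ 2 by rewrite ler_wpM2r // /C; lra.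
  lra.
- move=> i k x; split.
    apply: (delta _ _ _ C0); rewrite normrM normrN normrX.
    apply: le_trans (_ : S ^+ 2 * 1 <= _); first by rewrite ler_wpM2l.
    by rewrite /C; lra.
  move=> y y1; rewrite -[X in `|X|]mulrBr -mulrBr mxE (mulrDr s) cosD.
  have [h1 h2 h3 h4] := T y y1; move: h1 h2 h3 h4.
  set t := s * y ord0 i0; set a := s * x ord0 i0; set N := enorm y => h1 h2 h3 h4.
  have N0 : 0 <= N by exact: enorm_ge0.
  apply: (delta _ _ _ (mulr_ge0 C0 N0)).
  have -> : cos a * cos t - sin a * sin t - cos a =
    cos a * (cos t - 1) - sin a * sin t by ring.
  have [e1 e2] := cs a _ _ _ _ h3 h4.
  have N21 : S ^+ 2 * N ^+ 2 <= S ^+ 2 * N.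
    by rewrite ler_wpM2l // expr2 ler_piMl.
  rewrite normrM normrN normrX -/S.
  apply: le_trans (_ : S ^+ 2 * ((S + S ^+ 2) * N) <= _).
    rewrite ler_wpM2l //; move: e1 e2; rewrite !ler_norml; lra.
  have : (S ^+ 3 + S ^+ 4) * N <= C * N by rewrite ler_wpM2r // /C; lra.
  lra.
Qed.

End taylor_class_examples.

(** * The Levy operator and its approximation *)

Section levy.
Context {R : realType} {d : nat}.
Local Notation V := 'rV[R]_d.
Variable j : V -> R.
Hypotheses (j_levy : levy_density j) (j_radial : radially_decreasing j).
Implicit Types (u v w : V -> R) (p q : 'I_d -> V -> R) (H G : 'I_d -> 'I_d -> V -> R).
Implicit Types (x y z : V) (C : R).

(** The value at the origin is set to 0, since [levy_density] says nothing about [j] there. *)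
Definition j0 y : R := if y == 0 then 0 else j y.

Lemma j0_ge0 y : 0 <= j0 y.
Proof. by rewrite /j0; case: eqP => // /eqP y0; case: j_levy => _ /(_ y y0). Qed.

Lemma j0_le y z : y != 0 -> enorm y <= enorm z -> j0 z <= j0 y.
Proof.
move=> y0 yz; have [g [gj gd]] := j_radial.
have z0 : z != 0 by rewrite -enorm_gt0 (lt_le_trans _ yz) // enorm_gt0.
by rewrite /j0 (negbTE y0) (negbTE z0) !gj // gd // enorm_gt0.
Qed.

Lemma j0_sym y z : enorm y = enorm z -> j0 y = j0 z.
Proof.
move=> yz; have [y0|y0] := eqVneq y 0.
  have /eqP : enorm z = 0 by rewrite -yz y0 enorm0.
  by rewrite enorm_eq0 y0 => /eqP ->.
have z0 : z != 0 by rewrite -enorm_gt0 -yz enorm_gt0.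
by apply/eqP; rewrite eq_le !j0_le ?yz.
Qed.

Lemma measurable_j0 : measurable_fun setT j0.
Proof.
have [mj _ _] := j_levy.
have -> : j0 = j \_ [set y : V | y != 0].
  apply/funext => y; rewrite /j0 patchE; case: eqP => [->|/eqP y0].
    by rewrite memNset //= eqxx.
  by rewrite mem_set.
apply/measurable_restrict => //; last by rewrite setTI.
have -> : [set y : V | y != 0] = @enorm R d @^-1` `]0, +oo[.
  by apply/seteqP; split => y /=; rewrite in_itv /= andbT enorm_gt0.
by rewrite -[X in measurable X]setTI; apply: measurable_enorm.
Qed.

Definition cut y : R := Num.min 1 (enorm y ^+ 2).

Lemma cut_ge0 y : 0 <= cut y.
Proof. by rewrite le_min ler01 exprn_ge0 ?enorm_ge0. Qed.

Lemma cut_in y : enorm y <= 1 -> cut y = enorm y ^+ 2.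
Proof. by move=> y1; rewrite /cut min_r // exprn_ile1 // enorm_ge0. Qed.

Lemma cut_out y : 1 <= enorm y -> cut y = 1.
Proof. by move=> y1; rewrite /cut min_l // exprn_ege1. Qed.

Lemma measurable_cut : measurable_fun setT cut.
Proof.
by apply: measurable_minr => //; apply: measurable_funX; exact: measurable_enorm.
Qed.

Lemma Lig_cut_j0 : Lig (fun y => cut y * j0 y).
Proof.
have [_ _ jfin] := j_levy.
have E y : cut y * j0 y = cut y * j y.
  rewrite /j0; case: eqP => // ->; rewrite cut_in ?enorm0 //.
  by rewrite expr0n /= !mul0r.
apply/integrableP; split.
  apply/measurable_EFinP; apply: measurable_funM; first exact: measurable_cut.
  exact: measurable_j0.
under eq_integral do rewrite /= ger0_norm ?mulr_ge0 ?cut_ge0 ?j0_ge0 // E.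
exact: jfin.
Qed.

(* [Lop] is the operator computed from prescribed derivatives [p] and [H]. *)
Definition incr w p x y : R :=
  w (x + y) - w x - (enorm y <= 1)%R%:R * lin p x y.

Definition Lop w p H x : R :=
  \sum_i H i i x + Lint (fun y => incr w p x y * j0 y).

Lemma incr_le C w p H x y : C3 C w p H ->
  `|incr w p x y| <= C * (3 + d%:R ^+ 2) * cut y.
Proof.
move=> wC; have C0 := C3_ge0 wC; rewrite /incr.
have D0 : 0 <= C * d%:R ^+ 2 by rewrite mulr_ge0 // exprn_ge0.
have [y1|y1] := leP (enorm y) 1.
  rewrite mul1r cut_in //.
  apply: le_trans (C3_quad x wC y1) _; rewrite ler_wpM2r ?exprn_ge0 ?enorm_ge0 //; lra.
rewrite mul0r subr0 (cut_out (ltW y1)) mulr1.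
have [h _ _ _] := wC; have := ler_normB (w (x + y)) (w x).
have := h (x + y); have := h x; lra.
Qed.

Lemma measurable_unit_ball : measurable_fun setT (fun y : V => (enorm y <= 1)%R%:R : R).
Proof.
have -> : (fun y : V => (enorm y <= 1)%R%:R : R) = \1_(@enorm R d @^-1` `]-oo, 1]).
  apply/funext => y; rewrite indicE; have [y1|y1] := leP (enorm y) 1.
    by rewrite mem_set //= in_itv.
  by rewrite memNset //= in_itv /= leNgt y1.
by apply: measurable_indic; rewrite -[X in measurable X]setTI; apply: measurable_enorm.
Qed.

Lemma measurable_incr w p x : measurable_fun setT w ->
  measurable_fun setT (incr w p x).
Proof.
move=> mw; apply: measurable_funB; last first.
  apply: measurable_funM.
    exact: measurable_unit_ball.
  apply: measurable_sum => i.
  by apply: measurable_funM => //; exact: measurable_coord.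
apply: measurable_funB => //.
have := measurableT_comp mw (measurable_shift x).
by apply: eq_measurable_fun => y _ /=; rewrite addrC.
Qed.

Lemma Lig_incr C w p H x : C3 C w p H -> Lig (fun y => incr w p x y * j0 y).
Proof.
move=> wC; have [bw _ _] := C3_BL wC.
apply: (@Lig_dom _ _ _ (fun y => C * (3 + d%:R ^+ 2) * (cut y * j0 y))).
- apply: measurable_funM; last exact: measurable_j0.
  by apply: measurable_incr; exact: BL_measurable.
- move=> y; rewrite normrM mulrA (ger0_norm (j0_ge0 y)) ler_wpM2r ?j0_ge0 //.
  exact: incr_le wC.
- by apply: LigZ; exact: Lig_cut_j0.
Qed.

Lemma levy_opE C w p H x : C3 C w p H -> levy_op j w x = (Lop w p H x)%:E.
Proof.
move=> wC; rewrite /levy_op /Lop (C3_laplacian x wC) EFinD; congr (_ + _)%E.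
rewrite -(EFin_Lint (Lig_incr x wC)); apply: eq_integral => y _; congr EFin.
rewrite (C3_grad x y wC) -/(incr w p x y) /j0; case: eqP => // ->.
rewrite /incr addr0 subrr sub0r /lin big1 ?mulr0 ?oppr0 ?mul0r // => i _.
by rewrite mxE mulr0.
Qed.

End levy.

(** * Truncation of the density and moments of balls *)

Section approximation.
Context {R : realType} {d : nat}.
Local Notation V := 'rV[R]_d.
Variable j : V -> R.
Hypotheses (j_levy : levy_density j) (j_radial : radially_decreasing j).
Implicit Types (u v w : V -> R) (p q : 'I_d -> V -> R) (H G : 'I_d -> 'I_d -> V -> R).
Implicit Types (x y z : V) (C : R).
Local Notation J := (j0 j).
Local Notation Lop := (Lop j).

(** At the origin, where [j0] is 0, the cap itself is taken, so that the kernel is radially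
    nonincreasing there too. *)
Definition jcap (n : nat) y : R := if y == 0 then n%:R else Num.min (J y) n%:R.

Lemma jcap_ge0 n y : 0 <= jcap n y.
Proof. by rewrite /jcap; case: eqP => // _; rewrite le_min ler0n (j0_ge0 j_levy). Qed.

Lemma jcap_le n y : jcap n y <= n%:R.
Proof. by rewrite /jcap; case: eqP => // _; rewrite ge_min lexx orbT. Qed.

Lemma measurable_jcap n : measurable_fun setT (jcap n).
Proof.
have m1 : measurable_fun setT (fun y => Num.min (J y) n%:R).
  by apply: measurable_minr => //; exact: measurable_j0.
have -> : jcap n = fun y => Num.min (J y) n%:R + n%:R * \1_[set 0] y.
  apply/funext => y; rewrite /jcap indicE; case: eqP => [->|/eqP y0].
    by rewrite mem_set // mulr1 /j0 eqxx min_l // add0r.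
  by rewrite memNset ?mulr0 ?addr0 //= => h; rewrite h eqxx in y0.
apply: measurable_funD => //; apply: measurable_funM => //; apply: measurable_indic.
have -> : [set (0 : V)] = @enorm R d @^-1` [set 0].
  by apply/seteqP; split => y /= => [->|/eqP]; [rewrite enorm0|rewrite enorm_eq0 => /eqP].
by rewrite -[X in measurable X]setTI; apply: measurable_enorm.
Qed.

Lemma Lig_jcap n : Lig (jcap n).
Proof.
apply: (@Lig_dom _ _ _ (fun y => n%:R * \1_(eball 1) y + cut y * J y)).
- exact: measurable_jcap.
- move=> y; rewrite ger0_norm ?jcap_ge0 // indicE in_eball; case: ltP => y1.
    by rewrite mulr1 (le_trans (jcap_le n y)) // lerDl mulr_ge0 ?cut_ge0 ?(j0_ge0 j_levy).
  rewrite mulr0 add0r cut_out // mul1r /jcap; case: eqP => [y0|_]; last by rewrite ge_min lexx.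
  by move: y1; rewrite y0 enorm0 ler10.
- by apply: LigD; [apply: LigZ; exact: Lig_eball|exact: Lig_cut_j0].
Qed.

Lemma rkernel_jcap n : rkernel (jcap n).
Proof.
split; [exact: Lig_jcap|exact: jcap_ge0|move=> y z yz; rewrite /jcap].
case: (eqVneq y 0) yz => [->|y0 yz].
  by case: eqP => // _; rewrite ge_min lexx orbT.
have z0 : z != 0 by rewrite -enorm_gt0 (lt_le_trans _ yz) // enorm_gt0.
by rewrite (negbTE z0) le_min2 // (j0_le j_radial).
Qed.

Definition jtail n y : R := cut y * (J y - Num.min (J y) n%:R).

Lemma jtail_ge0 n y : 0 <= jtail n y.
Proof. by rewrite mulr_ge0 ?cut_ge0 // subr_ge0 ge_min lexx. Qed.

Lemma Lig_jtail n : Lig (jtail n).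
Proof.
apply: (@Lig_dom _ _ _ (fun y => cut y * J y)); last exact: Lig_cut_j0.
- apply: measurable_funM; first exact: measurable_cut.
  by apply: measurable_funB; [|apply: measurable_minr => //]; exact: measurable_j0.
- move=> y; rewrite ger0_norm ?jtail_ge0 // ler_wpM2l ?cut_ge0 // lerBlDr lerDl.
  by rewrite le_min ler0n (j0_ge0 j_levy).
Qed.

(** Dominated convergence: at each [y] the tail vanishes as soon as [n >= J y]. *)
Lemma jtail_small (e : R) : 0 < e -> exists n, Lint (jtail n) <= e.
Proof.
move=> e0.
have := @dominated_cvg _ _ _ (lebesgue_rV d) setT measurableT
  (fun n y => (jtail n y)%:E) (fun=> 0%E) (fun y => (cut y * J y)%:E).
have cvg0 y : (fun n => (jtail n y)%:E) @ \oo --> (0 : \bar R).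
  apply: cvg_near_cst; near=> n; rewrite /jtail min_l ?subrr ?mulr0 //.
  by near: n; exact: nbhs_infty_ger.
move=> /(_ _ (fun y _ => cvg0 y)) h.
have {}h : (\int[lebesgue_rV d]_y (jtail n y)%:E)%E @[n --> \oo] --> (0 : \bar R).
  have E0 : (\int[lebesgue_rV d]_(y in [set: V]) (0 : \bar R) = 0)%E by rewrite integral0.
  rewrite -[X in _ --> X]E0; apply: h => //.
  - by move=> n; apply/measurable_EFinP; exact: Lig_measurable (Lig_jtail n).
  - exact: Lig_cut_j0.
  - move=> n y _; rewrite /= ger0_norm ?jtail_ge0 // lee_fin ler_wpM2l ?cut_ge0 //.
    by rewrite lerBlDr lerDl le_min ler0n (j0_ge0 j_levy).
have {}h : (fun n => (Lint (jtail n))%:E) @ \oo --> (0 : \bar R).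
  by under eq_fun do rewrite -(EFin_Lint (Lig_jtail _)).
have /fine_cvgP[_ /cvgrPdist_le/(_ e e0)[N _ /(_ N (leqnn N))]] := h.
rewrite /= sub0r normrN ger0_norm => [hN|]; first by exists N.
by apply: Lint_ge0 => y; exact: jtail_ge0.
Unshelve. all: by end_near. Qed.

Section second_moments.
Variables (r : R) (i0 : 'I_d).
Hypothesis r0 : 0 < r.

Local Notation B := (\1_(eball r) : V -> R).

Let sB (e : V) c y : edot e e = 1 -> c = 0 -> B (reflect e c y) = B y.
Proof. by move=> e1 ->; rewrite !indicE !in_eball enorm_reflect0. Qed.

Lemma edot_delta1 i : edot (delta_mx ord0 i : V) (delta_mx ord0 i) = 1.
Proof. by rewrite -sqr_enorm enorm_delta expr1n. Qed.

Lemma reflect_delta i (y : V) k :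
  reflect (delta_mx ord0 i) 0 y ord0 k = (if k == i then -1 else 1) * y ord0 k.
Proof.
rewrite /reflect subr0 edot_delta !mxE eqxx /=; case: eqP => [->|_]; first by rewrite mulr1; ring.
by rewrite mulr0 subr0 mul1r.
Qed.

Lemma Lig_coordM (f : V -> R) i : Lig f -> (forall y, r <= enorm y -> f y = 0) ->
  Lig (fun y => y ord0 i * f y).
Proof.
move=> If f0; apply: (@Lig_dom _ _ _ (fun y => r * `|f y|)).
- apply: measurable_funM; [exact: measurable_coord|exact: Lig_measurable].
- move=> y; rewrite normrM; have [yr|yr] := leP r (enorm y).
    by rewrite f0 // normr0 !mulr0.
  by rewrite ler_wpM2r // (le_trans (coord_le_enorm y i)) // ltW.
- by apply: LigZ; exact: Lig_norm.
Qed.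

Lemma ball_out (y : V) : r <= enorm y -> B y = 0.
Proof. by move=> yr; rewrite indicE in_eball ltNge yr. Qed.

Lemma Lig_coord_ball i : Lig (fun y => y ord0 i * B y).
Proof. by apply: Lig_coordM; [exact: Lig_eball|exact: ball_out]. Qed.

Lemma Lig_coord2_ball i k : Lig (fun y => y ord0 i * (y ord0 k * B y)).
Proof.
apply: Lig_coordM; first exact: Lig_coord_ball.
by move=> y /ball_out ->; rewrite mulr0.
Qed.

Lemma Lint_odd (f : V -> R) i : Lig f ->
  (forall y, f (reflect (delta_mx ord0 i) 0 y) = - f y) -> Lint f = 0.
Proof.
move=> If fo; have := Lint_reflect 0 (edot_delta1 i) (Lig_measurable If).
under [fun x => _]funext do rewrite fo.
by rewrite LintN //; lra.
Qed.

Lemma Lint_coord2_ball_neq i k : i != k ->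
  Lint (fun y => y ord0 i * (y ord0 k * B y)) = 0.
Proof.
move=> ik; apply: (Lint_odd (i := i)) => [|y]; first exact: Lig_coord2_ball.
rewrite sB ?edot_delta1 // !reflect_delta eqxx eq_sym (negbTE ik); ring.
Qed.

(** The reflection with normal [(e_i - e_k) / sqrt 2] exchanges the two coordinates and preserves
    the ball. *)
Lemma Lint_coord2_ball_eq i k :
  Lint (fun y => y ord0 i * (y ord0 i * B y)) = Lint (fun y => y ord0 k * (y ord0 k * B y)).
Proof.
have [->//|ik] := eqVneq i k.
pose e : V := (Num.sqrt 2)^-1 *: (delta_mx ord0 i - delta_mx ord0 k).
have s2 : Num.sqrt 2 ^+ 2 = 2 :> R by rewrite sqr_sqrtr.
have s20 : Num.sqrt 2 != 0 :> R by rewrite sqrtr_eq0 -ltNge.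
have dik : (delta_mx ord0 i : V) ord0 k = 0 by rewrite mxE eq_sym (negbTE ik).
have dki : (delta_mx ord0 k : V) ord0 i = 0 by rewrite mxE (negbTE ik).
have dii l : (delta_mx ord0 l : V) ord0 l = 1 by rewrite mxE !eqxx.
have e1 : edot e e = 1.
  rewrite /e !edotE !edot_delta1 !edot_delta dik dki.
  have E (s : R) : s != 0 -> s^-1 * (s^-1 * (1 - 0) - s^-1 * (0 - 1)) = 2 / s ^+ 2.
    by move=> ?; field.
  by rewrite E // s2 divff.
rewrite -(Lint_reflect 0 e1 (Lig_measurable (Lig_coord2_ball i i))).
congr Lint; apply/funext => y; rewrite sB //.
suff -> : reflect e 0 y ord0 i = y ord0 k by [].
rewrite /reflect subr0 /e !edotE !edot_delta !mxE !eqxx (negbTE ik) /=.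
have E (s a b : R) : s != 0 -> a - 2 * (s^-1 * (a - b)) * (s^-1 * (1 - 0)) = a - 2 * (a - b) / s ^+ 2.
  by move=> ?; field.
by rewrite E // s2; field.
Qed.

Definition ball_moment : R := Lint (fun y => y ord0 i0 * (y ord0 i0 * B y)).

Lemma Lint_lin_radial p x (g : V -> R) : (forall i, Lig (fun y => y ord0 i * g y)) ->
  (forall i y, g (reflect (delta_mx ord0 i) 0 y) = g y) ->
  Lig (fun y => lin p x y * g y) /\ Lint (fun y => lin p x y * g y) = 0.
Proof.
move=> Ig gs.
have g0 i : Lint (fun y => y ord0 i * g y) = 0.
  apply: (Lint_odd (i := i)) => [|y]; first exact: Ig.
  by rewrite gs reflect_delta eqxx; ring.
have E : (fun y => lin p x y * g y) = (fun y => \sum_i p i x * (y ord0 i * g y)).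
  by apply/funext => y; rewrite mulr_suml; apply: eq_bigr => i _; rewrite mulrA.
rewrite E; elim: (index_enum _) => [|i s [I1 I2]].
  have -> : (fun y : V => \sum_(i <- [::]) p i x * (y ord0 i * g y)) = (fun=> 0).
    by apply/funext => y; rewrite big_nil.
  by split; [exact: Lig_cst0|exact: Lint0].
have -> : (fun y : V => \sum_(l <- i :: s) p l x * (y ord0 l * g y)) =
  (fun y : V => p i x * (y ord0 i * g y) + \sum_(l <- s) p l x * (y ord0 l * g y)).
  by apply/funext => y; rewrite big_cons.
have Ii := LigZ (p i x) (Ig i).
split; first exact: LigD.
by rewrite LintD // LintZ // g0 mulr0 I2 addr0.
Qed.

(** Mixed moments vanish and pure ones are equal by symmetry, so a quadratic form averages to a
    multiple of its trace: this is where the Laplacian comes from. *)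
Lemma Lint_quad_ball H x : Lig (fun y => quad H x y * B y) /\
  Lint (fun y => quad H x y * B y) = ball_moment * \sum_i H i i x.
Proof.
have L i : Lig (fun y => lin (H i) x y * (y ord0 i * B y)) /\
    Lint (fun y => lin (H i) x y * (y ord0 i * B y)) = H i i x * ball_moment.
  have E : (fun y => lin (H i) x y * (y ord0 i * B y)) =
      (fun y => \sum_k H i k x * (y ord0 k * (y ord0 i * B y))).
    by apply/funext => y; rewrite mulr_suml; apply: eq_bigr => k _; rewrite -mulrA.
  rewrite E; have -> : H i i x * ball_moment = \sum_k (k == i)%:R * (H i k x * ball_moment).
    rewrite (bigD1 i) //= big1 => [|k ki]; last by rewrite (negbTE ki) mul0r.
    by rewrite eqxx mul1r addr0.
  elim: (index_enum _) => [|k s [I1 I2]].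
    have -> : (fun y : V => \sum_(k <- [::]) H i k x * (y ord0 k * (y ord0 i * B y))) = (fun=> 0).
      by apply/funext => y; rewrite big_nil.
    by rewrite big_nil; split; [exact: Lig_cst0|exact: Lint0].
  have -> : (fun y : V => \sum_(l <- k :: s) H i l x * (y ord0 l * (y ord0 i * B y))) =
     (fun y : V => H i k x * (y ord0 k * (y ord0 i * B y)) +
       \sum_(l <- s) H i l x * (y ord0 l * (y ord0 i * B y))).
    by apply/funext => y; rewrite big_cons.
  have Ik := LigZ (H i k x) (Lig_coord2_ball k i).
  split; first exact: LigD.
  rewrite LintD // LintZ; last exact: Lig_coord2_ball.
  rewrite big_cons I2; congr (_ + _); have [->|ki] := eqVneq k i.
    by rewrite mul1r (Lint_coord2_ball_eq i i0).
  by rewrite Lint_coord2_ball_neq // mulr0 mul0r.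
have E : (fun y => quad H x y * B y) = (fun y => \sum_i lin (H i) x y * (y ord0 i * B y)).
  apply/funext => y; rewrite quad_lin mulr_suml; apply: eq_bigr => i _; ring.
rewrite E mulr_sumr; elim: (index_enum _) => [|i s [I1 I2]].
  have -> : (fun y : V => \sum_(i <- [::]) lin (H i) x y * (y ord0 i * B y)) = (fun=> 0).
    by apply/funext => y; rewrite big_nil.
  by rewrite big_nil; split; [exact: Lig_cst0|exact: Lint0].
have -> : (fun y : V => \sum_(l <- i :: s) lin (H l) x y * (y ord0 l * B y)) =
  (fun y : V => lin (H i) x y * (y ord0 i * B y) + \sum_(l <- s) lin (H l) x y * (y ord0 l * B y)).
  by apply/funext => y; rewrite big_cons.
have [L1 L2] := L i.
split; first exact: LigD.
by rewrite LintD // L2 big_cons I2 mulrC.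
Qed.

Lemma ball_moment_gt0 : 0 < ball_moment.
Proof.
(* On the ball of radius [r / 4] around [z], which lies in [eball r], the coordinate [i0] is at
   least [r / 4]. *)
pose z : V := (r / 2) *: delta_mx ord0 i0.
have zr : 0 < r / 4 by rewrite divr_gt0.
have I1 : Lig (fun y => (\1_(eball (r / 4)) (y - z)) : R) by exact: (Lig_shift (- z) (Lig_eball (r / 4))).
apply: lt_le_trans (_ : (r / 4) ^+ 2 * Lint (\1_(eball (r / 4)) : V -> R) <= _).
  by rewrite mulr_gt0 ?exprn_gt0 // Lint_eball_gt0.
rewrite -(Lint_shift (- z)); last by apply: measurable_indic; exact: measurable_eball.
rewrite -LintZ //; apply: Lint_le => [||y]; first exact: LigZ.
  exact: Lig_coord2_ball.
rewrite [in X in X <= _]indicE in_eball; case: ltP => [yz|_]; last first.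
  by rewrite mulr0 mulrA mulr_ge0 // -expr2 sqr_ge0.
have nz : enorm z = r / 2 by rewrite /z enormZ enorm_delta mulr1 ger0_norm // divr_ge0 // ltW.
have yr : enorm y < r.
  by have := enormD (y - z) z; rewrite subrK nz; lra.
rewrite indicE in_eball yr !mulr1 -expr2 ler_pXn2r ?nnegrE ?ltW //.
  have := coord_le_enorm (y - z) i0; rewrite !mxE !eqxx mulr1 ler_norml; lra.
have := coord_le_enorm (y - z) i0; rewrite !mxE !eqxx mulr1 ler_norml; lra.
Qed.

Lemma Lig_sqr_ball : Lig (fun y => enorm y ^+ 2 * B y).
Proof.
have [h _] := Lint_quad_ball (fun i k _ => (i == k)%:R) 0.
have E y : quad (fun i k _ => (i == k)%:R) 0 y = enorm y ^+ 2.
  rewrite sqr_enorm; apply: eq_bigr => i _.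
  rewrite (bigD1 i) //= big1 => [|k ki]; last by rewrite eq_sym (negbTE ki) mul0r.
  by rewrite eqxx mul1r addr0.
by under [X in Lig X]funext do rewrite -E.
Qed.

Lemma Lint_sqr_ball : Lint (fun y => enorm y ^+ 2 * B y) = d%:R * ball_moment.
Proof.
have [_ h] := Lint_quad_ball (fun i k _ => (i == k)%:R) 0.
have E y : quad (fun i k _ => (i == k)%:R) 0 y = enorm y ^+ 2.
  rewrite sqr_enorm; apply: eq_bigr => i _.
  rewrite (bigD1 i) //= big1 => [|k ki]; last by rewrite eq_sym (negbTE ki) mul0r.
  by rewrite eqxx mul1r addr0.
under [fun y => _]funext do rewrite -E.
rewrite h; under eq_bigr do rewrite eqxx.
by rewrite sumr_const card_ord mulrC.
Qed.

Lemma ball_moment_le : ball_moment <= r ^+ 2 * Lint B.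
Proof.
rewrite -LintZ; last exact: Lig_eball.
apply: Lint_le => [||y]; first exact: Lig_coord2_ball.
  by apply: LigZ; exact: Lig_eball.
rewrite mulrA -expr2 indicE in_eball; case: ltP => yr; rewrite ?mulr0 // !mulr1.
rewrite -real_normK ?num_real // ler_pXn2r ?nnegrE ?(ltW r0) //.
by rewrite (le_trans (coord_le_enorm _ _)) // ltW.
Qed.

End second_moments.

End approximation.

Section approximation_theorem.
Context {R : realType} {d : nat}.
Local Notation V := 'rV[R]_d.
Variable j : V -> R.
Hypotheses (j_levy : levy_density j) (j_radial : radially_decreasing j).
Variable i0 : 'I_d.

Lemma rkernel_comb (k l : V -> R) a b : 0 <= a -> 0 <= b -> rkernel k -> rkernel l ->
  rkernel (fun y => a * k y + b * l y).
Proof.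
move=> a0 b0 [k1 k2 k3] [l1 l2 l3]; split.
- by apply: LigD; exact: LigZ.
- by move=> y; rewrite addr_ge0 // mulr_ge0.
- by move=> y z yz; rewrite lerD // ler_wpM2l ?k3 ?l3.
Qed.

Lemma rkernel_ball r : rkernel (\1_(eball r) : V -> R).
Proof.
split=> [|//|y z yz]; first exact: Lig_eball.
rewrite !indicE !in_eball; case: (ltP (enorm z)) => // zr.
by rewrite (le_lt_trans yz zr).
Qed.

Lemma jcap_reflect n i y : jcap j n (reflect (delta_mx ord0 i) 0 y) = jcap j n y.
Proof.
by apply: rkernel_sym; [exact: rkernel_jcap|rewrite enorm_reflect0 ?edot_delta1].
Qed.

(** The capped density has finite mass and is even, so the compensating drift integrates to 0. *)
Lemma Lint_incr_jcap n C w p H x : C3 C w p H ->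
  Lint (fun y => (w (x + y) - w x) * jcap j n y) = Lint (fun y => incr w p x y * jcap j n y).
Proof.
move=> wC; have [bw _ _] := C3_BL wC; have Ij := Lig_jcap j_levy n.
have j_ge0 := jcap_ge0 j_levy n.
pose g y := (enorm y <= 1)%R%:R * jcap j n y.
have mg : measurable_fun setT g.
  by apply: measurable_funM; [exact: measurable_unit_ball|exact: measurable_jcap].
have Ig i : Lig (fun y => y ord0 i * g y).
  apply: (@Lig_dom _ _ _ (jcap j n)) => //.
    by apply: measurable_funM => //; exact: measurable_coord.
  move=> y; rewrite /g; case: (leP (enorm y) 1) => y1; last by rewrite mul0r mulr0 normr0.
  rewrite mul1r normrM (ger0_norm (j_ge0 y)) ler_piMl //.
  exact: le_trans (coord_le_enorm _ _) y1.
have gs i y : g (reflect (delta_mx ord0 i) 0 y) = g y.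
  by rewrite /g jcap_reflect enorm_reflect0 // edot_delta1.
have [I1 I2] := Lint_lin_radial p x Ig gs.
have If : Lig (fun y => (w (x + y) - w x) * jcap j n y).
  by apply: (Lig_conv (u := fun z => w z - w x) x Ij); apply: BL_B => //; exact: BL_cst.
rewrite -[LHS]subr0 -[X in _ - X = _]I2 -LintB //; congr Lint; apply/funext => y.
by rewrite /incr /g; ring.
Qed.

Lemma incr_jcap_tail n C w p H x : C3 C w p H ->
  `|Lint (fun y => incr w p x y * jcap j n y) - Lint (fun y => incr w p x y * j0 j y)|
  <= C * (3 + d%:R ^+ 2) * Lint (jtail j n).
Proof.
move=> wC; have C0 := C3_ge0 wC; have [bw _ _] := C3_BL wC.
have K0 : 0 <= C * (3 + d%:R ^+ 2) by rewrite mulr_ge0 // addr_ge0 // exprn_ge0.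
have I1 := Lig_incr j_levy x wC.
have I2 : Lig (fun y => incr w p x y * jcap j n y).
  apply: (LigM (M := C * (3 + d%:R ^+ 2))); last exact: Lig_jcap.
    by apply: measurable_incr; exact: BL_measurable.
  move=> y; apply: le_trans (incr_le x y wC) _.
  by rewrite ler_piMr // ge_min lexx.
have It := Lig_jtail j_levy n.
rewrite -LintB // -LintZ //; apply: Lint_abs => [||y]; [exact: LigB|exact: LigZ|].
have [->|y0] := eqVneq y 0.
  have -> : incr w p x 0 = 0.
    rewrite /incr addr0 subrr sub0r /lin big1 ?mulr0 ?oppr0 // => i _.
    by rewrite mxE mulr0.
  by rewrite !mul0r subrr normr0 mulr_ge0 // jtail_ge0.
rewrite -mulrBr normrM /jcap (negbTE y0) /jtail mulrA ler_pM ?incr_le //.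
  exact: incr_le wC.
by rewrite distrC ger0_norm // subr_ge0 ge_min lexx.
Qed.

Lemma conv_ball_expand r C w p H x : 0 < r -> r <= 1 -> C3 C w p H ->
  `|conv (\1_(eball r) : V -> R) w x - w x * Lint (\1_(eball r) : V -> R)
    - 2^-1 * (ball_moment r i0 * \sum_i H i i x)| <= C * r * (d%:R * ball_moment r i0).
Proof.
move=> r0 r1 wC; have C0 := C3_ge0 wC; have [bw _ _] := C3_BL wC.
have IB := @Lig_eball R d r.
have [_ h1 _ _] := wC.
have [L1 L2] : Lig (fun y : V => lin p x y * \1_(eball r) y) /\
    Lint (fun y : V => lin p x y * \1_(eball r) y) = 0.
  apply: Lint_lin_radial => [i|i y]; first exact: Lig_coord_ball.
  by rewrite !indicE !in_eball enorm_reflect0 // edot_delta1.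
have [Q1 Q2] := Lint_quad_ball r i0 H x.
have I1 := Lig_conv x IB bw.
have I2 := LigZ (w x) IB.
have I3 := LigZ 2^-1 Q1.
have I4 := LigB (LigB (LigB I1 I2) L1) I3.
have -> : conv (\1_(eball r) : V -> R) w x - w x * Lint (\1_(eball r) : V -> R)
    - 2^-1 * (ball_moment r i0 * \sum_i H i i x) =
  Lint (fun y : V => w (x + y) * \1_(eball r) y - w x * \1_(eball r) y -
    lin p x y * \1_(eball r) y - 2^-1 * (quad H x y * \1_(eball r) y)).
  rewrite LintB //; last exact: (LigB (LigB I1 I2) L1).
  rewrite LintB //; last exact: (LigB I1 I2).
  by rewrite LintB // L2 subr0 !LintZ // Q2.
rewrite -(@Lint_sqr_ball R d r i0) -LintZ; last exact: Lig_sqr_ball.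
apply: Lint_abs => // [|y]; first by apply: LigZ; exact: Lig_sqr_ball.
rewrite indicE in_eball; case: ltP => yr; last first.
  by rewrite !mulr0 !subr0 normr0.
have n0 := enorm_ge0 y.
rewrite !mulr1; apply: le_trans (h1 x y _) _; first by lra.
rewrite -mulrA ler_wpM2l // exprS ler_wpM2r ?exprn_ge0 //; exact: ltW.
Qed.

(* One time step of length [h]: a jump uniform in a small ball, whose second
   moment gives the Laplacian, or a jump along the truncated density, or
   killing at rate [m]. *)
Lemma approximation (m C e : R) : 0 <= m -> 0 <= C -> 0 < e ->
  exists h k, [/\ 0 < h <= e, h * m <= 1, rkernel k, Lint k = 1 - h * m &
    forall w p H, C3 C w p H -> forall x : V,
      `|(conv k w x - (1 - h * m) * w x) / h - Lop j w p H x| <= e].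
Proof.
move=> m0 C0 e0; pose K := C * (3 + d%:R ^+ 2).
have K0 : 0 <= K by rewrite mulr_ge0 // addr_ge0 // exprn_ge0.
have [n nP] := jtail_small j_levy (divr_gt0 e0 (mulr_gt0 (ltr0Sn R 1) (ltr_pwDr ltr01 K0))).
pose mn := Lint (jcap j n).
have mn0 : 0 <= mn by apply: Lint_ge0 => y; exact: jcap_ge0.
have dC0 : 0 <= d%:R * C by rewrite mulr_ge0.
pose Q := (d%:R * C + 1) * (m + mn + 1).
have Q1 : 1 <= Q by rewrite -[leLHS]mulr1 ler_pM // lerDr // addr_ge0.
have Q0 : 0 < Q by rewrite (lt_le_trans ltr01).
(* [r * Q <= 1] makes the mass [A] below nonnegative; [r * Q <= e / 8] controls the errors
   proportional to [h] and to [r]. *)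
pose r := Num.min (Q^-1) (e / (8 * Q)).
have r0 : 0 < r by rewrite lt_min invr_gt0 Q0 divr_gt0 // mulr_gt0.
have rQ : r * Q <= 1 by rewrite -ler_pdivlMr // div1r ge_min lexx.
have rQe : r * Q <= e / 8.
  by rewrite -ler_pdivlMr // -mulrA -invfM ge_min lexx orbT.
have r1 : r <= 1 by rewrite (le_trans _ rQ) // ler_peMr // ltW.
have QE : Q = d%:R * C * (m + mn) + d%:R * C + (m + mn) + 1 by rewrite /Q; ring.
pose vol := Lint (\1_(eball r) : V -> R).
have vol0 : 0 < vol by exact: Lint_eball_gt0.
pose M2 := ball_moment r i0.
have M20 : 0 < M2 by exact: ball_moment_gt0.
(* A uniform jump in the ball has covariance [M2 / vol] times the identity; with this [h], its
   second-order effect is [h] times the Laplacian. *)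
pose h := M2 / (2 * vol).
have h0 : 0 < h by rewrite divr_gt0 // mulr_gt0.
have hr : h <= r / 2.
  have := ball_moment_le i0 r0; rewrite -/M2 -/vol => hM.
  have : r ^+ 2 * vol <= r * vol.
    by rewrite ler_wpM2r ?(ltW vol0) // expr2 ler_piMl // ltW.
  by rewrite /h ler_pdivrMr ?mulr_gt0 //; lra.
have mmn : 0 <= m + mn by rewrite addr_ge0.
have dCm : 0 <= d%:R * C * (m + mn) by rewrite mulr_ge0.
have hQ : h * Q <= r / 2 * Q by rewrite ler_wpM2r // ltW.
(* The mass left to the small ball once killing has taken [h * m] and the jumps along [jcap] have
   taken [h * mn]. *)
pose A := 1 - h * (m + mn).
have hm0 : 0 <= h * m by rewrite mulr_ge0 // ltW.
have hmn0 : 0 <= h * mn by rewrite mulr_ge0 // ltW.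
have hd0 : 0 <= h * (d%:R * C) by rewrite mulr_ge0 // ltW.
have hdm0 : 0 <= h * (d%:R * C * (m + mn)) by rewrite mulr_ge0 // ltW.
have rd0 : 0 <= r * (d%:R * C) by rewrite mulr_ge0 // ltW.
have rdm0 : 0 <= r * (d%:R * C * (m + mn)) by rewrite mulr_ge0 // ltW.
have rm0 : 0 <= r * (m + mn) by rewrite mulr_ge0 // ltW.
rewrite QE !mulrDr in rQ rQe hQ.
have A1 : 0 <= A <= 1 by apply/andP; split; rewrite /A; clear -j_levy j_radial i0 hQ rQ rQe hm0 hmn0 hd0 hdm0 rd0 rdm0 rm0 r1 r0 h0; lra.
have /andP[A0 A1'] := A1.
pose k y := A / vol * \1_(eball r) y + h * jcap j n y.
have rk : rkernel k.
  apply: rkernel_comb; rewrite ?(ltW h0) ?divr_ge0 ?(ltW vol0) //.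
    exact: rkernel_ball.
  exact: rkernel_jcap.
have IB := @Lig_eball R d r; have Ij := Lig_jcap j_levy n.
exists h, k; split => //; [by rewrite h0 /=; lra|lra| |].
  rewrite /k LintD; [|exact: LigZ|exact: LigZ].
  by rewrite !LintZ // -/vol -/mn /A divfK ?gt_eqF //; ring.
move=> w p H wC x; have [bw _ _] := C3_BL wC; have [_ _ _ h3] := wC.
rewrite /k conv_kD; [|exact: LigZ|exact: LigZ|by []].
rewrite !conv_kZ //.
have hB := conv_ball_expand x r0 r1 wC.
rewrite -/vol -/M2 in hB.
set D := \sum_i H i i x in hB.
have DC : `|D| <= d%:R * C.
  apply: le_trans (ler_norm_sum _ _ _) _.
  apply: le_trans (_ : \sum_(i < d) C <= _); first by apply: ler_sum => i _; exact: (h3 i i x).1.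
  by rewrite sumr_const card_ord -[leLHS]mulr_natl.
have cj : conv (jcap j n) w x = w x * mn + Lint (fun y => incr w p x y * jcap j n y).
  rewrite -(Lint_incr_jcap n x wC) -LintZ // -LintD.
  - by congr Lint; apply/funext => y; ring.
  - exact: LigZ.
  - by apply: (Lig_conv (u := fun z => w z - w x) x Ij); apply: BL_B => //; exact: BL_cst.
have ht := incr_jcap_tail n x wC.
rewrite cj /Lop -/D -/K in ht *.
set J := Lint (fun y => incr w p x y * jcap j n y) in ht *.
set J0 := Lint (fun y => incr w p x y * j0 j y) in ht *.
set E := conv _ w x - _ - _ in hB.
have -> : conv (\1_(eball r) : V -> R) w x = w x * vol + 2^-1 * (M2 * D) + E by rewrite /E; ring.
have vol1 : vol != 0 by rewrite gt_eqF.
have M21 : M2 != 0 by rewrite gt_eqF.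
(* Three errors remain: [A] differs from 1, the cubic remainder on the small ball, and the
   truncation of the density. *)
have -> : (A / vol * (w x * vol + 2^-1 * (M2 * D) + E) + h * (w x * mn + J) -
   (1 - h * m) * w x) / h - (D + J0) = - (h * (m + mn)) * D + A * (2 * (E / M2)) + (J - J0).
  by rewrite /A /h; field; rewrite vol1 M21.
have e1 : `|- (h * (m + mn)) * D| <= h * (m + mn) * (d%:R * C).
  by rewrite normrM normrN (ger0_norm (x := h * _)) ?ler_wpM2l // mulr_ge0 // ltW.
have e2 : `|A * (2 * (E / M2))| <= 2 * (C * r * d%:R).
  rewrite normrM (ger0_norm A0); apply: le_trans (_ : 1 * _ <= _).
    by apply: ler_wpM2r A1'.
  rewrite mul1r normrM ger0_norm // ler_wpM2l // normrM normfV (gtr0_norm M20).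
  by rewrite ler_pdivrMr //; move: hB; clear -j_levy j_radial i0 M20; lra.
have e3 : K * Lint (jtail j n) <= e / 2.
  apply: le_trans (_ : K * (e / (2 * (K + 1))) <= _); first by rewrite ler_wpM2l.
  rewrite (_ : K * _ = e / 2 * (K / (K + 1))); last by field; rewrite gt_eqF // ltr_wpDl.
  by rewrite ler_piMr ?divr_ge0 ?ltW // ltr_pdivrMr ?ltr_wpDl // mul1r ltrDl ltr01.
move: e1 e2 ht; rewrite !ler_norml; clear -j_levy j_radial i0 e3 e0 hQ rQ rQe hm0 hmn0 hd0 hdm0 rd0 rdm0 rm0 h0 r0 C0; lra.
Qed.

End approximation_theorem.

(** * Mollification *)

Section mollifier.
Context {R : realType} {d : nat}.
Local Notation V := 'rV[R]_d.
Implicit Types (u v w : V -> R) (x y z : V).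

Lemma ppow_ge0 n (t : R) : 0 <= ppow n t.
Proof. by rewrite exprn_ge0 // le_max lexx. Qed.

Lemma ppow_le n (s t : R) : s <= t -> ppow n s <= ppow n t.
Proof.
move=> st; have h : Num.max 0 s <= Num.max 0 t by rewrite ge_max !le_max lexx st orbT.
by rewrite lerXn2r // nnegrE le_max lexx.
Qed.

Lemma bump_out n (r : R) x : r <= enorm x ^+ 2 -> bump n.+1 r x = 0.
Proof. by move=> h; rewrite /bump ppow_le0 // subr_le0. Qed.

Lemma bump_out3 n (rho : R) x : rho <= enorm x -> 0 <= rho ->
  [/\ bump n.+3 (rho ^+ 2) x = 0, forall i, bump_grad n.+3 (rho ^+ 2) i x = 0 &
      forall i k, bump_hess n.+3 (rho ^+ 2) i k x = 0].
Proof.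
move=> h h0; have : rho ^+ 2 - enorm x ^+ 2 <= 0.
  by rewrite subr_le0 lerXn2r ?nnegrE ?enorm_ge0.
move=> hn; split=> [|i|i k]; rewrite /bump /bump_grad /bump_hess /= !ppow_le0 //.
  by rewrite mulr0 mul0r.
by rewrite !(mulr0, mul0r) subr0.
Qed.

Lemma rkernel_bump n (rho : R) : 0 < rho -> rkernel (bump n.+3 (rho ^+ 2) : V -> R).
Proof.
move=> rho0; have [C bC] := @C3_bump R d n (rho ^+ 2) (sqr_ge0 _).
have [bb _ _] := C3_BL bC; have [h0 _ _ _] := bC.
split.
- apply: (@Lig_supp _ _ _ C rho) => //; first exact: BL_measurable.
  by move=> x h; have [] := bump_out3 n h (ltW rho0).
- by move=> y; exact: ppow_ge0.
- move=> y z yz; apply: ppow_le; rewrite lerD2l lerN2.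
  by rewrite lerXn2r ?nnegrE ?enorm_ge0.
Qed.

Lemma Lint_bump_gt0 n (rho : R) : 0 < rho -> 0 < Lint (bump n.+3 (rho ^+ 2) : V -> R).
Proof.
move=> rho0; have [Ib b0 _] := rkernel_bump n rho0.
have c0 : 0 < rho ^+ 2 - (rho / 2) ^+ 2.
  have : 0 < rho ^+ 2 by rewrite exprn_gt0.
  by rewrite exprMn expr2; lra.
apply: lt_le_trans (_ : (rho ^+ 2 - (rho / 2) ^+ 2) ^+ n.+3 * Lint (\1_(eball (rho / 2)) : V -> R) <= _).
  by rewrite mulr_gt0 ?exprn_gt0 // Lint_eball_gt0 // divr_gt0.
rewrite -LintZ; last exact: Lig_eball.
apply: Lint_le => // [|y]; first by apply: LigZ; exact: Lig_eball.
rewrite indicE in_eball; case: ltP => [yr|_]; last by rewrite mulr0.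
have -> : (rho ^+ 2 - (rho / 2) ^+ 2) ^+ n.+3 = ppow n.+3 (rho ^+ 2 - (rho / 2) ^+ 2).
  by rewrite /ppow max_r // ltW.
rewrite mulr1 ppow_le // lerD2l lerN2 lerXn2r ?nnegrE ?enorm_ge0 ?divr_ge0 ?ltW //.

Qed.

Definition moll (rho : R) y : R := (Lint (bump 3 (rho ^+ 2) : V -> R))^-1 * bump 3 (rho ^+ 2) y.

Lemma rkernel_moll rho : 0 < rho -> rkernel (moll rho).
Proof.
move=> r0; have [b1 b2 b3] := rkernel_bump 0 r0.
have c0 : 0 <= (Lint (bump 3 (rho ^+ 2) : V -> R))^-1 by rewrite invr_ge0 Lint_ge0.
by split=> [|y|y z yz]; [exact: LigZ|rewrite mulr_ge0|rewrite ler_wpM2l // b3].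
Qed.

Lemma Lint_moll rho : 0 < rho -> Lint (moll rho) = 1.
Proof.
move=> r0; have [b1 _ _] := rkernel_bump 0 r0.
by rewrite LintZ // mulVf // gt_eqF // Lint_bump_gt0.
Qed.

Lemma moll_out rho y : 0 <= rho -> rho <= enorm y -> moll rho y = 0.
Proof. by move=> r0 h; rewrite /moll; have [-> _ _] := bump_out3 0 h r0; rewrite mulr0. Qed.

(** The constant depends on [rho] and on the bound [M] but not on [u], so the accuracy of the kernel
    can be fixed before the iterates that it generates. *)
Lemma C3_moll rho M : 0 < rho -> exists C, forall u, BL u -> (forall x, `|u x| <= M) ->
  exists p H, C3 C (conv (moll rho) u) p H.
Proof.
move=> r0; have [b1 _ _] := rkernel_bump 0 r0.
have [C bC] := @C3_bump R d 0 (rho ^+ 2) (sqr_ge0 _).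
exists (`|(Lint (bump 3 (rho ^+ 2) : V -> R))^-1| * (M * (C * Lint (\1_(eball (rho + 1)) : V -> R)))).
move=> u bu uM; have := C3_conv bC (fun x h => bump_out3 0 h (ltW r0)) bu uM.
move=> /(C3_Z (Lint (bump 3 (rho ^+ 2) : V -> R))^-1) h.
do 2 eexists; move: h.
have -> : conv (moll rho) u = (fun x => (Lint (bump 3 (rho ^+ 2) : V -> R))^-1 * conv (bump 3 (rho ^+ 2)) u x).
  by apply/funext => x; rewrite -conv_kZ.
by apply.
Qed.

Lemma conv_le_on (k : V -> R) rho u v x : Lig k -> (forall y, 0 <= k y) ->
  (forall y, rho <= enorm y -> k y = 0) -> BL u -> BL v ->
  (forall y, enorm y < rho -> u (x + y) <= v (x + y)) -> conv k u x <= conv k v x.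
Proof.
move=> Ik k0 ks bu bv uv; apply: Lint_le; [exact: Lig_conv|exact: Lig_conv|move=> y].
by have [h|h] := ltP (enorm y) rho; [rewrite ler_wpM2r ?uv|rewrite ks // !mulr0].
Qed.

Lemma moll_le rho u v x : 0 < rho -> BL u -> BL v ->
  (forall y, enorm y < rho -> u (x + y) <= v (x + y)) ->
  conv (moll rho) u x <= conv (moll rho) v x.
Proof.
move=> r0 bu bv uv; have [b1 b2 _] := rkernel_moll r0.
by apply: (conv_le_on b1 b2 _ bu bv uv) => y h; rewrite moll_out // ltW.
Qed.

Lemma moll_cst rho a x : 0 < rho -> conv (moll rho) (fun=> a) x = a.
Proof. by move=> r0; have [b1 _ _] := rkernel_moll r0; rewrite conv_cst // Lint_moll // mulr1. Qed.

End mollifier.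

(** * Viscosity supersolutions and barriers *)

Section viscosity.
Context {R : realType} {d : nat}.
Local Notation V := 'rV[R]_d.
Variable j : V -> R.
Hypothesis j_levy : levy_density j.
Implicit Types (u v w : V -> R) (x y z : V).

(** The integral is built from suprema over simple functions, hence monotone for arbitrary
    functions. This covers the integrands built with [patch], whose measurability is not
    established. *)
Lemma le_integral_nomeas (f g : V -> \bar R) : (forall x, f x <= g x)%E ->
  (\int[lebesgue_rV d]_x f x <= \int[lebesgue_rV d]_x g x)%E.
Proof.
move=> fg; rewrite /integral !patch_setT; apply: leeB.
  apply: ge_ereal_sup => _ [h hf <-]; apply: ereal_sup_ubound; exists h => // x.
  exact: le_trans (hf x) (funepos_le (D := setT) (fun y _ => fg y) (in_setT x)).
apply: ge_ereal_sup => _ [h hf <-]; apply: ereal_sup_ubound; exists h => // x.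
exact: le_trans (hf x) (funeneg_le (D := setT) (fun y _ => fg y) (in_setT x)).
Qed.

Lemma is_derive_line (F : V -> R) (x e : V) t : derivable F (x + t *: e) e ->
  is_derive t (1 : R) (fun s => F (x + s *: e)) ('D_e F (x + t *: e)).
Proof.
move=> dF.
have E : (fun h : R => h^-1 *: (((fun s => F (x + s *: e)) \o shift t) (h *: (1 : R)) - F (x + t *: e))) =
         (fun h : R => h^-1 *: ((F \o shift (x + t *: e)) (h *: e) - F (x + t *: e))).
  apply/funext => h /=; congr (_ *: (F _ - _)).
  by rewrite -[h *: 1]/(h * 1) mulr1 scalerDl addrCA.
by apply: DeriveDef; rewrite /derivable /derive E.
Qed.

(** The second-order condition at a maximum along a line. If [b] were positive, the first derivative
    would be positive just after 0 and [F] would increase there, by the mean value theorem. *)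
Lemma max_derive2 (F : V -> R) (x e : V) (r b : R) : 0 < r ->
  (forall t, `|t| < r -> F (x + t *: e) <= F x) ->
  (forall t, `|t| < r -> derivable F (x + t *: e) e) ->
  is_derive x e (fun y => 'D_e F y) b ->
  'D_e F x = 0 /\ b <= 0.
Proof.
move=> r0 Fmax dF [d2 b2]; pose f t := F (x + t *: e).
pose f' t := 'D_e F (x + t *: e).
have df t : `|t| < r -> is_derive t (1 : R) f (f' t) by move=> tr; exact/is_derive_line/dF.
have x0 : x + 0 *: e = x by rewrite scale0r addr0.
have cf : forall t, `|t| < r -> {for t, continuous f}.
  move=> t tr; apply: differentiable_continuous; apply/derivable1_diffP.
  by have [] := df t tr.
have mvt a c : a < c -> `|a| < r -> `|c| < r -> exists2 s, a < s < c & f c - f a = f' s * (c - a).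
  move=> ac ar cr; have [||s] := @MVT R f f' a c ac.
  - move=> s; rewrite in_itv /= => /andP[as' sc]; apply: df.
    by move: ar cr; rewrite !ltr_norml; lra.
  - apply: continuous_in_subspaceT => s; rewrite inE /= in_itv /= => /andP[as' sc].
    by apply: cf; move: ar cr; rewrite !ltr_norml; lra.
  by rewrite in_itv /= => sac E; exists s.
have cvg0 : (fun h : R => h^-1 *: (f' h - f' 0)) @ 0^' --> b.
  have -> : (fun h : R => h^-1 *: (f' h - f' 0)) =
     (fun h => h^-1 *: (((fun y => 'D_e F y) \o shift x) (h *: e) - 'D_e F x)).
    by apply/funext => h; rewrite /f' x0 /= (addrC x).
  by rewrite -b2; exact: d2.
have f0 : f' 0 = 0.
  have [_ <-] : is_derive (0 : R) (1 : R) f (f' 0) by apply: df; rewrite normr0.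
  have [] // : is_derive (0 : R) (1 : R) f 0.
  have rr : - r <= r by lra.
  have inr t : t \in `]- r, r[ -> `|t| < r by rewrite in_itv /= ltr_norml.
  have dfr t : t \in `]- r, r[ -> derivable f t 1 by move=> /inr/df[].
  apply: (derive1_at_max rr dfr); first by rewrite in_itv /= oppr_lt0 r0.
  by move=> t /inr tr; rewrite /f x0; exact: Fmax.
split; first by rewrite -f0 /f' x0.
rewrite leNgt; apply/negP => b0.
have /cvgrPdist_lt/(_ _ b0)/nbhs_ballP[e' /= e'0 he] := cvg0.
pose m := Num.min e' r; have m0 : 0 < m by rewrite lt_min e'0.
have me : m <= e' by rewrite ge_min lexx.
have mr : m <= r by rewrite ge_min lexx orbT.
have [|||s /andP[s0 sm] E] := @mvt 0 (m / 2); rewrite ?normr0 ?divr_gt0 //.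
  by rewrite gtr0_norm ?divr_gt0 //; lra.
have := he s; rewrite -ball_normE /= sub0r normrN gtr0_norm // => /(_ _ (lt0r_neq0 s0)).
have sl : s < e' by lra.
move=> /(_ sl); rewrite f0 subr0 => hs.
have fs : 0 < f' s.
  have : 0 < s^-1 *: f' s by move: hs; rewrite ltr_norml; lra.
  by rewrite pmulr_rgt0 // invr_gt0.
have := Fmax (m / 2); rewrite -/(f _) gtr0_norm ?divr_gt0 //.
have -> : F x = f 0 by rewrite /f x0.
have : 0 < f' s * (m / 2 - 0) by rewrite mulr_gt0 // subr0 divr_gt0.
by rewrite -E => h1 h2; have := h2 ltac:(lra); lra.
Qed.

Lemma patch_in u (N : set V) f x : N x -> patch u N f x = f x.
Proof. by move=> Nx; rewrite /patch mem_set. Qed.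

Lemma near_partial (f g : V -> R) (N : set V) i x : open N -> N x ->
  (forall y, N y -> f y = g y) -> partial i f x = partial i g x.
Proof.
move=> oN Nx fg; apply: near_eq_derive.
have : nbhs x N by exact: open_nbhs_nbhs.
by apply: filterS => y /fg.
Qed.

Lemma near_derivable (f g : V -> R) (N : set V) (v : V) x : open N -> N x ->
  (forall y, N y -> f y = g y) -> derivable f x v -> derivable g x v.
Proof.
move=> oN Nx fg; apply: near_eq_derivable.
have : nbhs x N by exact: open_nbhs_nbhs.
by apply: filterS => y /fg.
Qed.

Lemma open_line (N : set V) x (e : V) : open N -> N x ->
  exists2 r : R, 0 < r & forall t, `|t| < r -> N (x + t *: e).
Proof.
move=> oN Nx; have : nbhs x N by exact: open_nbhs_nbhs.
move=> /nbhs_enorm[r r0 rN]; exists (r / (enorm e + 1)).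
  by rewrite divr_gt0 // ltr_wpDl ?enorm_ge0.
move=> t; rewrite ltr_pdivlMr ?ltr_wpDl ?enorm_ge0 // => tr; apply: rN.
rewrite addrC addKr enormZ; have := normr_ge0 t; have := enorm_ge0 e; lra.
Qed.

(** At the contact point [v - w] has a maximum: the gradients agree, the pure second derivatives are
    ordered, and so are the jumps. The derivatives of [phi] exist only as partial derivatives, so
    the argument runs along coordinate lines. *)
Lemma levy_op_touch C w p H (N : set V) (phi : V -> R) x :
  C3 C w p H -> open N -> N x -> C2_closure N phi -> phi x = w x ->
  (forall y, N y -> phi y <= w y) ->
  (levy_op j (patch w N phi) x <= levy_op j w x)%E.
Proof.
move=> wC oN Nx [_ c1 c2] pw Nw; set v := patch w N phi.
have vx : v x = w x by rewrite /v patch_in.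
have vphi y : N y -> v y = phi y by move=> Ny; rewrite /v patch_in.
have phiv y : N y -> phi y = v y by move=> Ny; rewrite vphi.
have vw y : v y <= w y.
  have [Ny|Ny] := pselect (N y); first by rewrite vphi // Nw.
  by rewrite /v /patch memNset.
have pv i y : N y -> partial i phi y = partial i v y by move=> Ny; apply: (near_partial i oN Ny).
have dv i y : N y -> derivable v y (delta_mx ord0 i).
  by move=> Ny; apply: (near_derivable oN Ny phiv); have [h _] := c1 i; exact: h.
have dv2 i y : N y -> derivable (partial i v) y (delta_mx ord0 i).
  move=> Ny; apply: (near_derivable oN Ny (pv i)).
  by have [h _] := c2 i i; exact: h.
have key i : partial i v x = p i x /\ partial i (partial i v) x <= H i i x.
  have [r r0 rN] := open_line (delta_mx ord0 i) oN Nx.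
  pose F y := v y - w y.
  have dF y : N y -> is_derive y (delta_mx ord0 i : V) F (partial i v y - p i y).
    move=> Ny; apply: is_deriveB; last exact: C3_is_derive wC.
    by apply: DeriveDef => //; exact: dv.
  have DF y : N y -> 'D_(delta_mx ord0 i) F y = partial i v y - p i y.
    by move=> Ny; have [_ E] := dF y Ny.
  have d2F : is_derive x (delta_mx ord0 i : V) (fun y => 'D_(delta_mx ord0 i) F y)
      (partial i (partial i v) x - H i i x).
    have h : is_derive x (delta_mx ord0 i : V) (fun y => partial i v y - p i y)
       (partial i (partial i v) x - H i i x).
      apply: is_deriveB; last exact: C3_is_derive2 wC.
      by apply: DeriveDef => //; exact: dv2.
    have [h1 h2] := h; apply: DeriveDef.
      by apply: (near_derivable oN Nx _ h1) => y Ny; rewrite DF.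
    by rewrite -h2; apply: (near_partial i oN Nx) => y Ny; rewrite DF.
  have [|t tr|h1 h2] := max_derive2 r0 _ _ d2F.
  - by move=> t tr; rewrite /F vx subrr subr_le0.
  - by have [] := dF _ (rN t tr).
  - by move: h1; rewrite DF //; split; lra.
rewrite /levy_op; apply: leeD.
  by rewrite lee_fin (C3_laplacian x wC); apply: ler_sum => i _; have [] := key i.
apply: le_integral_nomeas => y.
have -> : edot y (grad v x) = edot y (grad w x).
  apply: eq_bigr => i _; congr (_ * _); rewrite !mxE (C3_partial i wC).
  by have [] := key i.
have [->|y0] := eqVneq y 0; last first.
  rewrite lee_fin ler_wpM2r //; first by case: j_levy => _ h _; exact: h.
  by rewrite lerD2r vx lerD2r.
by rewrite !addr0 !subrr !edot0l mulr0 !subr0.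
Qed.

Lemma viscosity_of_classical C w p H (D : set V) l :
  C3 C w p H -> open D -> (forall x, D x -> Lop j w p H x <= - l * w x) ->
  viscosity_supersolution j D w (fun x => - l * w x).
Proof.
move=> wC oD wL; have [bw _ _] := C3_BL wC; have cw := BL_continuous bw.
split.
- exact: BL_measurable.
- have [h _ _ _] := wC; exists C; split; first exact: num_real.
  by move=> M CM x _; rewrite /= (le_trans (h x)) // ltW.
- move=> x a ax; rewrite /= lte_fin in ax.
  have cs : {within closure D, continuous w} by exact: continuous_subspaceT.
  exists (w @^-1` [set t | a < t]); last by move=> y; rewrite /= lte_fin.
  by apply: (cs x); apply: open_nbhs_nbhs; split => //; exact: open_gt.
- move=> x N phi Dx oN Nx ND c2 pw Nw.
  apply: le_trans (levy_op_touch wC oN Nx c2 _ _) _.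
  + by apply/eqP; rewrite -subr_eq0 pw.
  + by move=> y /Nw; rewrite subr_le0.
  + by rewrite (levy_opE j_levy x wC) lee_fin wL.
Qed.

End viscosity.

(** * Comparison with a supersolution in the ball *)

Section comparison.
Context {R : realType} {d : nat}.
Local Notation V := 'rV[R]_d.
Variable j : V -> R.
Hypothesis j_levy : levy_density j.
Implicit Types (u v w : V -> R) (x y z : V) (C : R).

Lemma LopD C C' w p H v q G x : C3 C w p H -> C3 C' v q G ->
  Lop j (fun x => w x + v x) (fun i x => p i x + q i x) (fun i k x => H i k x + G i k x) x =
  Lop j w p H x + Lop j v q G x.
Proof.
move=> wC vC; rewrite /Lop big_split /= addrACA -LintD; [|exact: Lig_incr wC|exact: Lig_incr vC].
congr (_ + Lint _); apply/funext => y; rewrite /incr linD; ring.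
Qed.

Lemma LopZ a C w p H x : C3 C w p H ->
  Lop j (fun x => a * w x) (fun i x => a * p i x) (fun i k x => a * H i k x) x =
  a * Lop j w p H x.
Proof.
move=> wC; rewrite /Lop mulrDr mulr_sumr -LintZ; last exact: Lig_incr wC.
congr (_ + Lint _); apply/funext => y; rewrite /incr linZ; ring.
Qed.

Lemma Lop_cst a x : Lop j (fun=> a) (fun _ _ => 0) (fun _ _ _ => 0) x = 0.
Proof.
rewrite /Lop big1 // add0r (_ : (fun y => _) = (fun=> 0)) ?Lint0 //.
apply/funext => y; rewrite /incr subrr /lin big1 => [|i _]; last by rewrite mul0r.
by rewrite mulr0 subrr mul0r.
Qed.

(** Divided by the maximum of [w / v], the function [w] touches [v] from below, and the viscosity
    inequality applies there. Negativity of [w] from radius [r' < r] on places the contact in a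
    compact set where [v] is positive. *)
Lemma supersolution_compare lam v C w p H (r r' : R) x0 :
  (C_plus (eball r) `&` C_b_plus) v ->
  viscosity_supersolution j (eball r) v (fun x => - lam * v x) ->
  C3 C w p H -> r' < r -> (forall x, r' <= enorm x -> w x < 0) -> 0 < w x0 ->
  exists x, [/\ enorm x < r', 0 < w x & Lop j w p H x <= - lam * w x].
Proof.
move=> [[_ vpos] [cv _ v0]] [_ _ _ vsup] wC r'r wneg wx0.
have [bw _ _] := C3_BL wC; have cw := BL_continuous bw.
have wout x : 0 < w x -> enorm x < r'.
  by move=> wx; rewrite ltNge; apply/negP => /wneg; rewrite ltNge ltW.
pose K := [set x : V | enorm x <= r'].
have vK x : K x -> 0 < v x by move=> Kx; apply: vpos; exact: le_lt_trans r'r.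
have cq : {within K, continuous (fun x => w x / v x)}.
  apply: continuous_in_subspaceT => x; rewrite inE => /vK vx.
  apply: (@cvgM _ _ (nbhs x) _ w (fun x => (v x)^-1)); first exact: cw.
  by apply: cvgV; [rewrite gt_eqF|exact: cv].
have [|x Kx xmax] := EVT_max_rV _ (cball_compact (r := r')) cq.
  by exists x0; exact: ltW (wout _ wx0).
rewrite inE in Kx; have vx := vK _ Kx.
have wx : 0 < w x.
  have Kx0 : K x0 by exact: ltW (wout _ wx0).
  have := xmax x0; rewrite inE => /(_ Kx0); move=> /(lt_le_trans _) h.
  have : 0 < w x / v x by apply: h; rewrite divr_gt0 // vK.
  by rewrite pmulr_lgt0 // invr_gt0.
have xr := wout _ wx; exists x; split => //.
pose t := v x / w x; have t0 : 0 < t by rewrite divr_gt0.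
pose phi y := t * w y.
have phiC : C3 (`|t| * C) phi (fun i x => t * p i x) (fun i k x => t * H i k x) by exact: C3_Z.
have phi_le y : phi y <= v y.
  have [yK|yK] := leP (enorm y) r'.
    have := xmax y; rewrite inE => /(_ yK) h.
    rewrite ler_pdivrMr ?vK // in h; rewrite /phi (le_trans (ler_wpM2l (ltW t0) h)) //.
    by rewrite /t !mulrA divfK ?gt_eqF // divff ?gt_eqF // mul1r.
  apply: le_trans (v0 y); rewrite pmulr_rle0 // ltW // wneg // ltW //.
have phix : phi x = v x by rewrite /phi /t mulfVK // gt_eqF.
have := vsup x (eball r') phi; rewrite phix subrr.
move=> /(_ (lt_trans xr r'r) (eball_open (r := r')) xr) hv.
have {hv} hv : (levy_op j (patch v (eball r') phi) x <= (- lam * v x)%:E)%E.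
  apply: hv => //; first by move=> y /= yr; exact: lt_trans r'r.
    exact: C3_C2_closure phiC.
  by move=> y _; rewrite subr_le0.
(* Replacing the outer values [v] by the smaller [phi] lowers the jump term and leaves the
   derivatives at [x] unchanged. *)
have : (levy_op j phi x <= (- lam * v x)%:E)%E.
  apply: le_trans hv; set V' := patch _ _ _.
  have E y : eball r' y -> phi y = V' y by move=> yr; rewrite /V' patch_in.
  have oB := @eball_open R d r'.
  rewrite /levy_op.
  have -> : grad V' x = grad phi x.
    by apply/rowP => i; rewrite !mxE (near_partial i oB xr E).
  have -> : laplacian V' x = laplacian phi x.
    apply: eq_bigr => i _; apply/esym/(near_partial i oB xr) => y yr.
    exact: near_partial oB yr E.
  rewrite leeD2l //; apply: le_integral_nomeas => y.
  have [->|y0] := eqVneq y 0; last first.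
    rewrite lee_fin ler_wpM2r //; first by case: j_levy => _ h _; exact: h.
    rewrite lerD2r -(E x xr) lerD2r /V' /patch; case: ifP => // _; exact: phi_le.
  by rewrite !addr0 !subrr.
rewrite (levy_opE j_levy x phiC) lee_fin (LopZ _ _ wC) => hL.
rewrite -(ler_pM2l t0) (le_trans hL) // -phix /phi; lra.
Qed.

(** The tangent inequality of a convex function. In the induction the two sides differ by
    [n.+1%:R * a ^+ n * (B - a) ^+ 2]. *)
Lemma ppow_convex n (a b : R) : 0 <= a ->
  ppow n.+1 a + n.+1%:R * ppow n a * (b - a) <= ppow n.+1 b.
Proof.
move=> a0; have E m : ppow m a = a ^+ m by rewrite /ppow max_r.
rewrite !E /ppow; set B := Num.max 0 b.
have B0 : 0 <= B by rewrite le_max lexx.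
have bB : b <= B by rewrite le_max lexx orbT.
apply: (@le_trans _ _ (a ^+ n.+1 + n.+1%:R * a ^+ n * (B - a))).
  by rewrite lerD2l ler_wpM2l ?lerD2r // mulr_ge0 ?exprn_ge0.
elim: n => [|n IH]; first by rewrite expr0 !expr1; lra.
rewrite (exprS B); apply: le_trans (ler_wpM2l B0 IH).
rewrite -subr_ge0.
have -> : B * (a ^+ n.+1 + n.+1%:R * a ^+ n * (B - a)) -
    (a ^+ n.+2 + n.+2%:R * a ^+ n.+1 * (B - a)) = n.+1%:R * a ^+ n * (B - a) ^+ 2.
  by rewrite -(natr1 n.+1) !exprS; ring.
by rewrite mulr_ge0 ?sqr_ge0 // mulr_ge0 ?exprn_ge0.
Qed.

(** In the unit ball convexity leaves only the term [- enorm y ^+ 2] of the argument of [ppow];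
    outside, the bump is nonnegative. *)
Lemma incr_bump_ge n (q : R) x y : enorm x ^+ 2 <= q ->
  - (n.+3%:R * ppow n.+2 (q - enorm x ^+ 2) + ppow n.+3 (q - enorm x ^+ 2)) * cut y <=
  incr (bump n.+3 q) (bump_grad n.+3 q) x y.
Proof.
move=> xq; rewrite /incr lin_bump /bump /=.
set a := q - enorm x ^+ 2; have a0 : 0 <= a by rewrite subr_ge0.
have p2 : 0 <= ppow n.+2 a := ppow_ge0 _ _.
have p3 : 0 <= ppow n.+3 a := ppow_ge0 _ _.
have [y1|y1] := leP (enorm y) 1.
  rewrite cut_in // mul1r.
  have := ppow_convex n.+2 (q - enorm (x + y) ^+ 2) a0.
  have -> : q - enorm (x + y) ^+ 2 - a = - 2 * edot x y - enorm y ^+ 2.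
    by rewrite /a !sqr_enorm !edotE (edotC y x); ring.
  have : 0 <= ppow n.+3 a * enorm y ^+ 2 by rewrite mulr_ge0 // exprn_ge0 ?enorm_ge0.
  lra.
rewrite cut_out ?(ltW y1) // mul0r.
have := ppow_ge0 n.+3 (q - enorm (x + y) ^+ 2).
have : 0 <= n.+3%:R * ppow n.+2 a by rewrite mulr_ge0.
lra.
Qed.

(** The Laplacian contains a positive term of order [N ^+ 2], proportional to [enorm x ^+ 2], while
    all the other terms are of order at most [N]. Hence a large exponent, and the exclusion of a
    ball around the origin. *)
Lemma bump_barrier (L rho r : R) : 0 < rho -> 0 <= L -> exists n, forall x,
  rho <= enorm x -> enorm x ^+ 2 < r ->
  L * bump n.+3 r x <= Lop j (bump n.+3 r) (bump_grad n.+3 r) (bump_hess n.+3 r) x.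
Proof.
move=> rho0 L0; pose J := Lint (fun y => cut y * j0 j y).
have J0 : 0 <= J by apply: Lint_ge0 => y; rewrite mulr_ge0 ?cut_ge0 ?j0_ge0.
pose B := (2 * d%:R * r + r * J + r ^+ 2 * J + L * r ^+ 2) / (4 * rho ^+ 2).
have [n nB] : exists n : nat, B <= n%:R.
  by exists (Num.truncn B).+1; exact/ltW/truncnS_gt.
exists n => x rx xr; have r0 : 0 < r by apply: le_lt_trans xr; rewrite exprn_ge0 ?enorm_ge0.
have [C bC] := @C3_bump R d n r (ltW r0).
set q := r - enorm x ^+ 2; have q0 : 0 < q by rewrite subr_gt0.
have qr : q <= r by rewrite /q gerBl exprn_ge0 ?enorm_ge0.
have P m : ppow m q = q ^+ m by rewrite /ppow max_r // ltW.
set N : R := n.+3%:R.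
have I : - (N * q ^+ n.+2 + q ^+ n.+3) * J <=
    Lint (fun y => incr (bump n.+3 r) (bump_grad n.+3 r) x y * j0 j y).
  have Ic := Lig_cut_j0 j_levy; rewrite /J -LintZ //.
  apply: Lint_le; [exact: LigZ|exact: Lig_incr bC|move=> y].
  rewrite mulrA ler_wpM2r ?j0_ge0 //.
  by have := @incr_bump_ge n r x y (ltW xr); rewrite -/q !P.
have S : \sum_i bump_hess n.+3 r i i x =
    N * (N - 1) * q ^+ n.+1 * (4 * enorm x ^+ 2) - 2 * d%:R * N * q ^+ n.+2.
  rewrite /bump_hess -/q !P sumrB; congr (_ - _).
    rewrite sqr_enorm /edot !mulr_sumr; apply: eq_bigr => i _ /=.
    by rewrite natrM /N -(natr1 n.+2) -/N; ring.
  under eq_bigr do rewrite eqxx mulr1.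
  by rewrite sumr_const card_ord -[LHS]mulr_natl /N /=; ring.
rewrite /Lop S /bump -/q P.
apply: le_trans (lerD (lexx _) I).
rewrite -subr_ge0.
have -> : N * (N - 1) * q ^+ n.+1 * (4 * enorm x ^+ 2) - 2 * d%:R * N * q ^+ n.+2 +
   - (N * q ^+ n.+2 + q ^+ n.+3) * J - L * q ^+ n.+3 =
   q ^+ n.+1 * (N * ((N - 1) * (4 * enorm x ^+ 2) - 2 * d%:R * q - q * J) -
     q ^+ 2 * J - L * q ^+ 2).
  by rewrite !exprS; ring.
apply: mulr_ge0; first by rewrite exprn_ge0 // ltW.
have N1 : 1 <= N by rewrite /N ler1n.
have NB : B <= N - 1.
  by rewrite /N -(natr1 n.+2) addrK (le_trans nB) // ler_nat; apply: leqW; apply: leqW.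
have x2 : rho ^+ 2 <= enorm x ^+ 2 by rewrite lerXn2r ?nnegrE ?(ltW rho0) ?enorm_ge0.
have rho2 : 0 < 4 * rho ^+ 2 by rewrite mulr_gt0 // exprn_gt0.
have h1 : 2 * d%:R * r + r * J + r ^+ 2 * J + L * r ^+ 2 <= (N - 1) * (4 * rho ^+ 2).
  by rewrite -ler_pdivrMr.
have h2 : (N - 1) * (4 * rho ^+ 2) <= (N - 1) * (4 * enorm x ^+ 2).
  by rewrite ler_wpM2l ?subr_ge0 //; lra.
have h3 : d%:R * q <= d%:R * r by rewrite ler_wpM2l.
have h4 : q * J <= r * J by rewrite ler_wpM2r.
have q2 : q ^+ 2 <= r ^+ 2 by rewrite lerXn2r ?nnegrE ?(ltW q0) ?(ltW r0).
have h5 : q ^+ 2 * J <= r ^+ 2 * J by rewrite ler_wpM2r.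
have h6 : L * q ^+ 2 <= L * r ^+ 2 by rewrite ler_wpM2l.
have h7 : 0 <= r ^+ 2 * J + L * r ^+ 2 by rewrite addr_ge0 // mulr_ge0 // exprn_ge0 // ltW.
have h8 : r ^+ 2 * J + L * r ^+ 2 <= N * (r ^+ 2 * J + L * r ^+ 2) by rewrite ler_peMl.
have h9 : N * (r ^+ 2 * J + L * r ^+ 2) <= N * ((N - 1) * (4 * enorm x ^+ 2) - 2 * d%:R * q - q * J).
  by rewrite ler_wpM2l ?(le_trans ler01) //; lra.
lra.
Qed.

End comparison.

(** * Bounds near the centre, far away and near the sphere *)

Section barriers.
Context {R : realType} {d : nat}.
Local Notation V := 'rV[R]_d.
Variables (j : V -> R) (i0 : 'I_d).
Hypotheses (j_levy : levy_density j) (j_radial : radially_decreasing j).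
Implicit Types (u v w : V -> R) (p q : 'I_d -> V -> R) (H G : 'I_d -> 'I_d -> V -> R).
Implicit Types (x y z : V) (C : R).

Definition jmass := Lint (fun y => cut y * j0 j y).

Lemma jmass_ge0 : 0 <= jmass.
Proof. by apply: Lint_ge0 => y; rewrite mulr_ge0 ?cut_ge0 ?j0_ge0. Qed.

Lemma Lop_bound C w p H x : C3 C w p H ->
  `|Lop j w p H x| <= C * (d%:R + (3 + d%:R ^+ 2) * jmass).
Proof.
move=> wC; have Ic := Lig_cut_j0 j_levy.
rewrite mulrDr (le_trans (ler_normD _ _)) // lerD //.
  rewrite (le_trans (ler_norm_sum _ _ _)) // (le_trans (_ : _ <= \sum_(i < d) C)) //.
    by apply: ler_sum => i _; have [_ _ _ h] := wC; exact: (h i i x).1.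
  by rewrite sumr_const card_ord -[leLHS]mulr_natl mulrC.
rewrite mulrA -LintZ //; apply: Lint_abs; [exact: Lig_incr wC|exact: LigZ|move=> y].
by rewrite normrM mulrA (ger0_norm (j0_ge0 j_levy y)) ler_wpM2r ?j0_ge0 // (incr_le x y wC).
Qed.

Lemma Lop_touch C w p H C' v q G x : C3 C w p H -> C3 C' v q G ->
  (forall y, w y - w x <= v y - v x) -> Lop j w p H x <= Lop j v q G x.
Proof.
move=> wC vC wv; pose phi y := w y + (v x - w x).
have pC := C3_D wC (C3_cst (v x - w x)).
have := levy_op_touch j_levy (N := setT) (phi := phi) (x := x) vC openT I (C3_C2_closure _ pC).
have -> : patch v setT phi = phi by apply/funext => y; rewrite patch_in.
rewrite (levy_opE j_levy x pC) (levy_opE j_levy x vC) lee_fin (LopD _ _ wC (C3_cst _)) //.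
rewrite Lop_cst addr0; apply; first by rewrite /phi; lra.
by move=> y _; rewrite /phi; have := wv y; lra.
Qed.

Lemma lin_delta p x i (t : R) : lin p x (t *: delta_mx ord0 i) = t * p i x.
Proof.
rewrite /lin (bigD1 i) //= big1 => [|k ki]; last by rewrite !mxE (negbTE ki) !mulr0.
by rewrite !mxE !eqxx mulr1 addr0 mulrC.
Qed.

Lemma quad_delta H x i (t : R) : quad H x (t *: delta_mx ord0 i) = t ^+ 2 * H i i x.
Proof.
rewrite quad_lin (bigD1 i) //= big1 => [|k ki]; last by rewrite !mxE (negbTE ki) !(mulr0, mul0r).
by rewrite lin_delta !mxE !eqxx mulr1 addr0 mulrA.
Qed.

Lemma expansion_le0 (A B M r : R) : 0 < r ->
  (forall t, `|t| < r -> t * A + t ^+ 2 * B <= M * `|t| ^+ 3) -> A = 0 /\ B <= 0.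
Proof.
move=> r0 h; pose N := `|M| + `|B| + 1.
have N0 : 0 < N by rewrite /N ltr_wpDl // addr_ge0.
have small e : 0 < e -> exists2 t : R, 0 < t <= 1 & t < r /\ t * N <= e.
  move=> e0; exists (Num.min (Num.min 1 (r / 2)) (e / N)).
    by rewrite !lt_min !ge_min lexx /= ltr01 !divr_gt0.
  split; first by rewrite !gt_min (_ : r / 2 < r) ?orbT //; lra.
  by rewrite -ler_pdivlMr // ge_min lexx orbT.
have MM := ler_norm M; have BB := ler_norm (- B); rewrite normrN in BB.
have b0 := normr_ge0 B; have m0 := normr_ge0 M.
have A0 (s : R) : `|s| = 1 -> s * A <= 0.
  move=> s1; apply/ler_addgt0Pr => e /small[t /andP[t0 t1] [tr te]]; rewrite add0r.
  have tt : `|s * t| = t by rewrite normrM s1 mul1r gtr0_norm.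
  have := h (s * t); rewrite tt => /(_ tr).
  have -> : (s * t) ^+ 2 = t ^+ 2 by rewrite -[LHS]real_normK ?num_real // tt.
  rewrite mulrAC (mulrC (s * A)) => h'.
  rewrite -(ler_pM2l t0); apply: le_trans (_ : t * (t * N) <= _); last by rewrite ler_pM2l.
  have t2 : 0 <= t ^+ 2 by rewrite exprn_ge0 // ltW.
  have h1 : t ^+ 2 * - B <= t ^+ 2 * `|B| by rewrite ler_wpM2l.
  have h2 : M * t ^+ 3 <= `|M| * t ^+ 2.
    rewrite (le_trans (_ : _ <= `|M| * t ^+ 3)) ?ler_wpM2r ?exprn_ge0 ?(ltW t0) //.
    by rewrite ler_wpM2l // (exprS _ 2) ler_piMl.
  rewrite /N; lra.
split.
  have := A0 1; have := A0 (-1); rewrite normrN normr1 mulN1r mul1r => /(_ erefl) + /(_ erefl).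
  lra.
apply/ler_addgt0Pr => e /small[t /andP[t0 t1] [tr te]]; rewrite add0r.
have := h t; have := h (- t); rewrite normrN gtr0_norm // sqrrN mulNr => /(_ tr) h1 /(_ tr) h2.
have t2 : 0 < t ^+ 2 by rewrite exprn_gt0.
rewrite -(ler_pM2l t2) (le_trans (_ : _ <= M * t ^+ 3)) //; first by lra.
have h3 : M * t ^+ 3 <= t ^+ 2 * (t * `|M|).
  by have := ler_wpM2r (exprn_ge0 3 (ltW t0)) MM; rewrite !exprS; lra.
apply: le_trans h3 _; rewrite ler_pM2l //; apply: le_trans te.
by rewrite ler_wpM2l ?(ltW t0) // /N; lra.
Qed.

(** The function touching [w] from above is given by an expansion along one coordinate only; this
    suits the square root of [boundary_bound], which is not in the class [C3]. *)
Lemma touch_expansion C w p H x i (z a M r : R) : C3 C w p H -> 0 < r ->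
  (forall t, `|t| < r -> w (x + t *: delta_mx ord0 i) - w x <=
     z * t + 2^-1 * (a * t ^+ 2) + M * `|t| ^+ 3) ->
  p i x = z /\ H i i x <= a.
Proof.
move=> wC r0 h; have [_ h1 _ _] := wC.
have [||A B] := @expansion_le0 (p i x - z) (2^-1 * (H i i x - a)) (M + C) (Num.min r 1).
- by rewrite lt_min r0 ltr01.
- move=> t; rewrite lt_min => /andP[tr t1].
  have := h t tr; have := h1 x (t *: delta_mx ord0 i).
  rewrite enormZ enorm_delta mulr1 lin_delta quad_delta => /(_ (ltW t1)).
  rewrite ler_norml; lra.
by split; lra.
Qed.

(** Averaging the jump [y] with its mirror image in the coordinate [i0] cancels the drift, and [cos
    (a + b) + cos (a - b) = 2 cos a cos b <= 2 cos a] makes the jump term nonpositive. *)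
Lemma Lop_cos_le k x : 0 <= cos (k * x ord0 i0) ->
  Lop j (fun x => cos (k * x ord0 i0))
    (fun i x => (i == i0)%:R * (- k * sin (k * x ord0 i0)))
    (fun i l x => ((i == i0) && (l == i0))%:R * (- k ^+ 2 * cos (k * x ord0 i0))) x <=
  - k ^+ 2 * cos (k * x ord0 i0).
Proof.
move=> c0; have [C wC] := @C3_cos R d i0 k.
rewrite /Lop (bigD1 i0) //= big1 => [|i ii]; last by rewrite (negbTE ii) mul0r.
rewrite eqxx mul1r addr0 gerDl.
set f := fun y => _; have If : Lig f := Lig_incr j_levy x wC.
have e1 := @edot_delta1 R d i0.
have : Lint f + Lint (fun y => f (reflect (delta_mx ord0 i0) 0 y)) <= 0.
  rewrite -LintD //; last exact: Lig_reflect.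
  rewrite -oppr_ge0 -LintN; last by apply: LigD => //; exact: Lig_reflect.
  apply: Lint_ge0 => y; rewrite oppr_ge0 /f.
  have ny := enorm_reflect0 y e1.
  rewrite (j0_sym j_radial ny) -mulrDl mulr_le0_ge0 ?j0_ge0 //.
  rewrite /incr ny !mxE.
  have linE z : lin (fun i x => (i == i0)%:R * (- k * sin (k * x ord0 i0))) x z =
      - k * sin (k * x ord0 i0) * z ord0 i0.
    rewrite /lin (bigD1 i0) //= big1 => [|l ll]; last by rewrite (negbTE ll) !mul0r.
    by rewrite eqxx mul1r addr0.
  rewrite !linE -/(reflect _ _ _) reflect_delta eqxx.
  have -> : edot y (delta_mx ord0 i0) = y ord0 i0 by rewrite edot_delta.
  rewrite eqxx subr0 mulr1.
  have -> : x ord0 i0 + (y ord0 i0 - 2 * y ord0 i0) = x ord0 i0 - y ord0 i0 by ring.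
  rewrite mulrDr mulrBr cosD cosB.
  have := cos_le1 (k * y ord0 i0); have := ler_wpM2l c0 (cos_le1 (k * y ord0 i0)).
  lra.
rewrite Lint_reflect //; last exact: Lig_measurable.
lra.
Qed.

End barriers.

Section radial_barriers.
Context {R : realType} {d : nat}.
Local Notation V := 'rV[R]_d.
Variables (j : V -> R) (i0 : 'I_d).
Hypotheses (j_levy : levy_density j) (j_radial : radially_decreasing j).
Implicit Types (u v w : V -> R) (p q : 'I_d -> V -> R) (H G : 'I_d -> 'I_d -> V -> R).
Implicit Types (x y z : V) (C : R).

Definition approximates C e m h (k : V -> R) :=
  [/\ 0 < h <= e, h * m <= 1, rkernel k, Lint k = 1 - h * m &
    forall w p H, C3 C w p H -> forall x,
      `|(conv k w x - (1 - h * m) * w x) / h - Lop j w p H x| <= e].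

Lemma cos_ge_half (t : R) : `|t| <= 2^-1 -> 2^-1 <= cos t.
Proof.
move=> t1; have := cos_sub1_le t.
have : `|t| ^+ 2 <= 2^-1 ^+ 2 by rewrite lerXn2r ?nnegrE.
rewrite ler_norml; lra.
Qed.

(* Otherwise [u - cos (s x_i0) / 8] would have a maximum in the ball of radius
   [rho], where [L cos (s x_i0) <= - s ^ 2 / 2]. *)
Lemma center_bound K : 0 <= K -> exists rho C, [/\ 0 < rho, 0 <= C &
  forall e m h k, e < 1 -> approximates C e m h k ->
  forall u, BL u -> rdecr u -> u 0 = 1 ->
  (forall x, - (h * K) <= conv k u x - (1 - h * m) * u x) ->
  forall x, enorm x <= rho -> 3 / 4 <= u x].
Proof.
(* In the ball of radius [(2 * s)^-1] the cosine is at least 1/2, so [cos (s x_i0) / 8] has [Lop] at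
   most [- s ^+ 2 / 16 <= - (K + 1)]. The spare unit absorbs the error [e < 1]. *)
move=> K0; pose s := 4 * (K + 1); have s0 : 0 < s by rewrite mulr_gt0 // ltr_wpDl.
have [C0 wC] := @C3_cos R d i0 s; have fC := C3_Z 8^-1 wC.
set C := `|8^-1| * C0 in fC.
exists (2 * s)^-1, C; split; [by rewrite invr_gt0 mulr_gt0|exact: C3_ge0 fC|].
move=> e m h k e1 [/andP[h0 he] hm [Ik k0 _] kE happ] u bu ru u1 uL x1 x1r.
rewrite leNgt; apply/negP => ux1.
pose phi x := 8^-1 * cos (s * x ord0 i0); pose g x := u x - phi x.
have [bphi _ _] := C3_BL fC; have bg : BL g by exact: BL_B.
have phi1 x : `|phi x| <= 8^-1.
  rewrite /phi ler_norml; have := cos_le1 (s * x ord0 i0); have := cos_geN1 (s * x ord0 i0); lra.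
have cg : {within [set x : V | enorm x <= (2 * s)^-1], continuous g}.
  exact/continuous_subspaceT/BL_continuous.
have [|x xr xmax] := EVT_max_rV _ (cball_compact (r := (2 * s)^-1)) cg.
  by exists x1.
rewrite inE in xr.
have g0 : 7 / 8 <= g x.
  have := xmax 0; rewrite inE /= enorm0 invr_ge0 (mulr_ge0 _ (ltW s0)) // => /(_ erefl).
  rewrite {1}/g /phi u1 mxE mulr0 cos0; lra.
(* Outside the ball [u <= u x1 < 3 / 4], hence [g] is below [7 / 8 = g 0]. *)
have gmax y : g y <= g x.
  have [yr|yr] := leP (enorm y) (2 * s)^-1; first by apply: xmax; rewrite inE.
  have := ru x1 y (le_trans x1r (ltW yr)); have := phi1 y; rewrite ler_norml /g in g0 *; lra.
have := @conv_le _ _ k g (fun=> g x) x Ik k0 bg (BL_cst _) gmax.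
rewrite conv_cst // kE (convB _ Ik bu bphi) -/phi /g => h1.
have := uL x; have := happ _ _ _ fC x; rewrite -/phi (LopZ j_levy _ _ wC).
set P := conv k phi x in h1 *; set Q := Lop _ _ _ _ _ => hQ hu.
have hc : 2^-1 <= cos (s * x ord0 i0).
  apply: cos_ge_half; rewrite normrM (gtr0_norm s0).
  apply: le_trans (_ : s * (2 * s)^-1 <= _).
    by rewrite ler_pM2l // (le_trans (coord_le_enorm x i0)).
  by rewrite invfM mulrCA divff ?gt_eqF // mulr1.
have hQ1 : Q <= - s ^+ 2 * cos (s * x ord0 i0).
  by apply: Lop_cos_le => //; apply: le_trans hc.
have s2 : 16 * (K + 1) <= s ^+ 2.
  rewrite /s exprMn; have -> : 4 ^+ 2 = 16 :> R by ring.
  by rewrite ler_pM2l // expr2 ler_peMr ?lerDr // addr_ge0.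
have h2 : s ^+ 2 * 2^-1 <= s ^+ 2 * cos (s * x ord0 i0) by rewrite ler_wpM2l // exprn_ge0 // ltW.
have h3 : (P - (1 - h * m) * phi x) / h < - K.
  have hK : 8^-1 * Q <= - (K + 1).
    by move: hQ1 s2 h2; rewrite mulNr; set S := s ^+ 2; set T := S * cos _; clearbody S T; lra.
  by move: hQ; rewrite ler_norml => /andP[_]; rewrite lerBlDr => /le_lt_trans; apply; lra.
rewrite ltr_pdivrMr // in h3; lra.
Qed.

(** The barrier [g] is at least 2 within radius [R1] and 0 beyond [R2]. As [w <= 1], a positive
    maximum of [w - g] lies outside the ball of radius [R1]; there [Lop w <= Lop g] is bounded, and
    the hypothesis forces [m * w <= C]. *)
Lemma far_bound R1 R2 : 0 <= R1 -> R1 < R2 -> exists C, 0 <= C /\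
  forall C' w p H m, C3 C' w p H -> rdecr w -> (forall x, 0 <= w x <= 1) -> 0 < m ->
  (forall x, R1 <= enorm x -> m * w x - 1 <= Lop j w p H x) ->
  forall x, R2 <= enorm x -> w x <= C / m.
Proof.
move=> R10 R12; pose q := R2 ^+ 2.
have R20 : 0 < R2 by exact: le_lt_trans R12.
have R122 : R1 ^+ 2 < R2 ^+ 2 by rewrite ltrXn2r ?nnegrE ?(ltW R20).
have [C0 gC0] := @C3_bump R d 0 q (ltW (exprn_gt0 2 R20)).
pose a := 2 / (q - R1 ^+ 2) ^+ 3; have a0 : 0 < a by rewrite divr_gt0 // exprn_gt0 // subr_gt0.
have gC := C3_Z a gC0; set Cg := _ * C0 in gC; pose g x := a * bump 3 q x.
pose C := 1 + Cg * (d%:R + (3 + d%:R ^+ 2) * jmass j).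
have Cg0 := C3_ge0 gC.
exists C; split.
  by rewrite addr_ge0 // mulr_ge0 // addr_ge0 // mulr_ge0 ?jmass_ge0 // addr_ge0 ?exprn_ge0.
move=> C' w p H m wC rw w01 m0 hL.
have g0 x : 0 <= g x by rewrite mulr_ge0 ?(ltW a0) // ppow_ge0.
have gout x : R2 <= enorm x -> g x = 0.
  by move=> h; rewrite /g bump_out ?mulr0 // lerXn2r ?nnegrE ?(ltW R20) ?enorm_ge0.
have gin x : enorm x <= R1 -> 2 <= g x.
  move=> h; have h2 : enorm x ^+ 2 <= R1 ^+ 2 by rewrite lerXn2r ?nnegrE ?enorm_ge0.
  rewrite /g /a mulrAC ler_pdivlMr ?exprn_gt0 ?subr_gt0 // ler_pM2l //.
  rewrite /bump /ppow max_r; last by rewrite subr_ge0 (le_trans h2) // ltW.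
  by rewrite lerXn2r ?nnegrE ?subr_ge0 ?(le_trans h2) ?(ltW R122) // lerB.
pose x2 : V := R2 *: delta_mx ord0 i0.
have nx2 : enorm x2 = R2 by rewrite enormZ enorm_delta mulr1 gtr0_norm.
suff h : w x2 <= C / m by move=> x xR; apply: le_trans h; apply: rw; rewrite nx2.
rewrite leNgt; apply/negP => wx2.
have C0' : 0 <= C.
  by rewrite addr_ge0 // mulr_ge0 // addr_ge0 // mulr_ge0 ?jmass_ge0 // addr_ge0 ?exprn_ge0.
have wx20 : 0 < w x2 by apply: le_lt_trans wx2; rewrite divr_ge0 // ltW.
pose f x := w x - g x; have [bw _ _] := C3_BL wC; have [bg _ _] := C3_BL gC.
have cf : {within [set x : V | enorm x <= R2], continuous f}.
  by apply/continuous_subspaceT/BL_continuous; exact: BL_B.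
have [|x xr xmax] := EVT_max_rV _ (cball_compact (r := R2)) cf.
  by exists x2 => /=; rewrite nx2.
have fx : w x2 <= f x.
  by have := xmax x2; rewrite inE /= nx2 lexx => /(_ erefl); rewrite {1}/f gout ?nx2 // subr0.
have fmax y : f y <= f x.
  have [yr|yr] := leP (enorm y) R2; first by apply: xmax; rewrite inE.
  apply: le_trans fx; rewrite /f gout ?(ltW yr) // subr0; apply: rw; rewrite nx2 ltW //.
have xR1 : R1 <= enorm x.
  rewrite leNgt; apply/negP => /ltW/gin; have /andP[_ w1] := w01 x.
  by move: fx wx20; rewrite /f; lra.
have := hL x xR1.
have hT' : Lop j w p H x <= Cg * (d%:R + (3 + d%:R ^+ 2) * jmass j).
  apply: le_trans (Lop_touch j_levy wC gC (x := x) _) _.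
    by move=> y; have := fmax y; rewrite /f /g; lra.
  by apply: le_trans (Lop_bound j_levy x gC); exact: ler_norm.
move: wx2; rewrite ltr_pdivrMr // mulrC => wx2.
have : m * w x2 <= m * w x.
  by rewrite ler_pM2l // (le_trans fx) // /f gerBl.
by rewrite /C in wx2; lra.
Qed.

End radial_barriers.

Section boundary_layer.
Context {R : realType} {d : nat}.
Local Notation V := 'rV[R]_d.
Variables (j : V -> R) (i0 : 'I_d).
Hypotheses (j_levy : levy_density j) (j_radial : radially_decreasing j).
Implicit Types (u v w : V -> R) (p q : 'I_d -> V -> R) (H G : 'I_d -> 'I_d -> V -> R).
Implicit Types (x y z : V) (C : R).

Lemma Lig_small_jumps rho : Lig (fun y => \1_(eball rho) y * (cut y * j0 j y)).
Proof.
apply: (@LigM _ _ _ _ 1); last exact: Lig_cut_j0.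
  by apply: measurable_indic; exact: measurable_eball.
by move=> y; rewrite indicE; case: (_ \in _); rewrite ?normr1 ?normr0.
Qed.

(** The part of the density above a level [n] is handled by [jtail_small]; below that level the
    density is at most [n], and [cut] is at most [rho] in the ball. *)
Lemma small_jumps (e : R) : 0 < e -> exists rho : R, [/\ 0 < rho, rho <= 1 &
  Lint (fun y => \1_(eball rho) y * (cut y * j0 j y)) <= e].
Proof.
move=> e0; have e2 : 0 < e / 2 by rewrite divr_gt0.
have [n nE] := jtail_small j_levy e2.
pose B := Lint (\1_(eball 1) : V -> R); have B0 : 0 < B by exact: Lint_eball_gt0.
pose T := n%:R * B + 1; have T0 : 0 < T by rewrite ltr_wpDl // mulr_ge0 // ltW.
pose rho := Num.min 1 (e / (2 * T)); exists rho.
have rho0 : 0 < rho by rewrite lt_min ltr01 divr_gt0 // mulr_gt0.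
have rho1 : rho <= 1 by rewrite ge_min lexx.
split => //.
have I1 := Lig_eball 1 : Lig (\1_(eball 1) : V -> R); have I2 := Lig_jtail j_levy n.
apply: le_trans (_ : Lint (fun y => jtail j n y + rho * n%:R * \1_(eball 1) y) <= _).
  apply: Lint_le; [exact: Lig_small_jumps|by apply: LigD => //; exact: LigZ|move=> y].
  rewrite !indicE !in_eball.
  have t0 : 0 <= jtail j n y by exact: jtail_ge0.
  have c0 := cut_ge0 y.
  have [yr|yr] := ltP (enorm y) rho; last first.
    by rewrite mul0r addr_ge0 // !mulr_ge0 // ltW.
  rewrite (lt_le_trans yr rho1) mul1r mulr1 /jtail mulrBr.
  have yy : cut y <= rho.
    rewrite cut_in; last by rewrite ltW // (lt_le_trans yr).
    by rewrite (le_trans _ (ltW yr)) // expr2 ler_piMl ?enorm_ge0 // ltW // (lt_le_trans yr).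
  have : cut y * Num.min (j0 j y) n%:R <= rho * n%:R.
    apply: ler_pM => //; first by rewrite le_min ler0n (j0_ge0 j_levy).
    by rewrite ge_min lexx orbT.
  lra.
rewrite LintD //; last exact: LigZ.
rewrite LintZ // -/B [leRHS]splitr lerD //.
have : rho <= e / (2 * T) by rewrite ge_min lexx orbT.
rewrite ler_pdivlMr ?mulr_gt0 // => h.
have : 0 <= rho by exact: ltW.
by rewrite /T in h; lra.
Qed.

(** The quadratic bound serves the jumps shorter than [rho], the linear one the longer ones. For
    [u > 1] the square root is 0 by convention. *)
Lemma sqrt1B_le (u : R) : Num.sqrt (1 - u) - 1 + u / 2 <= Num.min (u ^+ 2 / 2) (`|u| / 2).
Proof.
have [u1|u1] := leP u 1.
  apply: (@le_trans _ _ 0); last by rewrite le_min !divr_ge0 ?sqr_ge0.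
  have : Num.sqrt (1 - u) <= 1 - u / 2.
    rewrite -(@ler_pXn2r _ 2) ?nnegrE ?sqrtr_ge0 //; last by lra.
    by rewrite sqr_sqrtr ?subr_ge0 //; have := sqr_ge0 u; lra.
  lra.
rewrite ler0_sqrtr; last by lra.
rewrite le_min gtr0_norm; last by lra.
have := sqr_ge0 (u - 1); lra.
Qed.

Lemma sqrt1B_taylor (u : R) : `|u| <= 1 ->
  Num.sqrt (1 - u) <= 1 - u / 2 - u ^+ 2 / 8 + `|u| ^+ 3.
Proof.
move=> u1; have a0 := normr_ge0 u.
have [l1 l2] : - `|u| <= u /\ u <= `|u| by split; [exact: lerNnormlW|exact: ler_norm].
have u2 : u ^+ 2 = `|u| ^+ 2 by rewrite real_normK ?num_real.
have a2 : `|u| ^+ 2 <= 1 by rewrite exprn_ile1.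
have a3 : 0 <= `|u| ^+ 3 by rewrite exprn_ge0.
pose c := 1 - u / 2 - u ^+ 2 / 8; have c0 : 3 / 8 <= c by rewrite /c; lra.
rewrite -/c -(@ler_pXn2r _ 2) ?nnegrE ?sqrtr_ge0 //; last by lra.
rewrite sqr_sqrtr; last by lra.
have -> : (c + `|u| ^+ 3) ^+ 2 = c ^+ 2 + 2 * c * `|u| ^+ 3 + (`|u| ^+ 3) ^+ 2 by ring.
have -> : c ^+ 2 = 1 - u + u * u ^+ 2 / 8 + (u ^+ 2) ^+ 2 / 64 by rewrite /c; field.
have := sqr_ge0 (u ^+ 2); have := sqr_ge0 (`|u| ^+ 3).
have : - `|u| ^+ 3 <= u * u ^+ 2.
  by rewrite u2 exprS -mulNr ler_wpM2r ?exprn_ge0.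
have : 3 / 8 * `|u| ^+ 3 <= c * `|u| ^+ 3 by rewrite ler_wpM2r.
lra.
Qed.

(* The comparison function is the square root of [(r - x_i0) / s0]: near the
   boundary its concavity, of order [s^(- 3 / 2)], beats the contribution of the
   jumps. *)
Lemma boundary_bound K : 0 <= K -> exists s0, 0 < s0 /\
  forall C w p H r nu, C3 C w p H -> rdecr w -> (forall x, 0 <= w x <= 1) -> 0 <= nu ->
  (forall x, - K <= Lop j w p H x) -> (forall x, r <= enorm x -> w x <= nu) ->
  forall x, enorm x < r -> r - enorm x < s0 -> w x <= nu + Num.sqrt ((r - enorm x) / s0).
Proof.
move=> K0; have [|rho [rho0 rho1 rhoj]] := @small_jumps (1 / 4); first by rewrite divr_gt0.
pose J := jmass j; have J0 : 0 <= J by exact: jmass_ge0.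
pose Z := J + K + 1; have Z1 : 1 <= Z by rewrite /Z; lra.
pose s0 := rho / (8 * Z); have s00 : 0 < s0 by rewrite divr_gt0 // mulr_gt0 //; lra.
exists s0; split => // C w p H r nu wC rw w01 nu0 wK wr x0 x0r x0s.
rewrite leNgt; apply/negP => wx0.
have r0 : 0 < r by apply: le_lt_trans x0r; exact: enorm_ge0.
(* The half-space [x_i0 < r] stands in for the ball: [B] depends on one coordinate and is 0 beyond
   it, as [Num.sqrt] of a negative number. Radial monotonicity moves the point [x0] to the axis. *)
pose B x := Num.sqrt ((r - x ord0 i0) / s0); pose F x := w x - B x.
pose x1 : V := enorm x0 *: delta_mx ord0 i0.
have nx1 : enorm x1 = enorm x0 by rewrite enormZ enorm_delta mulr1 ger0_norm ?enorm_ge0.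
have Fx1 : nu < F x1.
  rewrite /F /B (rdecr_sym rw nx1) !mxE !eqxx mulr1; lra.
have [bw _ _] := C3_BL wC.
have cF : {within [set x : V | enorm x <= r], continuous F}.
  apply: continuous_subspaceT => x; apply: (@cvgB _ _ _ (nbhs x) _ w B); first exact: BL_continuous.
  apply: (@continuous_comp _ _ _ (fun x : V => (r - x ord0 i0) / s0) (@Num.sqrt R)); last exact: sqrt_continuous.
  apply: (@cvgM _ _ (nbhs x) _ (fun x : V => r - x ord0 i0) (fun=> s0^-1)); last exact: cvg_cst.
  apply: (@cvgB _ _ _ (nbhs x) _ (fun=> r) (fun x : V => x ord0 i0 : R)); first exact: cvg_cst.
  exact: coord_continuous.
have [|x xr xmax] := EVT_max_rV _ (cball_compact (r := r)) cF.
  by exists x1 => /=; rewrite nx1 ltW.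
rewrite inE /= in xr.
have Fx : nu < F x.
  by have := xmax x1; rewrite inE /= nx1 (ltW x0r) => /(_ erefl); exact: lt_le_trans.
have B0 y : 0 <= B y by exact: sqrtr_ge0.
have Fout y : r <= enorm y -> F y <= nu.
  by move=> /wr h; rewrite /F; have := B0 y; lra.
have xr' : enorm x < r.
  by rewrite ltNge; apply/negP => /Fout; rewrite leNgt Fx.
have Fmax y : F y <= F x.
  have [yr|/ltW/Fout yr] := leP (enorm y) r; first by apply: xmax; rewrite inE.
  exact: le_trans (ltW Fx).
pose s := r - x ord0 i0; pose b := B x.
have sp : 0 < s.
  rewrite subr_gt0 (le_lt_trans _ xr') // (le_trans _ (coord_le_enorm x i0)) //; exact: ler_norm.
have b1 : b <= 1 by move: Fx; rewrite /F -/b; have /andP[] := w01 x; lra.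
have b2 : b ^+ 2 = s / s0 by rewrite sqr_sqrtr // divr_ge0 // ltW.
have b0 : 0 < b by rewrite /b sqrtr_gt0 divr_gt0.
have ss0 : s <= s0.
  by rewrite -(mul1r s0) -ler_pdivrMr // -b2 exprn_ile1 // ltW.
have BE y : B (x + y) = b * Num.sqrt (1 - y ord0 i0 / s).
  rewrite /b /B -sqrtrM; last by rewrite divr_ge0 // ltW.
  congr Num.sqrt; rewrite mxE opprD addrA -/s; field; rewrite !gt_eqF //.
have wB y : w (x + y) - w x <= b * (Num.sqrt (1 - y ord0 i0 / s) - 1).
  by have := Fmax (x + y); rewrite /F BE -/b; lra.
have key i : p i x = (if i == i0 then - (b / s / 2) else 0) /\
             H i i x <= (if i == i0 then - (b / s ^+ 2 / 4) else 0).
  case: eqP => [->|/eqP ii].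
    apply: (touch_expansion (M := b / s ^+ 3) wC sp) => t ts.
    apply: le_trans (wB _) _; rewrite !mxE !eqxx mulr1.
    have := @sqrt1B_taylor (t / s); rewrite normrM normfV (gtr0_norm sp).
    rewrite ler_pdivrMr // mul1r => /(_ (ltW ts)) h.
    have := ler_wpM2l (ltW b0) h; set A := Num.sqrt _.
    have -> : b * (1 - t / s / 2 - (t / s) ^+ 2 / 8 + (`|t| / s) ^+ 3) =
       b + (- (b / s / 2) * t + 2^-1 * (- (b / s ^+ 2 / 4) * t ^+ 2) + b / s ^+ 3 * `|t| ^+ 3).
      by field; rewrite gt_eqF.
    lra.
  apply: (touch_expansion (M := 0) wC sp) => t _.
  apply: le_trans (wB _) _; rewrite !mxE (eq_sym i0) (negbTE ii) andbF mulr0 mul0r subr0 sqrtr1; lra.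
have linE y : lin p x y = - (b / s / 2) * y ord0 i0.
  rewrite /lin (bigD1 i0) //= big1 => [|l ll]; first by have [-> _] := key i0; rewrite eqxx addr0.
  by have [-> _] := key l; rewrite (negbTE ll) mul0r.
have incr_ub y : incr w p x y <=
    (b / s ^+ 2 / 2) * (\1_(eball rho) y * cut y) + (b / s / rho / 2 + 1) * cut y.
  have c0 := cut_ge0 y.
  have bs : 0 <= b / s by rewrite divr_ge0 // ltW.
  have T1 : 0 <= (b / s ^+ 2 / 2) * (\1_(eball rho) y * cut y).
    by rewrite !mulr_ge0 ?invr_ge0 ?exprn_ge0 ?(ltW b0) ?(ltW sp) // indicE.
  have T2 : 0 <= b / s / rho / 2 * cut y.
    by rewrite !mulr_ge0 ?invr_ge0 ?(ltW b0) ?(ltW sp) ?(ltW rho0).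
  rewrite /incr; have [y1|y1] := leP (enorm y) 1; last first.
    rewrite mul0r subr0; have /andP[_ w1] := w01 (x + y); have /andP[w0 _] := w01 x.
    have ww : w (x + y) - w x <= 1 by clear -j_levy j_radial i0 w0 w1; lra.
    by rewrite (cut_out (ltW y1)) in T1 T2 *; clear -j_levy j_radial i0 T1 T2 ww; lra.
  rewrite mul1r linE; set u := y ord0 i0 / s.
  have -> : - (b / s / 2) * y ord0 i0 = - (b * (u / 2)) by rewrite /u; ring.
  have := wB y; have := sqrt1B_le u; rewrite -/u le_min => /andP[h1 h2] h3.
  have g1 := ler_wpM2l (ltW b0) h1; have g2 := ler_wpM2l (ltW b0) h2.
  have yn := coord_le_enorm y i0; have n0 := enorm_ge0 y.
  rewrite (cut_in y1) in c0 T1 T2 *.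
  have [yr|yr] := ltP (enorm y) rho.
    have : b * (u ^+ 2 / 2) <= (b / s ^+ 2 / 2) * enorm y ^+ 2.
      have -> : b * (u ^+ 2 / 2) = (b / s ^+ 2 / 2) * `|y ord0 i0| ^+ 2.
        by rewrite real_normK ?num_real // /u; field; rewrite gt_eqF.
      rewrite ler_wpM2l ?lerXn2r ?nnegrE // !mulr_ge0 ?invr_ge0 ?exprn_ge0 ?(ltW b0) ?(ltW sp) //.
    by rewrite indicE in_eball yr mul1r in T1 *; lra.
  have : b * (`|u| / 2) <= b / s / rho / 2 * enorm y ^+ 2.
    have -> : b * (`|u| / 2) = b / s / 2 * `|y ord0 i0|.
      by rewrite /u normrM normfV (gtr0_norm sp); ring.
    apply: le_trans (_ : b / s / 2 * enorm y <= _); first by rewrite ler_wpM2l // divr_ge0.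
    have -> : b / s / rho / 2 * enorm y ^+ 2 = b / s / 2 * (enorm y * (enorm y / rho)) by ring.
    apply: ler_wpM2l; first by rewrite divr_ge0.
    by rewrite ler_peMr // ler_pdivlMr // mul1r.
  lra.
have LB : Lop j w p H x <= - (b / s ^+ 2 / 4) + ((b / s ^+ 2 / 2) * (1 / 4) + (b / s / rho / 2 + 1) * J).
  apply: lerD.
    rewrite (bigD1 i0) //= -[leRHS]addr0 lerD //.
      by have [_] := key i0; rewrite eqxx.
    apply: sumr_le0 => i ii; have [_] := key i; by rewrite (negbTE ii).
  have I1 := Lig_small_jumps rho; have I2 := Lig_cut_j0 j_levy.
  have bs2 : 0 <= b / s ^+ 2 / 2 by rewrite !divr_ge0 ?exprn_ge0 ?(ltW b0) ?(ltW sp).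
  apply: le_trans (_ : (b / s ^+ 2 / 2) * Lint (fun y => \1_(eball rho) y * (cut y * j0 j y)) +
     (b / s / rho / 2 + 1) * J <= _); last by rewrite lerD2r ler_wpM2l.
  rewrite /J /jmass -!LintZ // -LintD; [|exact: LigZ|exact: LigZ].
  apply: Lint_le; [exact: Lig_incr wC|by apply: LigD; exact: LigZ|move=> y].
  have := ler_wpM2r (j0_ge0 j_levy y) (incr_ub y); lra.
have := wK x; apply/negP; rewrite -ltNge (le_lt_trans LB) //.
(* The terms add up to at most [- be / 4 + be / 8 + be / 16 + J], and [16 * Z <= be] brings this
   down to [- Z + J < - K]. *)
pose be := b / s ^+ 2.
have beE : b / s / rho / 2 = be * (s / (2 * rho)) by rewrite /be; field; rewrite !gt_eqF.
have sJ : s / (2 * rho) * J <= 1 / 16.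
  rewrite mulrAC ler_pdivrMr ?mulr_gt0 //.
  have h : s0 * (8 * Z) = rho by rewrite /s0 divfK // mulf_neq0 // gt_eqF //; lra.
  have : s * J <= s0 * Z by rewrite ler_pM // ?(ltW sp) // /Z; lra.
  lra.
have be0 : 0 <= be by rewrite divr_ge0 ?exprn_ge0 ?(ltW b0) ?(ltW sp).
have beZ : 16 * Z <= be.
  rewrite ler_pdivlMr ?exprn_gt0 //.
  have bb : s / s0 <= b by rewrite -b2 expr2 ler_piMl // ltW.
  apply: le_trans bb; rewrite ler_pdivlMr //.
  have -> : 16 * Z * s ^+ 2 * s0 = s * (16 * Z * (s * s0)) by ring.
  rewrite ler_piMr // ?(ltW sp) //.
  have h : s0 * (8 * Z) = rho by rewrite /s0 divfK // mulf_neq0 // gt_eqF //; lra.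
  have s08 : s0 <= 1 / 8.
    by rewrite /s0 ler_pdivrMr ?mulr_gt0 //; [lra|lra].
  have : s * (s0 * (8 * Z)) <= 1 / 8 * 1.
    by rewrite h; apply: ler_pM; rewrite ?(ltW sp) ?(ltW rho0) ?(le_trans ss0).
  lra.
have := ler_wpM2l be0 sJ; rewrite beE -/be; rewrite /Z in beZ; clear -j_levy j_radial i0 beZ J0 K0; lra.
Qed.

End boundary_layer.

(** * The ball *)

Section ball_estimate.
Context {R : realType} {d : nat}.
Local Notation V := 'rV[R]_d.
Variables (j : V -> R) (i0 : 'I_d).
Hypotheses (j_levy : levy_density j) (j_radial : radially_decreasing j).
Implicit Types (u v w : V -> R) (p q : 'I_d -> V -> R) (H G : 'I_d -> 'I_d -> V -> R).
Implicit Types (x y z : V) (C : R).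

Lemma approximates_le C C' e m h k : C <= C' ->
  approximates j C' e m h k -> approximates j C e m h k.
Proof.
move=> CC [h1 h2 h3 h4 h5]; split => // w p H wC; exact: h5 (C3_le CC wC).
Qed.

(** As mollification commutes with [conv k], an inequality for one discrete step on a Lipschitz [u]
    becomes one for [Lop] of the mollified function, up to [e]. *)
Lemma approximates_moll C e m h k rho u p H : approximates j C e m h k -> 0 < rho ->
  BL u -> C3 C (conv (moll rho) u) p H -> forall x,
  `|conv (moll rho) (fun y => conv k u y - (1 - h * m) * u y) x / h
    - Lop j (conv (moll rho) u) p H x| <= e.
Proof.
move=> [/andP[h0 he] hm [Ik _ _] _ kL] rho0 bu wC x.
have [Im _ _] := @rkernel_moll R d rho rho0.
have := kL _ _ _ wC x; rewrite convB; [|exact: Im|exact: BL_conv|exact: BL_Z].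
by rewrite convZ // (convC _ Im Ik bu).
Qed.

Lemma approximates_moll_ge C e m h k rho u g p H : approximates j C e m h k -> 0 < rho ->
  BL u -> BL g -> C3 C (conv (moll rho) u) p H ->
  (forall x, h * g x <= conv k u x - (1 - h * m) * u x) ->
  forall x, conv (moll rho) g x - e <= Lop j (conv (moll rho) u) p H x.
Proof.
move=> ap rho0 bu bg wC ug x; have [/andP[h0 he] hm [Ik _ _] _ _] := ap.
have [Im m0 _] := @rkernel_moll R d rho rho0.
have := approximates_moll ap rho0 bu wC x.
have : conv (moll rho) (fun y => h * g y) x <=
    conv (moll rho) (fun y => conv k u y - (1 - h * m) * u y) x.
  apply: conv_le => //; first exact: BL_Z.
  by apply: BL_B; [exact: BL_conv|exact: BL_Z].
rewrite convZ // mulrC -ler_pdivlMr // ler_norml; lra.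
Qed.

Lemma approximates_moll_le C e m h k rho u g p H : approximates j C e m h k -> 0 < rho ->
  BL u -> BL g -> C3 C (conv (moll rho) u) p H ->
  (forall x, conv k u x - (1 - h * m) * u x <= h * g x) ->
  forall x, Lop j (conv (moll rho) u) p H x <= conv (moll rho) g x + e.
Proof.
move=> ap rho0 bu bg wC ug x; have [/andP[h0 he] hm [Ik _ _] _ _] := ap.
have [Im m0 _] := @rkernel_moll R d rho rho0.
have := approximates_moll ap rho0 bu wC x.
have : conv (moll rho) (fun y => conv k u y - (1 - h * m) * u y) x <=
    conv (moll rho) (fun y => h * g y) x.
  apply: conv_le => //; last exact: BL_Z.
  by apply: BL_B; [exact: BL_conv|exact: BL_Z].
rewrite convZ // (mulrC h (conv _ _ _)) -ler_pdivrMr // ler_norml; lra.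
Qed.

(** The inequality is [u_n <= u_(n+1)], divided by [u_n 0]: a value above [M] makes the source [h]
    at most [h / M]. *)
Lemma scheme_profile (m lam1 C e M h : R) k X n x0 : 0 <= m + lam1 -> approximates j C e m h k ->
  BL X -> rdecr X -> (forall x, 0 <= X x <= 1) -> 0 < M ->
  M < scheme k (h * (m + lam1)) h X n x0 ->
  exists om, [/\ BL om, rdecr om, om 0 = 1, forall x, 0 <= om x <= 1 &
    forall x, h * (m * om x - (m + lam1) * (X x * om x) - M^-1) <=
      conv k om x - (1 - h * m) * om x].
Proof.
move=> b0 [/andP[h0 he] hm rk kE _] bX rX X01 M0; have [Ik k0 _] := rk.
have X0 x : 0 <= X x by case/andP: (X01 x).
have a0 : 0 <= h * (m + lam1) by rewrite mulr_ge0 // ltW.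
pose u := scheme k (h * (m + lam1)) h X n; rewrite -/u => ubig.
have bu : BL u by exact: scheme_BL.
have u0 x : 0 <= u x by apply: scheme_ge0 => //; exact: ltW.
have ru : rdecr u by apply: scheme_rdecr => //; exact: ltW.
have u0big : M < u 0 by apply: lt_le_trans ubig _; apply: ru; rewrite enorm0 enorm_ge0.
have u00 : 0 < u 0 by exact: lt_trans u0big.
have uinv : (u 0)^-1 <= M^-1 by rewrite lef_pV2 ?posrE // ltW.
have ui0 : 0 < (u 0)^-1 by rewrite invr_gt0.
exists (fun x => (u 0)^-1 * u x); split.
- exact: BL_Z.
- by move=> x y /ru; rewrite ler_pM2l.
- by rewrite mulVf // gt_eqF.
- move=> x; rewrite mulr_ge0 ?(ltW ui0) //= mulrC ler_pdivrMr // mul1r.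
  by apply: ru; rewrite enorm0 enorm_ge0.
move=> x; rewrite (convZ _ _ Ik bu).
have := scheme_incr rk a0 (ltW h0) n x bX X0; rewrite /= -/u => hinc.
have := ler_wpM2l (ltW h0) uinv; have := ler_wpM2l (ltW ui0) hinc.
clearbody u; lra.
Qed.

(** Everywhere [X * om <= om] leaves [- lam1 * W]; beyond [r1 + rho] the mollifier only sees points
    where [X] vanishes, which leaves [m * W]. *)
Lemma moll_profile (m lam1 C e t h r1 rho : R) k X om p H : 0 < m -> 0 <= m + lam1 ->
  approximates j C e m h k -> 0 < rho ->
  BL X -> (forall x, 0 <= X x <= 1) -> (forall x, r1 <= enorm x -> X x = 0) ->
  BL om -> (forall x, 0 <= om x <= 1) ->
  (forall x, h * (m * om x - (m + lam1) * (X x * om x) - t) <=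
      conv k om x - (1 - h * m) * om x) ->
  let W := conv (moll rho) om in
  C3 C W p H -> forall x, [/\ 0 <= W x <= 1, - lam1 * W x - (t + e) <= Lop j W p H x &
    r1 + rho <= enorm x -> m * W x - (t + e) <= Lop j W p H x].
Proof.
move=> m0 b0 ap rho0 bX X01 Xout bom om01 omL W WC x.
have [Im mo0 _] := @rkernel_moll R d rho rho0.
have bXom : BL (fun x => X x * om x) by exact: BL_M.
have bg : BL (fun x => m * om x - (m + lam1) * (X x * om x) - t).
  apply: BL_B; last exact: BL_cst.
  by apply: BL_B; apply: BL_Z.
have om0 y : 0 <= om y by case/andP: (om01 y).
have Xom y : 0 <= X y * om y <= om y.
  by case/andP: (X01 y) => X0 X1; rewrite mulr_ge0 //= ler_piMl.
pose Y := conv (moll rho) (fun x => X x * om x).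
have := approximates_moll_ge ap rho0 bom bg WC omL x.
rewrite convB //; [|by apply: BL_B; apply: BL_Z|exact: BL_cst].
rewrite convB; [|exact: Im|exact: BL_Z|exact: BL_Z].
rewrite moll_cst // (convZ m _ Im bom) (convZ _ _ Im bXom) -/W -/Y => LW.
have W0 : 0 <= W x by exact: conv_ge0.
have W1 : W x <= 1.
  by rewrite -(moll_cst 1 x rho0); apply: conv_le => // [|y]; [exact: BL_cst|case/andP: (om01 y)].
have YW : Y x <= W x by apply: conv_le => // y; case/andP: (Xom y).
split; first by rewrite W0 W1.
  have := ler_wpM2l b0 YW; lra.
move=> xr; have Y0 : Y x <= 0.
  rewrite -[leRHS](moll_cst 0 x rho0); apply: moll_le => //; first exact: BL_cst.
  move=> y yr; rewrite Xout ?mul0r //.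
  by have := enormBD (x + y) y; rewrite addrK; lra.
have := ler_wpM2l b0 Y0; lra.
Qed.

(** By contradiction, from an iterate exceeding [M]. The lower bound [- K] on the operator is
    uniform in [m], which allows [m] to be chosen last, after the radius [rho0], the exponent [N],
    the tolerance [eta] and the width [dl]. *)
Lemma ball_bound (r lam lam1 : R) v : 0 < r -> lam1 < lam ->
  (C_plus (eball r) `&` C_b_plus) v ->
  viscosity_supersolution j (eball r) v (fun x => - lam * v x) ->
  exists m dl C e M, [/\ [/\ 0 <= m, 0 <= m + lam1, 0 < dl & 0 <= C], 0 < e &
   forall h k, approximates j C e m h k -> forall X, BL X -> rdecr X ->
     (forall x, 0 <= X x <= 1) -> (forall x, r + 2 * dl <= enorm x -> X x = 0) ->
     forall n x, scheme k (h * (m + lam1)) h X n x <= M].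
Proof.
move=> r0 lam1lam vC vsup.
pose K := `|lam1| + 2; have K0 : 0 <= K by rewrite addr_ge0.
have [rho0 [C1 [rho00 C10 center]]] := center_bound i0 j_levy j_radial K0.
pose rho1 := Num.min (rho0 / 2) (r / 2).
have rho10 : 0 < rho1 by rewrite lt_min !divr_gt0.
have rho1r : rho1 <= rho0 / 2 by rewrite ge_min lexx.
pose L := `|lam| + 1; have L0 : 0 <= L by rewrite addr_ge0.
(* The support has radius [2 r], so [hb] stays above [hr > 0] up to the sphere of radius [r]. *)
have [N hN] := bump_barrier j_levy (4 * r ^+ 2) rho10 (mulr_ge0 (ler0n R 4) L0).
have r20 : 0 < r ^+ 2 by rewrite exprn_gt0.
have [Ch hC] := @C3_bump R d N (4 * r ^+ 2) (mulr_ge0 (ler0n R 4) (ltW r20)).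
set hb := bump N.+3 (4 * r ^+ 2) in hN hC.
have hbE x y : enorm x <= enorm y -> hb y <= hb x.
  by move=> xy; apply: ppow_le; rewrite lerB // lerXn2r ?nnegrE ?enorm_ge0.
have hb0 x : 0 <= hb x by exact: ppow_ge0.
pose xr : V := r *: delta_mx ord0 i0.
have nxr : enorm xr = r by rewrite enormZ enorm_delta mulr1 gtr0_norm.
pose hr := hb xr; have hr0 : 0 < hr.
  by rewrite /hr /hb /bump nxr /ppow exprn_gt0 // lt_max; apply/orP; right; lra.
pose Q := (Ch * (d%:R + (3 + d%:R ^+ 2) * jmass j) + `|lam| * Ch) / (2 * hr).
have Ch0 := C3_ge0 hC.
have Q0 : 0 <= Q.
  apply: divr_ge0; last by rewrite mulr_ge0 // ltW.
  apply: addr_ge0; last by rewrite mulr_ge0.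
  by rewrite mulr_ge0 // addr_ge0 // mulr_ge0 ?jmass_ge0 // addr_ge0 ?exprn_ge0.
pose P := 2 * (1 + Q + `|lam|).
have P0 : 0 < P by rewrite mulr_gt0 // ltr_wpDr // ltr_wpDr.
(* Near the origin the errors add up to [eta * P / 2], at most half of [lam - lam1], against a gain
   of three quarters of it. *)
pose eta := Num.min (1 / 2) ((lam - lam1) / P).
have eta0 : 0 < eta by rewrite lt_min !divr_gt0 // subr_gt0.
have eta1 : eta <= 1 / 2 by rewrite ge_min lexx.
have etaP : eta * P <= lam - lam1 by rewrite -ler_pdivlMr // ge_min lexx orbT.
have [s0 [s00 layer]] := boundary_bound i0 j_levy K0.
have [bhb _ _] := C3_BL hC; have [Lh Lh0 hL] := BL_ge0 bhb.
(* The first bound limits the growth of [hb] across a layer of width [dl] to [hr / 4]; the second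
   makes the square root of [boundary_bound] at most [eta / 8] at depths up to [5 * dl]. *)
pose dl := Num.min (hr / (4 * (Lh + 1))) (s0 * (eta / 8) ^+ 2 / 6).
have e80 : 0 < (eta / 8) ^+ 2 by rewrite exprn_gt0 // divr_gt0.
have Lh1 : 0 < 4 * (Lh + 1) by rewrite mulr_gt0 // ltr_wpDl.
have dl0 : 0 < dl by rewrite lt_min (divr_gt0 hr0 Lh1) /= divr_gt0 // mulr_gt0.
have dlh : Lh * dl <= hr / 4.
  have : dl <= hr / (4 * (Lh + 1)) by rewrite ge_min lexx.
  rewrite ler_pdivlMr // => h; rewrite ler_pdivlMr //; clear -j_levy j_radial i0 h dl0; lra.
have dls : 6 * dl <= s0 * (eta / 8) ^+ 2.
  by rewrite mulrC -ler_pdivlMr // ge_min lexx orbT.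
have hbdl x : r - dl <= enorm x -> hb x <= 5 / 4 * hr.
  move=> xr'; have [h|h] := leP r (enorm x).
    by apply: le_trans (hbE xr x _) _; rewrite ?nxr // ler_peMl ?(ltW hr0) //; clear -j_levy j_radial i0; lra.
  pose y : V := enorm x *: delta_mx ord0 i0.
  have ny : enorm y = enorm x by rewrite enormZ enorm_delta mulr1 ger0_norm ?enorm_ge0.
  apply: le_trans (hbE y x _) _; first by rewrite ny.
  have := (hL y xr).2; have -> : enorm (y - xr) = r - enorm x.
    by rewrite -scalerBl enormZ enorm_delta mulr1 ler0_norm ?opprB // subr_le0 ltW.
  have : Lh * (r - enorm x) <= Lh * dl by rewrite ler_wpM2l //; clear -xr'; lra.
  rewrite ler_norml -/hr; clear -dlh; lra.
have lay_arith t : r - dl <= t -> t < r + 4 * dl ->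
    r + 4 * dl - t < s0 /\ Num.sqrt ((r + 4 * dl - t) / s0) <= eta / 8.
  move=> t1 t2.
  have e81 : (eta / 8) ^+ 2 <= 1.
    by rewrite exprn_ile1 ?divr_ge0 ?(ltW eta0) // ler_pdivrMr // mul1r (le_trans eta1) //; clear -j_levy j_radial i0; lra.
  have s08 : s0 * (eta / 8) ^+ 2 <= s0 * 1 by rewrite ler_wpM2l // ltW.
  split; first by clear -t1 t2 s08 dls dl0; lra.
  rewrite -(@ler_pXn2r _ 2) ?nnegrE ?sqrtr_ge0 ?divr_ge0 ?(ltW eta0) //.
  rewrite sqr_sqrtr; last by rewrite divr_ge0 ?(ltW s00) // subr_ge0 ltW.
  by rewrite ler_pdivrMr // mulrC; clear -t1 t2 dls dl0; lra.
pose rho := Num.min (rho0 / 2) dl; have rhop : 0 < rho by rewrite lt_min divr_gt0.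
have rhodl : rho <= dl by rewrite ge_min lexx orbT.
have rhorho : rho <= rho0 / 2 by rewrite ge_min lexx.
have [Cw wC] := @C3_moll R d rho 1 rhop.
have [||Cd [Cd0 far]] := @far_bound R d j i0 j_levy (r + 3 * dl) (r + 4 * dl).
- by rewrite addr_ge0 ?mulr_ge0 ?(ltW r0) ?(ltW dl0).
- by rewrite ltrD2l ltr_pM2r // ltr_nat.
(* Large enough for [Cd / m <= eta / 8] and [0 <= m + lam1]. *)
pose m := 8 * Cd / eta + `|lam1| + 1.
have mC : 8 * Cd / eta <= m by rewrite /m -addrA lerDl addr_ge0.
have Ce0 : 0 <= 8 * Cd / eta by rewrite !mulr_ge0 ?invr_ge0 ?(ltW eta0).
have m1 : `|lam1| + 1 <= m by rewrite /m -addrA lerDr.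
have m0 : 0 < m by apply: lt_le_trans m1; rewrite ltr_wpDl.
have b0 : 0 <= m + lam1 by have := ler_norm (- lam1); rewrite normrN; clear -j_levy j_radial i0 m1; lra.
have Cdm : Cd / m <= eta / 8.
  by rewrite ler_pdivrMr //; move: mC; rewrite ler_pdivrMr //; clear -j_levy j_radial i0; lra.
have profK t s : 0 <= t -> t <= 1 -> 0 <= s -> s <= 1 ->
    - K <= m * t - (m + lam1) * (s * t) - eta / 2.
  move=> t0 t1 ss0 ss1; have st : s * t <= t by rewrite ler_piMl.
  have := ler_wpM2l b0 st.
  have : lam1 * t <= `|lam1| * 1.
    by rewrite (le_trans (ler_norm _)) // normrM ler_pM // ger0_norm.
  rewrite /K; clear -eta1 ; lra.
have WK t : 0 <= t -> t <= 1 -> - K <= - lam1 * t - eta.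
  move=> t0 t1.
  have : lam1 * t <= `|lam1| * 1 by rewrite (le_trans (ler_norm _)) // normrM ler_pM // ger0_norm.
  rewrite /K; clear -eta1 ; lra.
have far_arith : r + 2 * dl + rho <= r + 3 * dl by clear -rhodl; lra.
exists m, dl, (Num.max C1 Cw), (eta / 2), (2 / eta); split => //.
- by split => //; [exact: ltW|rewrite le_max C10].
- by rewrite divr_gt0.
move=> h k ap X bX rX X01 Xout n x0.
have ap1 : approximates j C1 (eta / 2) m h k by apply: approximates_le ap; rewrite le_max lexx.
have ap2 : approximates j Cw (eta / 2) m h k by apply: approximates_le ap; rewrite le_max lexx orbT.
rewrite leNgt; apply/negP => ubig.
have Mp : 0 < 2 / eta by rewrite divr_gt0.
have [om [bom rom om00 om01 omL]] := scheme_profile b0 ap bX rX X01 Mp ubig.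
rewrite invf_div in omL.
have om34 x : enorm x <= rho0 -> 3 / 4 <= om x.
  have [/andP[h0 _] _ _ _ _] := ap.
  apply: (center _ _ _ _ _ ap1) => // [|y]; first by clear -eta1; lra.
  apply: le_trans (omL y).
  rewrite -mulrN ler_pM2l //; case/andP: (om01 y) => o0 o1; case/andP: (X01 y) => X0 X1.
  exact: profK.
have [p [H WC]] := wC om bom (fun x => ltac:(by case/andP: (om01 x) => o0 o1; rewrite ger0_norm)).
have prof := moll_profile m0 b0 ap2 rhop bX X01 Xout bom om01 omL WC.
pose W := conv (moll rho) om; rewrite -/W in WC prof.
have rW : rdecr W by apply: rdecr_conv => //; exact: rkernel_moll.
have W34 x : enorm x <= rho0 / 2 -> 3 / 4 <= W x.
  move=> xr'; rewrite -(moll_cst (3 / 4) x rhop); apply: moll_le => //; first exact: BL_cst.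
  move=> y yr; apply: om34; apply: le_trans (enormD x y) _.
  by rewrite [leRHS]splitr lerD // (le_trans (ltW yr)).
have W01 x : 0 <= W x <= 1 by case: (prof x).
have LWin x : - lam1 * W x - eta <= Lop j W p H x.
  by case: (prof x) => _; rewrite -splitr.
have LWK x : - K <= Lop j W p H x.
  by apply: le_trans (LWin x); case/andP: (W01 x) => w0 w1; exact: WK.
have Wfar x : r + 4 * dl <= enorm x -> W x <= eta / 8.
  move=> xr'; apply: le_trans Cdm; apply: (far _ _ _ _ _ WC) => // y yr.
  case: (prof y) => _ _; rewrite -splitr => /(_ (le_trans far_arith yr)) hy.
  apply: le_trans hy; rewrite lerB // (le_trans eta1) //; clear -eta0; lra.
have Wlay x : r - dl <= enorm x -> W x <= eta / 4.
  move=> xr'; have [xR|xR] := leP (r + 4 * dl) (enorm x).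
    by apply: le_trans (Wfar x xR) _; rewrite ler_pM2l // lef_pV2 ?posrE // ler_nat.
  have [sR sq] := lay_arith _ xr' xR.
  apply: le_trans (layer _ _ _ _ _ _ WC rW W01 _ LWK Wfar x xR sR) _.
    by rewrite divr_ge0 // ltW.
  by apply: le_trans (lerD (lexx _) sq) _; clear -eta0; lra.
(* With [a * hr = eta / 2], the function [W + a * hb - eta] is at most
   [eta / 4 + 5 / 8 * eta - eta < 0] from radius [r - dl] on, and at least [3 / 4 - eta > 0] at the
   origin. *)
pose a := eta / (2 * hr); have ap0 : 0 < a by rewrite divr_gt0 // mulr_gt0.
have ahr : a * hr = eta / 2 by rewrite /a; field; rewrite gt_eqF.
have TC := C3_D (C3_D WC (C3_Z a hC)) (C3_cst (- eta)).
have [|||x [xlt _]] := supersolution_compare (x0 := 0) (r' := r - dl) j_levy vC vsup TC.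
- by rewrite gtrBl.
- move=> x xr'; have := Wlay x xr'; have := hbdl x xr'; rewrite -(ler_pM2l ap0) -/hb.
  have -> : a * (5 / 4 * hr) = 5 / 4 * (eta / 2) by rewrite -ahr; ring.
  clear -eta0; lra.
- have := W34 0; rewrite enorm0 divr_ge0 ?(ltW rho00) // => /(_ erefl).
  have := mulr_ge0 (ltW ap0) (hb0 0); rewrite -/hb; clear -eta1; lra.
rewrite (LopD j_levy _ (C3_D WC (C3_Z a hC)) (C3_cst _)) Lop_cst addr0.
rewrite (LopD j_levy _ WC (C3_Z a hC)) (LopZ j_levy _ _ hC) -/hb.
apply/negP; rewrite -ltNge.
have := LWin x; case/andP: (W01 x) => w0 w1.
have hbx := hb0 x.
set A := Lop j W p H x; set B := Lop j hb _ _ _ => LA.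
have xr' : enorm x <= r by rewrite (le_trans (ltW xlt)) // gerBl ltW.
have [x1|x1] := leP rho1 (enorm x).
  have hx : hr <= hb x by apply: hbE; rewrite nxr.
  have hB : 4 * L * hb x <= B.
    apply: hN => //; apply: (@le_lt_trans _ _ (r ^+ 2)).
      by rewrite lerXn2r ?nnegrE ?enorm_ge0 ?(ltW r0).
    by rewrite ltr_pMl // ltr1n.
  have g1 : eta / 2 <= a * hb x by rewrite -ahr ler_pM2l.
  have g2 : 4 * (L * (a * hb x)) <= a * B.
    have -> : 4 * (L * (a * hb x)) = a * (4 * L * hb x) by ring.
    exact: (ler_wpM2l (ltW ap0) hB).
  have g3 : 0 <= (lam - lam1) * W x by rewrite mulr_ge0 // subr_ge0 ltW.
  have g4 := ler_wpM2l L0 g1.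
  have g5 : - (lam * (a * hb x)) <= `|lam| * (a * hb x).
    by rewrite -mulNr ler_wpM2r ?(le_trans _ g1) ?divr_ge0 ?(ltW eta0) // -normrN ler_norm.
  have g6 : lam * eta <= `|lam| * eta by rewrite ler_wpM2r ?(ltW eta0) // ler_norm.
  have g7 : 0 <= `|lam| * eta by rewrite mulr_ge0 ?(ltW eta0).
  rewrite /L in g2 g4; clear -LA g1 g2 g3 g4 g5 g6 g7 eta0.
  move: (a * hb x) (W x) g1 g2 g3 g4 g5 g6 LA => S w; lra.
have g0 : 3 / 4 <= W x by rewrite W34 // (le_trans (ltW x1)).
have hB : `|B| <= Ch * (d%:R + (3 + d%:R ^+ 2) * jmass j) by exact: Lop_bound.
have hxC : `|hb x| <= Ch by have [hh _ _ _] := hC.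
have g1 : (lam - lam1) * (3 / 4) <= (lam - lam1) * W x by rewrite ler_wpM2l // subr_ge0 ltW.
have g2 : - (eta * Q) <= a * B + lam * (a * hb x).
  have -> : eta * Q = a * (Ch * (d%:R + (3 + d%:R ^+ 2) * jmass j) + `|lam| * Ch).
    by rewrite /Q /a; ring.
  have -> : a * B + lam * (a * hb x) = a * (B + lam * hb x) by ring.
  rewrite -mulrN ler_pM2l //.
  have : `|lam * hb x| <= `|lam| * Ch by rewrite normrM ler_wpM2l.
  move: hB; rewrite !ler_norml; clear -eta0; lra.
have g6 : lam * eta <= `|lam| * eta by rewrite ler_wpM2r ?(ltW eta0) // ler_norm.
rewrite /P in etaP; have l0 : 0 < lam - lam1 by rewrite subr_gt0.
clear -LA g1 g2 g6 etaP l0.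
clearbody Q eta; lra.
Qed.

End ball_estimate.

(** * The domain *)

Section neighbourhoods.
Context {R : realType} {d : nat}.
Local Notation V := 'rV[R]_d.
Local Notation mu := (lebesgue_rV d).
Implicit Types (x y z : V) (D : set V).

Definition thicken D (t : R) : set V := [set x | exists2 y, D y & enorm (x - y) < t].

Lemma thicken_open D t : open (thicken D t).
Proof.
rewrite openE => x [y Dy xy]; apply/nbhs_enorm; exists (t - enorm (x - y)).
  by rewrite subr_gt0.
move=> z zx; exists y => //; rewrite -(subrK x z) -addrA.
by apply: le_lt_trans (enormD _ _) _; rewrite -ltrBrDr.
Qed.

(** The neighbourhoods of radius [n.+1%:R^-1] decrease to the closure, which has the measure of [D]
    because the boundary is null. Boundedness gives the finite measure that continuity from above
    asks for. *)
Lemma thicken_measure D (M : \bar R) : open D -> bounded_set D -> mu (boundary D) = 0%E ->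
  (mu D < M)%E -> exists2 t, 0 < t & (mu (thicken D t) < M)%E.
Proof.
move=> oD bD bd0 DM; apply: contrapT => h.
pose F n := thicken D n.+1%:R^-1.
have FM n : (M <= mu (F n))%E.
  by rewrite leNgt; apply/negP => hn; apply: h; exists n.+1%:R^-1.
have mF n : measurable (F n) by apply: open_measurable_rV; exact: thicken_open.
have IF : \bigcap_n F n = closure D.
  apply/seteqP; split => x.
    move=> Fx A /nbhs_enorm[r r0 rA].
    have [n nr] : exists n : nat, n.+1%:R^-1 < r.
      by have [n _ /(_ n (leqnn n))] := near_infty_natSinv_lt (PosNum r0); exists n.
    have [y Dy xy] := Fx n I; exists y; split => //; apply: rA.
    by rewrite enormB (lt_trans xy).
  move=> Dx n _; have n0 : 0 < n.+1%:R^-1 :> R by [].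
  have [|y [Dy yx]] := Dx [set y | enorm (y - x) < n.+1%:R^-1].
    by apply/nbhs_enorm; exists n.+1%:R^-1.
  by exists y => //; rewrite enormB.
have mD := open_measurable_rV oD.
have mc : measurable (closure D).
  by rewrite -[X in measurable X]setCK; apply: measurableC; apply: open_measurable_rV; exact/closed_openC/closed_closure.
have muc : mu (closure D) = mu D.
  have -> : closure D = D `|` boundary D.
    rewrite /boundary (interior_id _).1 //; apply/seteqP; split => x; last first.
      by case=> [/subset_closure|[]].
    by move=> Dx; have [?|?] := pselect (D x); [left|right].
  apply: measureU0 => //; rewrite /boundary; apply: measurableD => //.
  by apply: open_measurable_rV; exact: open_interior.
have F0 : (mu (F 0%N) < +oo)%E.
  have [r r0 rD] := bounded_enorm bD.
  apply: le_lt_trans (lebesgue_rV_eball_lty (r + 1)).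
  apply: le_measure; rewrite ?inE //; first exact: measurable_eball.
  move=> x [y Dy]; rewrite invr1 => xy; rewrite /eball /= -(subrK y x) addrC.
  by apply: le_lt_trans (enormD _ _) _; rewrite ltrD // rD.
have := nonincreasing_cvg_mu F0 mF; rewrite IF => /(_ mc) cF.
have {}cF : mu \o F @ \oo --> mu (closure D).
  apply: cF => n m nm; apply/subsetPset => x [y Dy xy]; exists y => //.
  by apply: lt_le_trans xy _; rewrite lef_pV2 ?posrE // ler_nat.
have cc : cvg (mu \o F @ \oo) by apply: cvgP cF.
have : (M <= limn (mu \o F))%E by apply: lime_ge => //; exact: nearW.
by rewrite (cvg_lim _ cF) // muc leNgt DM.
Qed.

Definition clamp (t : R) : R := Num.min 1 (Num.max 0 t).

Lemma clamp_rng t : 0 <= clamp t <= 1.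
Proof. by rewrite /clamp le_min ler01 le_max lexx ge_min lexx. Qed.

Lemma clamp1 t : 1 <= t -> clamp t = 1.
Proof. by move=> t1; rewrite /clamp min_l // le_max t1 orbT. Qed.

Lemma clamp0 t : t <= 0 -> clamp t = 0.
Proof. by move=> t0; rewrite /clamp max_l // min_r. Qed.

Lemma clamp_id t : 0 <= t <= 1 -> clamp t = t.
Proof. by case/andP => t0 t1; rewrite /clamp max_r // min_r. Qed.

Lemma clampE t : clamp t = if t <= 0 then 0 else if 1 <= t then 1 else t.
Proof.
case: (leP t 0) => [/clamp0//|t0]; case: (leP 1 t) => [/clamp1//|t1].
by rewrite clamp_id // !ltW.
Qed.

Lemma clamp_lip s t : `|clamp s - clamp t| <= `|s - t|.
Proof.
have [h1 h2] : - `|s - t| <= s - t /\ s - t <= `|s - t|.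
  by split; [exact: lerNnormlW|exact: ler_norm].
have n0 := normr_ge0 (s - t); rewrite ler_norml !clampE.
case: (leP s 0) => ?; case: (leP t 0) => ?; case: (leP 1 s) => ?; case: (leP 1 t) => ?;
  apply/andP; split; lra.
Qed.

Lemma clamp_homo : {homo clamp : s t / s <= t}.
Proof.
move=> s t st; rewrite !clampE.
case: (leP s 0) => ?; case: (leP t 0) => ?; case: (leP 1 s) => ?; case: (leP 1 t) => ?; lra.
Qed.

Definition edist D x : R := inf [set enorm (x - y) | y in D].

Lemma edist_le D x y : D y -> edist D x <= enorm (x - y).
Proof. by move=> Dy; apply: ge_inf; [exists 0 => _ [z _ <-]; exact: enorm_ge0|exists y]. Qed.

Lemma edist_lt D x t : D !=set0 -> edist D x < t -> thicken D t x.
Proof.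
move=> [z Dz] /inf_lt[|_ [y Dy <-] yt]; first by exists (enorm (x - z)); exists z.
by exists y.
Qed.

Lemma edist_lip D x y : D !=set0 -> `|edist D x - edist D y| <= enorm (x - y).
Proof.
move=> D0; have h a b : edist D a - edist D b <= enorm (a - b).
  rewrite lerBlDl addrC -lerBlDl; apply: lb_le_inf.
    by case: D0 => z Dz; exists (enorm (b - z)); exists z.
  move=> _ [z Dz <-]; rewrite lerBlDl; apply: le_trans (edist_le a Dz) _.
  by rewrite -(subrK b a) -addrA subrK enormD.
by rewrite ler_norml h lerNl opprB enormB h.
Qed.

Lemma exists_cutoff D t : 0 < t -> D !=set0 -> exists chi (L : R), [/\ 0 < L,
  forall x y, `|chi x - chi y| <= L * enorm (x - y), forall x, 0 <= chi x <= 1,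
  forall x y, D y -> enorm (x - y) <= t / 2 -> chi x = 1 &
  forall x, 0 < chi x -> thicken D t x].
Proof.
(* Affine in the distance to [D], equal to 1 at distance [t / 2] and to 0 at distance [t]. *)
move=> t0 D0; exists (fun x => clamp (2 - 2 / t * edist D x)), (2 / t).
split; first by rewrite divr_gt0.
- move=> x y; apply: le_trans (clamp_lip _ _) _.
  have -> : 2 - 2 / t * edist D x - (2 - 2 / t * edist D y) =
    (2 / t) * (edist D y - edist D x) by ring.
  rewrite normrM gtr0_norm ?divr_gt0 // ler_pM2l ?divr_gt0 // enormB.
  exact: edist_lip.
- by move=> x; exact: clamp_rng.
- move=> x y Dy xy; rewrite clamp1 //.
  have := le_trans (edist_le x Dy) xy; rewrite ler_pdivlMr // => h.
  have : 2 / t * edist D x <= 1 by rewrite mulrAC ler_pdivrMr // mul1r mulrC.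
  lra.
- move=> x h; apply: edist_lt => //; rewrite ltNge; apply/negP => tx.
  move: h; rewrite clamp0 ?ltxx // subr_le0 mulrAC ler_pdivlMr //.
  by rewrite ler_pM2l.
Qed.

End neighbourhoods.

Section transfer.
Context {R : realType} {d : nat}.
Local Notation V := 'rV[R]_d.
Local Notation mu := (lebesgue_rV d).
Implicit Types (u v w f : V -> R) (x y z : V) (D : set V) (C : R).

Lemma polarize_comp e c u (g : R -> R) : {homo g : s t / s <= t} ->
  polarize e c (fun x => g (u x)) = (fun x => g (polarize e c u x)).
Proof.
move=> gh; apply/funext => x; rewrite /polarize.
set a := u x; set b := u _; case: ifP => _.
  have [ab|/ltW ab] := leP a b; first by rewrite (max_idPr _) // gh.
  by rewrite (max_idPl _) // gh.
have [ab|/ltW ab] := leP a b; first by rewrite (min_idPl _) // gh.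
by rewrite (min_idPr _) // gh.
Qed.

Lemma BL_lip u (L : R) : (forall x y, `|u x - u y| <= L * enorm (x - y)) ->
  (forall x, 0 <= u x <= 1) -> BL u.
Proof.
move=> uL u01; exists (`|L| + 1) => x y; case/andP: (u01 x) => u0 u1; split.
  by rewrite ger0_norm // (le_trans u1) // lerDr.
apply: le_trans (uL x y) _; rewrite ler_wpM2r ?enorm_ge0 //.
by rewrite (le_trans (ler_norm _)) // lerDl.
Qed.

(** * Damping of the iteration *)

Section damping.
Variables (k : V -> R) (a h s : R).
Hypotheses (rk : rkernel k) (a0 : 0 <= a) (h0 : 0 <= h) (s1 : 1 <= s).
Local Notation k' := (fun y => s^-1 * k y).

Lemma rkernel_damped : rkernel k'.
Proof.
have [Ik k0 kd] := rk; have s0 : 0 <= s^-1 by rewrite invr_ge0 (le_trans ler01).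
split; [exact: LigZ|by move=> y; rewrite mulr_ge0|].
by move=> y z yz; rewrite ler_wpM2l // kd.
Qed.

(** Increments obey the homogeneous recursion, so dividing [k] and [a] by [s] divides the increment
    at stage [n] by [s ^+ n]. The source [h] is not damped, hence the first increments agree. This
    gives almost stationary iterates without any convergence argument. *)
Lemma scheme_damped f n x : BL f ->
  s ^+ n * (scheme k' (a / s) h f n.+1 x - scheme k' (a / s) h f n x) =
  scheme k a h f n.+1 x - scheme k a h f n x.
Proof.
have [Ik _ _] := rk; have rk' := rkernel_damped; have s0 : s != 0 by rewrite gt_eqF // (lt_le_trans ltr01).
move=> bf; elim: n x => [|n IH] x.
  by rewrite /= !conv_cst ?Lint0 ?mul0r //; [rewrite expr0; ring|case: rk'].
have b1 := scheme_BL (a / s) h rk' n.+1 bf; have b0 := scheme_BL (a / s) h rk' n bf.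
have c1 := scheme_BL a h rk n.+1 bf; have c0 := scheme_BL a h rk n bf.
have E k1 b : scheme k1 b h f n.+2 x - scheme k1 b h f n.+1 x =
  conv k1 (scheme k1 b h f n.+1) x + b * (f x * scheme k1 b h f n.+1 x) + h -
  (conv k1 (scheme k1 b h f n) x + b * (f x * scheme k1 b h f n x) + h) by [].
rewrite !E; move: IH b1 b0 c1 c0; set v1 := scheme k' _ _ _ n.+1; set v0 := scheme k' _ _ _ n.
set u1 := scheme k _ _ _ n.+1; set u0 := scheme k _ _ _ n => IH b1 b0 c1 c0.
rewrite !conv_kZ //.
have -> : conv k u1 x + a * (f x * u1 x) + h - (conv k u0 x + a * (f x * u0 x) + h) =
   conv k u1 x - conv k u0 x + a * (f x * (u1 x - u0 x)) by ring.
rewrite -(convB _ Ik c1 c0) -IH.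
have -> : conv k (fun y => u1 y - u0 y) x = s ^+ n * (conv k v1 x - conv k v0 x).
  rewrite -(convB _ Ik b1 b0) -convZ //; last exact: BL_B.
  by congr conv; apply/funext => y; rewrite IH.
by rewrite exprS; field.
Qed.

Lemma scheme_damped_le f n x : BL f -> (forall x, 0 <= f x) ->
  scheme k' (a / s) h f n x <= scheme k a h f n x.
Proof.
have [Ik k0 _] := rk; have rk' := rkernel_damped; move=> bf f0.
have sp : 0 < s by exact: lt_le_trans s1.
have si : s^-1 <= 1 by rewrite invf_le1.
have as0 : 0 <= a / s by rewrite divr_ge0 // ltW.
elim: n x => [|n IH] x //=; rewrite lerD2r.
have bn := scheme_BL (a / s) h rk' n bf.
have u0 y : 0 <= scheme k' (a / s) h f n y by exact: scheme_ge0.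
rewrite conv_kZ //; apply: lerD.
  apply: le_trans (_ : conv k (scheme k' (a / s) h f n) x <= _).
    by rewrite ler_piMl // conv_ge0.
  by apply: conv_le => //; exact: scheme_BL.
apply: ler_pM => //; first by rewrite mulr_ge0.
  by rewrite ler_piMr.
by rewrite ler_wpM2l.
Qed.

End damping.

Lemma exp_unbounded (s y : R) : 1 < s -> exists n, y <= s ^+ n.
Proof.
move=> s1; have B n : 1 + n%:R * (s - 1) <= s ^+ n.
  elim: n => [|n IH]; first by rewrite mul0r addr0 expr0.
  rewrite exprS -natr1; have := ler_wpM2l (ltW (lt_trans ltr01 s1)) IH.
  have : 0 <= n%:R * (s - 1) ^+ 2 by rewrite mulr_ge0 ?sqr_ge0.
  lra.
exists (Num.truncn (y / (s - 1))).+1; apply: le_trans (B _).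
have := ltW (truncnS_gt (y / (s - 1))); rewrite ler_pdivrMr ?subr_gt0 //; lra.
Qed.

(** In positive dimension the shell between the two spheres contains a nonempty open set, of
    positive measure. *)
Lemma eball_measure_lt (r s : R) : 0 <= r -> r < s -> (0 < d)%N ->
  (mu (eball r) < mu (eball s))%E.
Proof.
move=> r0 rs d0; pose i0 := Ordinal d0.
pose S := [set x : V | r < enorm x < s].
have oS : open S.
  have -> : S = eball s `&` (@enorm R d @^-1` [set t | r < t]).
    by apply/seteqP; split => x; rewrite /S /eball /=; [case/andP|case=> h1 h2; apply/andP].
  apply: openI; first exact: eball_open.
  by apply: open_comp => [x _|]; [exact: enorm_continuous|exact: open_gt].
have S0 : S !=set0.
  exists (((r + s) / 2) *: delta_mx ord0 i0); rewrite /S /= enormZ enorm_delta mulr1.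
  rewrite ger0_norm; [apply/andP; split; lra|lra].
have h : (mu (eball r `|` S) <= mu (eball s))%E.
  apply: le_measure; rewrite ?inE; [apply: measurableU| |].
  - exact: measurable_eball.
  - exact: open_measurable_rV.
  - exact: measurable_eball.
  - by move=> x []; [move=> /= xr; exact: lt_trans rs|case/andP].
apply: lt_le_trans h; rewrite measureU; [|exact: measurable_eball|exact: open_measurable_rV|].
  rewrite lteDl; first exact: lebesgue_rV_open_gt0.
  by rewrite ge0_fin_numE // lebesgue_rV_eball_lty.
apply/seteqP; split => x //=; rewrite /eball /S /= => -[xr /andP[rx _]].
by have := lt_trans xr rx; rewrite ltxx.
Qed.

End transfer.

Section domain.
Context {R : realType} {d : nat}.
Local Notation V := 'rV[R]_d.
Local Notation mu := (lebesgue_rV d).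
Variables (j : V -> R) (i0 : 'I_d).
Hypotheses (j_levy : levy_density j) (j_radial : radially_decreasing j).
Implicit Types (u v w f : V -> R) (x y z : V) (D : set V) (C : R).

Lemma BL_clamp u (L : R) (g : R -> R) : (forall x y, `|u x - u y| <= L * enorm (x - y)) ->
  (forall s t, `|g s - g t| <= 2 * `|s - t|) -> (forall t, 0 <= g t <= 1) ->
  BL (fun x => g (u x)).
Proof.
move=> uL gL g01; apply: (@BL_lip _ _ _ (2 * L)) => [x y|x]; last exact: g01.
by apply: le_trans (gL _ _) _; rewrite -mulrA ler_pM2l.
Qed.

(* Polarization only brings [chi] below 1 / 2 outside a ball; the positive part
   of [2 chi - 1] turns this into a condition on the support. *)
Lemma scheme_rearranged (k : V -> R) (a h r s t L M RD : R) chi :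
  rkernel k -> 0 <= a -> 0 <= h -> 0 <= r -> r < s -> s < t -> 0 < L ->
  (forall x y, `|chi x - chi y| <= L * enorm (x - y)) ->
  (forall x, 0 <= chi x <= 1) -> (forall x, RD <= enorm x -> chi x = 0) ->
  Lint (fun z => (0 < chi z)%R%:R) < Lint (\1_(eball r) : V -> R) ->
  (forall X, BL X -> rdecr X -> (forall x, 0 <= X x <= 1) ->
    (forall x, t <= enorm x -> X x = 0) -> forall n x, scheme k a h X n x <= M) ->
  forall n x, scheme k a h (fun x => clamp (2 * chi x - 1)) n x <= M.
Proof.
move=> rk a0 h0 r0 rs st L0 chiL chi01 chi0 chim hM.
pose g (t : R) := clamp (2 * t - 1).
have g01 b : 0 <= g b <= 1 by exact: clamp_rng.
have g0 (u : V -> R) x : 0 <= g (u x) by case/andP: (g01 (u x)).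
have gL a1 a2 : `|g a1 - g a2| <= 2 * `|a1 - a2|.
  apply: le_trans (clamp_lip _ _) _.
  have -> : 2 * a1 - 1 - (2 * a2 - 1) = 2 * (a1 - a2) by ring.
  by rewrite normrM ger0_norm.
have gh : {homo g : b c / b <= c} by move=> b c bc; apply: clamp_homo; lra.
(* The implication runs from a bound for the polarized function back to [chi]. As [g] is
   nondecreasing, it commutes with polarization. *)
pose P u := (forall n x, scheme k a h (fun x => g (u x)) n x <= M) ->
  forall n x, scheme k a h (fun x => g (chi x)) n x <= M.
have [|u e c uL u01 e1 c0 Pu Pp|u [Pu uL u01 us]] := @polarization_chain _ _ P chi L RD s r
  L0 r0 rs chiL chi01 chi0 chim.
- by [].
- apply: Pu => n; have bu := BL_clamp uL gL g01.
  have bp : BL (fun x => g (polarize e c u x)).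
    by rewrite -polarize_comp //; exact: BL_polarize.
  apply: (pol_ub e1 (w' := scheme k a h (fun x => g (polarize e c u x)) n)); last exact: Pp.
  apply: scheme_pol => //; rewrite -polarize_comp //; exact: pol_polarize.
apply: Pu => n x; have ts : 0 < t - s by rewrite subr_gt0.
(* A radial cut-off above [g (u y)]: it is 1 up to radius [s], and [u < 1 / 2] gives [g (u y) = 0]
   from there on. *)
pose X (y : V) := clamp ((t - enorm y) / (t - s)).
have X01 y : 0 <= X y <= 1 by exact: clamp_rng.
have bX : BL X.
  apply: (@BL_lip _ _ _ (t - s)^-1) => // y z; apply: le_trans (clamp_lip _ _) _.
  rewrite -mulrBl normrM (gtr0_norm (x := (t - s)^-1)) ?invr_gt0 // mulrC ler_pM2l ?invr_gt0 //.
  rewrite (_ : t - enorm y - (t - enorm z) = enorm z - enorm y); last by ring.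
  by rewrite distrC; exact: ler_enormB.
apply: (le_trans _ (hM X bX _ X01 _ n x)).
- apply: scheme_le => //; first exact: BL_clamp uL gL g01.
  move=> y; have [ys|ys] := leP s (enorm y).
    by rewrite /g clamp0; [case/andP: (X01 y)|have := us y ys; lra].
  rewrite /X clamp1; first by case/andP: (g01 (u y)).
  by rewrite ler_pdivlMr // mul1r lerB // ltW.
- by move=> y z yz; apply: clamp_homo; rewrite ler_pM2r ?invr_gt0 // lerB.
- by move=> y ty; rewrite /X clamp0 // pmulr_lle0 ?invr_gt0 // subr_le0.
Qed.

Lemma domain_supersolution D (r lam lam' : R) v : open D -> bounded_set D -> D !=set0 ->
  mu (boundary D) = 0%E -> mu (eball r) = mu D -> 0 < r -> lam' < lam ->
  (C_plus (eball r) `&` C_b_plus) v ->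
  viscosity_supersolution j (eball r) v (fun x => - lam * v x) ->
  exists2 w, (C_plus D `&` C_b_plus) w &
    viscosity_supersolution j D w (fun x => - lam' * w x).
Proof.
move=> oD bD D0 bd0 DB r0 ll vC vsup.
have one21 : 1 <= 2 * 1 - 1 :> R by lra.
(* Half of the gap is spent on [ball_bound], the other half on damping. *)
pose th := (lam - lam') / 2; have th0 : 0 < th by rewrite divr_gt0 // subr_gt0.
pose lam1 := lam' + th; have lam1l : lam1 < lam by rewrite /lam1 /th; lra.
have [m [dl [C [e [M [[m0 b0 dl0 C0] e0 hM]]]]]] := ball_bound i0 j_levy j_radial r0 lam1l vC vsup.
have r1 : 0 <= r + dl / 2 by rewrite addr_ge0 ?divr_ge0 // ltW.
have DM : (mu D < mu (eball (r + dl / 2)))%E.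
  rewrite -DB; apply: eball_measure_lt; rewrite ?(ltW r0) //.
    by rewrite ltrDl divr_gt0.
  exact: leq_ltn_trans (ltn_ord i0).
have [t t0 tM] := thicken_measure oD bD bd0 DM.
have [chi [L [L0 chiL chi01 chi1 chit]]] := exists_cutoff t0 D0.
have [RD RD0 DRD] := bounded_enorm bD.
have bchi := BL_lip chiL chi01.
have chi0 x : RD + t <= enorm x -> chi x = 0.
  move=> xR; apply/eqP; rewrite eq_le; case/andP: (chi01 x) => -> _; rewrite andbT leNgt.
  apply/negP => /chit[y /DRD yR xy].
  by have := enormD y (x - y); rewrite addrC subrK; lra.
have chim : Lint (fun z => (0 < chi z)%R%:R) < Lint (\1_(eball (r + dl / 2)) : V -> R).
  pose A := [set z | 0 < chi z].
  have -> : (fun z => (0 < chi z)%R%:R : R) = \1_A.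
    apply/funext => z; rewrite indicE; have [h|h] := ltP 0 (chi z); first by rewrite mem_set.
    by rewrite memNset //= /A /= ltNge h.
  have mA : measurable A.
    apply: open_measurable_rV; apply: (@open_comp _ _ chi [set s | 0 < s]); last exact: open_gt.
    by move=> z _; exact: BL_continuous.
  have AM : (mu A < mu (eball (r + dl / 2)))%E.
    apply: le_lt_trans tM; apply: le_measure; rewrite ?inE //.
    by apply: open_measurable_rV; exact: thicken_open.
  rewrite !Lint_indic //; last exact: measurable_eball.
  have Boo := @lebesgue_rV_eball_lty R d (r + dl / 2).
  by apply: fine_lt => //; rewrite ge0_fin_numE // (lt_trans AM).
(* The cut-off is 1 within [t / 2] of [D], so at points of [D] the mollifier only sees [f = 1]. *)
pose rho := t / 2; have rho0 : 0 < rho by rewrite divr_gt0.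
have [Cw wC] := @C3_moll R d rho M rho0.
(* The source of the scheme counts for 1: one half covers the last increment, see [Uinc], the other
   half the error [e']. *)
pose e' := Num.min e (1 / 2); have e'0 : 0 < e' by rewrite lt_min e0 divr_gt0.
have C'0 : 0 <= Num.max C Cw by rewrite le_max C0.
have [h [k ap]] := approximation j_levy j_radial i0 m0 C'0 e'0.
have {ap} ap : approximates j (Num.max C Cw) e' m h k := ap.
have apw : approximates j Cw e' m h k by apply: approximates_le ap; rewrite le_max lexx orbT.
have apb : approximates j C e m h k.
  have [/andP[h0 he] hm rk kE kL] : approximates j C e' m h k.
    by apply: approximates_le ap; rewrite le_max lexx.
  have ee : e' <= e by rewrite ge_min lexx.
  split => //; first by rewrite h0 (le_trans he).
  by move=> w p H wwC x; apply: le_trans ee; exact: kL wwC x.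
have [/andP[h0 he] hm rk kE _] := ap; have [Ik k0 _] := rk.
pose a := h * (m + lam1); have a0 : 0 <= a by rewrite mulr_ge0 // ltW.
pose f x := clamp (2 * chi x - 1).
have f01 x : 0 <= f x <= 1 by exact: clamp_rng.
have f0 x : 0 <= f x by case/andP: (f01 x).
have bf : BL f.
  apply: (@BL_clamp chi L (fun t => clamp (2 * t - 1)) chiL); last by move=> ?; exact: clamp_rng.
  move=> a1 a2; apply: le_trans (clamp_lip _ _) _.
  have -> : 2 * a1 - 1 - (2 * a2 - 1) = 2 * (a1 - a2) by ring.
  by rewrite normrM ger0_norm.
have uM n x : scheme k a h f n x <= M.
  (* The three radii bound the volume of the enlarged domain, the region left by the polarizations,
     and the support of the radial cut-off. *)
  apply: (@scheme_rearranged k a h (r + dl / 2) (r + dl) (r + 2 * dl) L M (RD + t) chi) => //.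
  - exact: ltW.
  - by rewrite ltrD2l ltr_pdivrMr // mulr_natr mulr2n ltrDl.
  - by rewrite ltrD2l mulr_natl mulr2n ltrDl.
  - by move=> X bX rX X01 X0 n' x'; exact: (hM h k apb).
pose s := 1 + h * th; have hth : 0 < h * th by rewrite mulr_gt0.
have s1 : 1 < s by rewrite ltrDl.
have s0 : 0 < s by exact: lt_trans s1.
(* With this [n] the damped increments, at most [M / s ^+ n], fall below [h / 2]. *)
have [n nM] := exp_unbounded (2 * M / h) s1.
pose k' y := s^-1 * k y.
have rk' : rkernel k' := rkernel_damped rk (ltW s1).
have [Ik' k'0 _] := rk'.
have as0 : 0 <= a / s by rewrite divr_ge0 // ltW.
pose U := scheme k' (a / s) h f n.+1.
have bU : BL U by exact: scheme_BL.
have U0 x : 0 <= U x by apply: scheme_ge0 => //; exact: ltW.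
have UM x : U x <= M.
  apply: le_trans (uM n.+1 x); exact: (scheme_damped_le rk a0 (ltW h0) (ltW s1)).
(* The last step alone adds [h]; this makes the mollified iterate strictly positive. *)
have Uh x : h <= U x.
  rewrite /U /= lerDr addr_ge0 //; last first.
    by rewrite mulr_ge0 // mulr_ge0 //; apply: scheme_ge0 => //; exact: ltW.
  by apply: conv_ge0 => // y; apply: scheme_ge0 => //; exact: ltW.
have Uinc x : conv k' U x + a / s * (f x * U x) + h <= U x + h / 2.
  have := scheme_damped a h rk (ltW s1) n.+1 x bf; rewrite -/k' -/U => hd.
  have E : scheme k' (a / s) h f n.+2 x = conv k' U x + a / s * (f x * U x) + h by [].
  rewrite -E -lerBlDl.
  have sn : s ^+ n <= s ^+ n.+1 by rewrite ler_eXn2l // ltW.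
  have sn0 : 0 < s ^+ n.+1 by rewrite exprn_gt0.
  rewrite -(ler_pM2l sn0) hd.
  have u1 := uM n.+2 x; have u2 := scheme_ge0 rk a0 (ltW h0) n.+1 x f0.
  apply: le_trans (_ : M <= _); first by rewrite -[leRHS]subr0 lerB.
  have nM' := le_trans nM sn; rewrite ler_pdivrMr // in nM'; clear -nM'; lra.
pose g x := (m + th) * U x - (m + lam1) * (f x * U x) - 2^-1.
have bfU : BL (fun x => f x * U x) by exact: BL_M.
have bg : BL g.
  apply: BL_B; last exact: BL_cst.
  by apply: BL_B; apply: BL_Z.
have UL x : conv k U x - (1 - h * m) * U x <= h * g x.
  have := ler_wpM2l (ltW s0) (Uinc x); rewrite (conv_kZ _ _ Ik bU).
  have -> : s * (s^-1 * conv k U x + a / s * (f x * U x) + h) =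
     conv k U x + a * (f x * U x) + s * h by field; rewrite gt_eqF.
  have : h <= s * h by rewrite ler_peMl ?(ltW h0) ?(ltW s1).
  rewrite /g /a /s; clear -h0; lra.
have [|p [H WC]] := wC U bU; first by move=> x; rewrite ger0_norm.
pose w := conv (moll rho) U; rewrite -/w in WC.
have [Im mo0 _] := @rkernel_moll R d rho rho0.
have wh x : h <= w x.
  rewrite -[leLHS](moll_cst h x rho0); apply: conv_le => //; exact: BL_cst.
have [bw _ _] := C3_BL WC; have cw := BL_continuous bw.
exists w.
  split; [split => [|x _]|split => [||x]].
  - exact: continuous_subspaceT.
  - exact: lt_le_trans (wh x).
  - exact: cw.
  - have [hC _ _ _] := WC; exists Cw; split; first exact: num_real.
    by move=> B CB x _; rewrite /= (le_trans (hC x)) // ltW.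
  - exact: le_trans (ltW h0) (wh x).
apply: (viscosity_of_classical j_levy WC oD) => x Dx.
have := approximates_moll_le apw rho0 bU bg WC UL x; rewrite -/w.
rewrite convB //; [|by apply: BL_B; apply: BL_Z|exact: BL_cst].
rewrite convB; [|exact: Im|exact: BL_Z|exact: BL_Z].
rewrite moll_cst // (convZ _ _ Im bU) (convZ _ _ Im bfU) -/w => Lw.
have fU : w x <= conv (moll rho) (fun x => f x * U x) x.
  apply: (moll_le rho0 bU bfU) => y yr.
  have c1 : chi (x + y) = 1 by apply: (chi1 _ x Dx); rewrite addrC addKr ltW.
  have f1 : f (x + y) = 1 by rewrite /f c1 clamp1.
  by rewrite f1 mul1r.
have := ler_wpM2l b0 fU; have : e' <= 1 / 2 by rewrite ge_min lexx orbT.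
move: Lw; rewrite /lam1; clear -h0; lra.
Qed.

End domain.

Theorem theorem1p5 (R : realType) (d : nat) (j : 'rV[R]_d -> R)
  (j_levy : levy_density j) (j_A1 : condition_A1 j)
  (j_radial : radially_decreasing j)
  (D : set 'rV[R]_d) (D_bounded : bounded_set D) (D_open : open D)
  (D_boundary : lebesgue_rV d (boundary D) = 0%E)
  (r : R) (ball_volume : lebesgue_rV d (eball r) = lebesgue_rV d D) :
  (principal_eigenvalue j (eball r) <= principal_eigenvalue j D)%E.
Proof.
(* Nonempty open sets have positive measure, so [D] is empty exactly when the ball is. *)
have [r0|r0] := leP r 0.
  have B0 : @eball R d r = set0.
    by rewrite -subset0 => x /(le_lt_trans (enorm_ge0 x)); rewrite ltNge r0.
  suff -> : D = set0 by rewrite B0.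
  apply/eqP/negPn/negP => /set0P D0; have := lebesgue_rV_open_gt0 D_open D0.
  by rewrite -ball_volume B0 measure0 ltxx.
have D0 : D !=set0.
  apply/set0P/eqP => D0; have : (0 < lebesgue_rV d (@eball R d r))%E.
    by apply: lebesgue_rV_open_gt0; [exact: eball_open|exists 0; rewrite /eball /= enorm0].
  by rewrite ball_volume D0 measure0 ltxx.
(* In dimension 0 both sets are the whole one-point space; otherwise there is a coordinate to serve
   as [i0]. *)
case: (posnP d) => [d0|d0].
  suff -> : D = eball r by [].
  have all0 (x : 'rV[R]_d) : x = 0 by apply/rowP => -[i hi]; exfalso; rewrite d0 in hi.
  have [y Dy] := D0; apply/seteqP; split => x _.
    by rewrite /eball /= (all0 x) enorm0.
  by rewrite (all0 x) -(all0 y).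
apply: ge_ereal_sup => _ [lam [v vC vsup] <-].
(* The domain attains every level strictly below [lam], which suffices for the suprema. *)
apply/lee_subgt0Pr => e e0; rewrite -EFinB; apply: ereal_sup_ubound.
have [|w wC wsup] := domain_supersolution (Ordinal d0) (lam' := lam - e) j_levy j_radial
  D_open D_bounded D0 D_boundary ball_volume r0 _ vC vsup.
  by rewrite gtrBl.
by exists (lam - e) => //; exists w.
Qed.
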